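(* Let $h_M>0$, let $A \subset \mathbb{R}^r$, and let $f : A \times \mathcal{C}^0([-h_M,0];\mathbb{R}^n) \rightarrow \mathbb{R}^n$ be a continuous function such that $f(\cdot,0)=0$ and $f$ is locally Lipschitz continuous with respect to the second argument. Let $\mathcal{H}$ be any subset of $\mathcal{C}^0(\mathbb{R}_+; \mathbb{R}^r)$ that is forward invariant and that satisfies $\zeta(t) \in A$ for all $\zeta \in \mathcal{H}$ and all $t \geq 0$. Consider the retarded differential equation $$\dot{x}(t) = f(\zeta(t),x_t), \quad t \geq 0, \qquad x(\tau) = x_0(\tau), \quad \tau\in[-h_M,0], \qquad (\ast)$$ where $x_0 \in \mathcal{C}^0([-h_M,0];\mathbb{R}^n)$ and $\zeta \in \mathcal{H}$. For a given $H > 0$, assume that the restriction of $f$ to $A \times \{ \phi \in \mathcal{C}^0([-h_M,0];\mathbb{R}^n) : \Vert \phi \Vert_\infty \leq H \}$ is Lipschitz continuous with respect to the second argument, uniformly with respect to the first argument. Let there exist a continuous functional $V : A \times W \rightarrow\mathbb{R}$ and $\omega_1 , \omega_2 \in \mathcal{K}$ such that $$\omega_1(\Vert \phi(0) \Vert) \leq V(\xi,\phi) \leq \omega_2(\Vert \phi \Vert_W)$$ for all $\xi \in A$ and $\phi \in Q_H$. For any $x_0 \in W$ and $\zeta \in \mathcal{H}$, introducing $V_\zeta(t) = V(\zeta(t),x_t)$ with $x$ the trajectory of $(\ast)$, assume that $$D^+V_\zeta(t) \leq 0 \quad \text{as soon as } x_t \in Q_H.$$ Then $(\ast)$ is $(\mathcal{C}^0([-h_M,0];\mathbb{R}^n),\mathcal{H})$-stable.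 Moreover, if there exists $\omega_3 \in \mathcal{K}$ such that (for any $x_0\in W$ and $\zeta\in\mathcal{H}$) $$D^+ V_\zeta(t) \leq - \omega_3(\Vert x(t) \Vert) \quad \text{as soon as } x_t \in Q_H,$$ then $(\ast)$ is $(\mathcal{C}^0([-h_M,0];\mathbb{R}^n),\mathcal{H})$-locally uniformly asymptotically stable. Furthermore, if $f$ is Lipschitz continuous with respect to the second argument on all of $A \times \mathcal{C}^0([-h_M,0];\mathbb{R}^n)$, uniformly with respect to the first argument, and if there exist a continuous functional $V : A \times W \rightarrow\mathbb{R}$, $\omega_1,\omega_2 \in \mathcal{K}_\infty$ and $\omega_3 \in \mathcal{K}$ such that $\omega_1(\Vert \phi(0) \Vert) \leq V(\xi,\phi) \leq \omega_2(\Vert \phi \Vert_W)$ for all $\xi \in A$ and all $\phi \in W$, and such that, for any $x_0 \in W$ and $\zeta \in \mathcal{H}$, the function $V_\zeta(t) = V(\zeta(t),x_t)$ with $x$ the trajectory of $(\ast)$ satisfies $D^+ V_\zeta(t) \leq - \omega_3(\Vert x(t) \Vert)$ at every time $t \geq 0$ in the interval of existence (i.e., the case $H=+\infty$, $Q_H=W$), then $(\ast)$ is $(\mathcal{C}^0([-h_M,0];\mathbb{R}^n),\mathcal{H})$-globally uniformly asymptotically stable.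
   Context: $\mathbb{R}^n$ carries the Euclidean norm $\Vert\cdot\Vert$. $\mathcal{C}^0([-h_M,0];\mathbb{R}^n)$ is endowed with the uniform norm $\Vert \phi \Vert_\infty = \sup_{s \in [-h_M,0]} \Vert \phi(s) \Vert$. $W$ is the set of absolutely continuous functions $\phi : [-h_M,0] \rightarrow \mathbb{R}^n$ with square integrable weak derivative $\dot\phi$, endowed with the norm $\Vert \phi \Vert_W = \sqrt{\Vert \phi(0) \Vert^2 + \int_{-h_M}^0 \Vert \dot{\phi}(s) \Vert^2 \,\mathrm{d}s}$; continuity of $V$ on $A\times W$ is with respect to this norm. $Q_H = \{ \phi \in W : \Vert \phi \Vert_W \leq H \}$. For a continuous function $x:[-h_M,t_f)\to\mathbb{R}^n$ with $t_f>0$ and for $0\le t<t_f$, $x_t = x(t+\cdot) \in \mathcal{C}^0([-h_M,0];\mathbb{R}^n)$. The trajectory is the maximal solution of the equation associated with $x_0$ and $\zeta$. A condition holding ''as soon as $x_t\in Q_H$'' means it holds at every time $t\ge 0$ in the interval of existence at which $x_t\in Q_H$. For $v:[a,b)\rightarrow\mathbb{R}$ the Dini upper right derivative at $t\in[a,b)$ is $D^+v(t) = \limsup_{h \rightarrow 0^+} \frac{v(t+h)-v(t)}{h}$. Class $\mathcal{K}$: continuous strictly increasing functions $\alpha:\mathbb{R}_+\to\mathbb{R}_+$ with $\alpha(0)=0$. Class $\mathcal{K}_\infty$: $\alpha\in\mathcal{K}$ with $\lim_{s\to+\infty}\alpha(s)=+\infty$. Class $\mathcal{KL}$: continuous $\beta:\mathbb{R}_+\times\mathbb{R}_+\to\mathbb{R}_+$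 such that $s\mapsto\beta(s,t)$ is of class $\mathcal{K}$ for each fixed $t\ge0$, and $t\mapsto\beta(s,t)$ is strictly decreasing with $\lim_{t\to+\infty}\beta(s,t)=0$ for each fixed $s>0$. A set $\mathcal{H} \subset \mathcal{C}^0(\mathbb{R}_+;\mathbb{R}^r)$ is forward invariant if for any $\zeta \in \mathcal{H}$ and any $a > 0$ we have $\zeta(\cdot + a) \in \mathcal{H}$. Write $X=\mathcal{C}^0([-h_M,0];\mathbb{R}^n)$ with $\Vert\cdot\Vert_X=\Vert\cdot\Vert_\infty$. - The system is $(X,\mathcal{H})$-stable if there exist $\alpha \in \mathcal{K}$ and $R > 0$ such that for any $x_0 \in X$ with $\Vert x_0 \Vert_X < R$ and any $\zeta \in \mathcal{H}$, the system trajectory $x$ is well defined on $\mathbb{R}_+$ with $\Vert x(t) \Vert \leq \alpha(\Vert x_0 \Vert_X)$ for all $t \geq 0$. - It is $(X,\mathcal{H})$-locally uniformly asymptotically stable if there exist $\beta\in\mathcal{KL}$ and $R > 0$ such that for any $x_0 \in X$ with $\Vert x_0 \Vert_X < R$ and any $\zeta \in \mathcal{H}$, the trajectory $x$ (is defined on $\mathbb{R}_+$ and) satisfies $\Vert x(t) \Vert \leq \beta(\Vert x_0 \Vert_X,t)$ for all $t \geq 0$. If one can select $R = +\infty$, it is $(X,\mathcal{H})$-globally uniformly asymptotically stable. *)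

(* Defs.v *)
From mathcomp Require Export all_boot all_order all_algebra.
From mathcomp Require Export all_classical all_reals all_analysis.
Export Order.TTheory GRing.Theory Num.Theory.
Export numFieldNormedType.Exports.

Set Implicit Arguments.
Unset Strict Implicit.
Unset Printing Implicit Defensive.

Local Open Scope classical_set_scope.
Local Open Scope ring_scope.

(* The norm carried by 'rV[R]_n in the library is the max norm; it induces the
   same topology (hence the same continuity and derivatives) as this one. *)
Definition enorm (R : realType) (n : nat) (x : 'rV[R]_n) : R :=
  Num.sqrt (\sum_(i < n) x 0 i ^+ 2).

(* C^0(D; R^n) as a set of total functions. A map D -> R^n is represented by
   its extension by 0 outside D (the base point of 'rV[R]_n is 0), so that
   equality in C^0(D; R^n) is equality of functions, and a map f defined on
   A x C^0(D; R^n) is the restriction of a total function f. *)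
Definition C0 (R : realType) (n : nat) (D : set R) : set (R -> 'rV[R]_n) :=
  [set phi | {within D, continuous phi} /\ phi \_ D = phi].

Definition supnorm (R : realType) (n : nat) (hM : R) (phi : R -> 'rV[R]_n) : R :=
  sup [set enorm (phi s) | s in `[- hM, 0]].

(* x_t = x(t + .) on [-hM, 0] *)
Definition seg (R : realType) (n : nat) (hM : R) (x : R -> 'rV[R]_n) (t : R)
    : R -> 'rV[R]_n :=
  (fun s => x (t + s)) \_ `[- hM, 0].

Definition abs_continuous (R : realType) (n : nat) (hM : R)
    (phi : R -> 'rV[R]_n) : Prop :=
  forall eps : R, 0 < eps -> exists2 delta : R, 0 < delta &
    forall (N : nat) (a b : 'I_N -> R),
      (forall i, [/\ - hM <= a i, a i <= b i & b i <= 0]) ->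
      trivIset setT (fun i => `]a i, b i[%classic) ->
      \sum_(i < N) (b i - a i) < delta ->
      \sum_(i < N) enorm (phi (b i) - phi (a i)) < eps.

(* C^1 functions with compact support in ]-hM, 0[ *)
Definition test_function (R : realType) (hM : R) (psi : R -> R) : Prop :=
  [/\ forall s : R, derivable psi s 1,
      continuous (derive1 psi) &
      exists a b : R, [/\ - hM < a, b < 0 &
        forall s : R, ~~ (a <= s <= b) -> psi s = 0]].

Definition weak_derivative (R : realType) (n : nat) (hM : R)
    (phi g : R -> 'rV[R]_n) : Prop :=
  forall i : 'I_n,
    (@lebesgue_measure R).-integrable `[- hM, 0] (fun s => (g s 0 i)%:E) /\
    forall psi : R -> R, test_function hM psi ->
      \int[@lebesgue_measure R]_(s in `[- hM, 0]) (phi s 0 i * derive1 psi s) =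
      - \int[@lebesgue_measure R]_(s in `[- hM, 0]) (g s 0 i * psi s).

(* A weak derivative of phi if there is one; it is unique up to a null set. *)
Definition wderiv (R : realType) (n : nat) (hM : R) (phi : R -> 'rV[R]_n)
    : R -> 'rV[R]_n :=
  get (weak_derivative hM phi).

Definition W (R : realType) (n : nat) (hM : R) : set (R -> 'rV[R]_n) :=
  [set phi | [/\ C0 `[- hM, 0] phi, abs_continuous hM phi &
    exists2 g, weak_derivative hM phi g &
      (@lebesgue_measure R).-integrable `[- hM, 0]
        (fun s => (enorm (g s) ^+ 2)%:E)]].

Definition Wnorm (R : realType) (n : nat) (hM : R) (phi : R -> 'rV[R]_n) : R :=
  Num.sqrt (enorm (phi 0) ^+ 2 +
    \int[@lebesgue_measure R]_(s in `[- hM, 0]) (enorm (wderiv hM phi s) ^+ 2)).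

Definition QH (R : realType) (n : nat) (hM H : R) : set (R -> 'rV[R]_n) :=
  [set phi | W hM phi /\ Wnorm hM phi <= H].

(* Joint continuity on A x S, where S is normed by N and the codomain by M. *)
Definition continuous_on_prod (R : realType) (r n : nat) (U : zmodType)
    (A : set 'rV[R]_r) (S : set (R -> 'rV[R]_n)) (N : (R -> 'rV[R]_n) -> R)
    (M : U -> R) (F : 'rV[R]_r -> (R -> 'rV[R]_n) -> U) : Prop :=
  forall xi phi, A xi -> S phi -> forall eps : R, 0 < eps ->
    exists2 delta : R, 0 < delta &
      forall xi' phi', A xi' -> S phi' ->
        enorm (xi' - xi) < delta -> N (phi' \- phi) < delta ->
        M (F xi' phi' - F xi phi) < eps.

(* Lipschitz on A x S in the second argument, uniformly in the first one. *)
Definition lipschitz_snd (R : realType) (r n : nat) (hM : R)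
    (A : set 'rV[R]_r) (S : set (R -> 'rV[R]_n))
    (f : 'rV[R]_r -> (R -> 'rV[R]_n) -> 'rV[R]_n) : Prop :=
  exists2 L : R, 0 <= L &
    forall xi phi psi, A xi -> S phi -> S psi ->
      enorm (f xi phi - f xi psi) <= L * supnorm hM (phi \- psi).

(* Every point of A x C^0([-hM, 0]; R^n) has a neighborhood on which f is
   Lipschitz in the second argument, uniformly in the first one. *)
Definition locally_lipschitz_snd (R : realType) (r n : nat) (hM : R)
    (A : set 'rV[R]_r) (f : 'rV[R]_r -> (R -> 'rV[R]_n) -> 'rV[R]_n) : Prop :=
  forall xi0 phi0, A xi0 -> C0 `[- hM, 0] phi0 ->
    exists2 delta : R, 0 < delta &
      lipschitz_snd hM
        [set xi | A xi /\ enorm (xi - xi0) < delta]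
        [set phi | C0 `[- hM, 0] phi /\ supnorm hM (phi \- phi0) < delta] f.

Definition forward_invariant (R : realType) (r : nat)
    (HH : set (R -> 'rV[R]_r)) : Prop :=
  forall zeta, HH zeta -> forall a : R, 0 < a ->
    HH ((fun t => zeta (t + a)) \_ `[0, +oo[).

(* x solves the delay equation on [-hM, tf[ (its values elsewhere are
   irrelevant); the derivative at t = 0 is a right derivative. *)
Definition solution (R : realType) (r n : nat) (hM : R)
    (f : 'rV[R]_r -> (R -> 'rV[R]_n) -> 'rV[R]_n) (zeta : R -> 'rV[R]_r)
    (x0 : R -> 'rV[R]_n) (tf : \bar R) (x : R -> 'rV[R]_n) : Prop :=
  [/\ (0 < tf)%E,
      {within [set t : R | - hM <= t /\ (t%:E < tf)%E], continuous x},
      forall s : R, - hM <= s <= 0 -> x s = x0 s,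
      forall t : R, 0 < t -> (t%:E < tf)%E ->
        is_derive t 1 x (f (zeta t) (seg hM x t)) &
      h^-1 *: (x h - x 0) @[h --> 0^'+] --> f (zeta 0) (seg hM x 0)].

(* x on [-hM, tf[ is a maximal (non-extendable) solution. *)
Definition trajectory (R : realType) (r n : nat) (hM : R)
    (f : 'rV[R]_r -> (R -> 'rV[R]_n) -> 'rV[R]_n) (zeta : R -> 'rV[R]_r)
    (x0 : R -> 'rV[R]_n) (tf : \bar R) (x : R -> 'rV[R]_n) : Prop :=
  solution hM f zeta x0 tf x /\
  forall tf' x', solution hM f zeta x0 tf' x' -> (tf <= tf')%E ->
    (forall t : R, - hM <= t -> (t%:E < tf)%E -> x' t = x t) -> tf' = tf.

(* The trajectory is well defined on R_+ and satisfies P at all times: a maximal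
   solution exists, and any maximal solution is global and satisfies P. *)
Definition global_trajectory (R : realType) (r n : nat) (hM : R)
    (f : 'rV[R]_r -> (R -> 'rV[R]_n) -> 'rV[R]_n) (zeta : R -> 'rV[R]_r)
    (x0 : R -> 'rV[R]_n) (P : R -> 'rV[R]_n -> Prop) : Prop :=
  (exists tf x, trajectory hM f zeta x0 tf x) /\
  forall tf x, trajectory hM f zeta x0 tf x ->
    tf = +oo%E /\ forall t : R, 0 <= t -> P t (x t).

Definition dini (R : realType) (v : R -> R) (t : R) : \bar R :=
  limf_esup (fun h : R => ((v (t + h) - v t) / h)%:E) 0^'+.

(* Comparison functions are total functions considered on R_+ only; their values
   there are nonnegative by monotonicity and alpha 0 = 0. *)
Definition classK (R : realType) (alpha : R -> R) : Prop :=
  [/\ {within `[0, +oo[, continuous alpha},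
      forall s s' : R, 0 <= s -> s < s' -> alpha s < alpha s' &
      alpha 0 = 0].

Definition classKinf (R : realType) (alpha : R -> R) : Prop :=
  classK alpha /\ alpha s @[s --> +oo] --> +oo.

Definition classKL (R : realType) (beta : R -> R -> R) : Prop :=
  [/\ {within [set p : R * R | 0 <= p.1 /\ 0 <= p.2],
         continuous (fun p : R * R => beta p.1 p.2)},
      forall t : R, 0 <= t -> classK (beta^~ t),
      forall s t t' : R, 0 < s -> 0 <= t -> t < t' -> beta s t' < beta s t &
      forall s : R, 0 < s -> beta s t @[t --> +oo] --> (0 : R)].

Definition stable (R : realType) (r n : nat) (hM : R)
    (f : 'rV[R]_r -> (R -> 'rV[R]_n) -> 'rV[R]_n)
    (HH : set (R -> 'rV[R]_r)) : Prop :=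
  exists alpha : R -> R, exists rho : R, [/\ classK alpha, 0 < rho &
    forall x0 zeta, C0 `[- hM, 0] x0 -> supnorm hM x0 < rho -> HH zeta ->
      global_trajectory hM f zeta x0
        (fun _ xt => enorm xt <= alpha (supnorm hM x0))].

(* Uniform asymptotic stability for initial conditions of norm < rho. *)
Definition uas_within (R : realType) (r n : nat) (hM : R)
    (f : 'rV[R]_r -> (R -> 'rV[R]_n) -> 'rV[R]_n)
    (HH : set (R -> 'rV[R]_r)) (rho : \bar R) : Prop :=
  exists2 beta : R -> R -> R, classKL beta &
    forall x0 zeta, C0 `[- hM, 0] x0 -> ((supnorm hM x0)%:E < rho)%E ->
      HH zeta ->
      global_trajectory hM f zeta x0
        (fun t xt => enorm xt <= beta (supnorm hM x0) t).

Definition locally_uas (R : realType) (r n : nat) (hM : R)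
    (f : 'rV[R]_r -> (R -> 'rV[R]_n) -> 'rV[R]_n)
    (HH : set (R -> 'rV[R]_r)) : Prop :=
  exists2 rho : R, 0 < rho & uas_within hM f HH rho%:E.

Definition globally_uas (R : realType) (r n : nat) (hM : R)
    (f : 'rV[R]_r -> (R -> 'rV[R]_n) -> 'rV[R]_n)
    (HH : set (R -> 'rV[R]_r)) : Prop :=
  uas_within hM f HH +oo%E.

(* D^+ V_zeta(t) <= - w(|x(t)|) along every trajectory starting in W, at every
   time t of the interval of existence at which x_t is in Q. *)
Definition dini_decay (R : realType) (r n : nat) (hM : R)
    (f : 'rV[R]_r -> (R -> 'rV[R]_n) -> 'rV[R]_n)
    (HH : set (R -> 'rV[R]_r)) (V : 'rV[R]_r -> (R -> 'rV[R]_n) -> R)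
    (Q : set (R -> 'rV[R]_n)) (w : R -> R) : Prop :=
  forall x0 zeta tf x, W hM x0 -> HH zeta -> trajectory hM f zeta x0 tf x ->
    forall t : R, 0 <= t -> (t%:E < tf)%E -> Q (seg hM x t) ->
      (dini (fun u => V (zeta u) (seg hM x u)) t <= (- w (enorm (x t)))%:E)%E.

(* Main.v *)
Require Import Defs.
From mathcomp Require Import ring lra measurable_realfun.

Set Implicit Arguments.
Unset Strict Implicit.
Unset Printing Implicit Defensive.

Local Open Scope classical_set_scope.
Local Open Scope ring_scope.

(** A continuous initial condition need not lie in W, but at time hM the state
    x_hM is C^1 and, by Gronwall, |x_hM|_W <= C |x_0|_oo; from then on all states
    are C^1 and their W-norm is at most C times the sup of |x| over the last
    2 hM units of time. Hence, as long as |x| <= e, the states x_t (t >= hM) stay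
    in Q_H, V decreases along them, and
    w1 |x(t)| <= V(hM) <= w2 (C' |x_0|_oo) < w1 e, so |x| never reaches e.
    Applied to the trajectory restarted at a later time, the same bound reduces
    attractivity to finding one window of length hM where |x| is small; since |x|
    is Lipschitz, V would lose a fixed amount on every window where it is not.
    Solutions are compared with those of the equation whose segments are
    projected onto the ball of radius H, which is globally Lipschitz; no local
    existence theory outside that ball is needed, Zorn's lemma alone provides
    maximal extensions. *)

(** * Euclidean norm and one-sided derivatives *)

(** A bound on D^+ alone does not exclude upward jumps, so V can be compared at two times only if it
    is continuous along the trajectory. As V is continuous for the W-norm, t -> x_t must be
    continuous into W. This holds once the segments are C^1, which is why nothing is asserted about
    V before time hM. The W-norm of a C^1 segment has to be computed although [wderiv] is an
    arbitrary choice of weak derivative: the du Bois-Reymond part serves to replace it by the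
    classical derivative. The estimates are organised around pairs (e, d), where initial size d
    guarantees the bound e forever. The global statement reuses the local estimates with a radius H
    chosen after e, large enough for the trajectories at hand. All bounds are first obtained in
    quantified form. A comparison function that is jointly continuous in (s, t) is then manufactured
    from them as a weighted supremum. *)

Section EuclideanNorm.
Context {R : realType} {n : nat}.
Implicit Types (x y z : 'rV[R]_n).

Lemma sum_sqr_ge0 x : 0 <= \sum_(i < n) x 0 i ^+ 2.
Proof. by apply: sumr_ge0 => i _; exact: sqr_ge0. Qed.

Lemma enorm_ge0 x : 0 <= enorm x.
Proof. exact: sqrtr_ge0. Qed.

Lemma sqr_enorm x : enorm x ^+ 2 = \sum_(i < n) x 0 i ^+ 2.
Proof. by rewrite sqr_sqrtr// sum_sqr_ge0. Qed.

Lemma enorm0 : enorm (0 : 'rV[R]_n) = 0.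
Proof.
by rewrite /enorm big1 ?sqrtr0// => i _; rewrite mxE expr0n.
Qed.

Lemma enormN x : enorm (- x) = enorm x.
Proof. by rewrite /enorm; congr Num.sqrt; apply: eq_bigr => i _; rewrite mxE sqrrN. Qed.

Lemma enormBC x y : enorm (x - y) = enorm (y - x).
Proof. by rewrite -enormN opprB. Qed.

Lemma enormZ (c : R) x : enorm (c *: x) = `|c| * enorm x.
Proof.
rewrite /enorm -sqrtr_sqr -sqrtrM ?sqr_ge0//; congr Num.sqrt.
by rewrite mulr_sumr; apply: eq_bigr => i _; rewrite mxE exprMn.
Qed.

Lemma coord_le_enorm x i : `|x 0 i| <= enorm x.
Proof.
rewrite -sqrtr_sqr ler_sqrt ?sum_sqr_ge0//.
by rewrite (bigD1 i)//= lerDl sumr_ge0// => j _; exact: sqr_ge0.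
Qed.

Lemma enorm_eq0 x : enorm x = 0 -> x = 0.
Proof.
move=> x0; apply/rowP => i; rewrite mxE; apply/eqP; rewrite -normr_le0 -x0.
exact: coord_le_enorm.
Qed.

(** Cauchy-Schwarz from the weighted inequality 2uv <= (b/a) u^2 + (a/b) v^2 with a, b the two
    norms: summed over the coordinates, its right-hand side is exactly 2ab. *)
Lemma sum_coordM_le x y : \sum_(i < n) x 0 i * y 0 i <= enorm x * enorm y.
Proof.
have [/eqP/enorm_eq0->|x0] := boolP (enorm x == 0).
  by rewrite enorm0 mul0r big1// => i _; rewrite mxE mul0r.
have [/eqP/enorm_eq0->|y0] := boolP (enorm y == 0).
  by rewrite enorm0 mulr0 big1// => i _; rewrite mxE mulr0.
set a := enorm x in x0 *; set b := enorm y in y0 *.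
have a0 : 0 < a by rewrite lt_def x0 enorm_ge0.
have b0 : 0 < b by rewrite lt_def y0 enorm_ge0.
have le2 i : 2 * (x 0 i * y 0 i) <= b / a * x 0 i ^+ 2 + a / b * y 0 i ^+ 2.
  rewrite -subr_ge0.
  suff -> : b / a * x 0 i ^+ 2 + a / b * y 0 i ^+ 2 - 2 * (x 0 i * y 0 i) =
     (b * x 0 i - a * y 0 i) ^+ 2 / (a * b).
    by rewrite divr_ge0 ?sqr_ge0// mulr_ge0 ?ltW.
  by field; rewrite x0 y0.
rewrite -(ler_pM2l (ltr0n R 2)) mulr_sumr.
apply: (le_trans (ler_sum _ (fun i _ => le2 i))).
rewrite big_split/= -!mulr_sumr -!sqr_enorm -/a -/b le_eqVlt; apply/orP; left.
by apply/eqP; field; rewrite x0 y0.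
Qed.

Lemma enormD x y : enorm (x + y) <= enorm x + enorm y.
Proof.
rewrite -(@ler_pXn2r _ 2)// ?nnegrE ?addr_ge0 ?enorm_ge0//.
rewrite sqrrD !sqr_enorm.
have -> : \sum_(i < n) (x + y) 0 i ^+ 2 = \sum_(i < n) x 0 i ^+ 2 +
    (\sum_(i < n) x 0 i * y 0 i) *+ 2 + \sum_(i < n) y 0 i ^+ 2.
  rewrite -sumrMnl -!big_split/=; apply: eq_bigr => i _.
  by rewrite mxE sqrrD.
by rewrite lerD2r lerD2l lerMn2r sum_coordM_le orbT.
Qed.

Lemma enormB x y : enorm (x - y) <= enorm x + enorm y.
Proof. by rewrite -(enormN y) enormD. Qed.

Lemma enorm_triangle z x y : enorm (x - y) <= enorm (x - z) + enorm (z - y).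
Proof. by apply: le_trans (enormD _ _); rewrite addrA subrK. Qed.

Lemma enorm_lipschitz x y : `|enorm x - enorm y| <= enorm (x - y).
Proof.
rewrite ler_norml; apply/andP; split.
  rewrite lerBrDr addrC lerBlDr -{1}(subrK x y) addrC (le_trans (enormD _ _))//.
  by rewrite enormBC addrC.
by rewrite lerBlDr -{1}(subrK y x) enormD.
Qed.

Lemma mx_norm_le_enorm x : `|x| <= enorm x.
Proof.
rewrite [leLHS]/Num.norm/= mx_normrE; apply: bigmax_le; first exact: enorm_ge0.
by move=> [i j] _ /=; rewrite (ord1 i) coord_le_enorm.
Qed.

Lemma enorm_le_sum x : enorm x <= \sum_(i < n) `|x 0 i|.
Proof.
rewrite -(@ler_pXn2r _ 2)// ?nnegrE ?enorm_ge0 ?sumr_ge0//.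
rewrite sqr_enorm expr2 mulr_suml; apply: ler_sum => i _.
rewrite -real_normK ?num_real// expr2 ler_wpM2l//.
by rewrite (bigD1 i)//= lerDl sumr_ge0.
Qed.

Lemma enorm_le_mx_norm x : enorm x <= n%:R * `|x|.
Proof.
apply: (le_trans (enorm_le_sum x)).
apply: (@le_trans _ _ (\sum_(i < n) `|x|)); last first.
  by rewrite sumr_const card_ord mulr_natl.
apply: ler_sum => i _; rewrite [leRHS]/Num.norm/= mx_normrE.
by apply: le_trans (le_bigmax _ _ (0, i)).
Qed.

End EuclideanNorm.
#[global] Hint Extern 0 (is_true (0 <= enorm _)) => solve [apply: enorm_ge0] : core.

Section EpsilonDelta.
Context {R : realType} {n : nat}.
Implicit Types (x : R -> 'rV[R]_n) (D : set R).

(** Phrased with [enorm] because all estimates are Euclidean, while the topology of row vectors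
    comes from the max norm. *)
Definition econt D x := forall t, D t -> forall e : R, 0 < e ->
  exists2 d : R, 0 < d &
    forall u, D u -> `|u - t| < d -> enorm (x u - x t) < e.

Lemma cvg_enormP {T} {F : set_system T} {FF : Filter F} (g : T -> 'rV[R]_n)
    (l : 'rV[R]_n) :
  g @ F --> l <-> forall e : R, 0 < e -> \forall t \near F, enorm (g t - l) < e.
Proof.
split=> [/cvgrPdist_lt gl e e0|gl].
  have e1 : 0 < e / n.+1%:R by rewrite divr_gt0.
  apply: filterS (gl _ e1) => t tl; rewrite enormBC.
  apply: (le_lt_trans (enorm_le_mx_norm _)).
  rewrite ltr_pdivlMr// in tl; apply: le_lt_trans tl; rewrite mulrC ler_wpM2l//.
  by rewrite ler_nat.
apply/cvgrPdist_lt => e e0; apply: filterS (gl _ e0) => t.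
by apply: le_lt_trans; rewrite -normrN opprB mx_norm_le_enorm.
Qed.

Lemma econtP D x : {within D, continuous x} <-> econt D x.
Proof.
rewrite subspace_continuousP; split => xc t Dt.
  move=> e e0; have /cvg_enormP/(_ e e0) := xc t Dt.
  rewrite near_withinE => /nbhs_ballP[d/= d0 xd]; exists d => // u Du ut.
  by apply: xd => //; rewrite /ball/= distrC.
apply/cvg_enormP => e /(xc t Dt)[d d0 xd]; rewrite near_withinE.
apply/nbhs_ballP; exists d => // u ut Du; apply: xd => //.
by rewrite distrC.
Qed.

Lemma econtW D1 D2 x : D1 `<=` D2 -> econt D2 x -> econt D1 x.
Proof.
move=> D12 xc t /D12 Dt e /(xc t Dt)[d d0 xd]; exists d => // u /D12; exact: xd.
Qed.

Lemma rcontP D (g : R -> R) :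
  {within D, continuous g} <-> forall t, D t -> forall e : R, 0 < e ->
  exists2 d : R, 0 < d & forall u, D u -> `|u - t| < d -> `|g u - g t| < e.
Proof.
rewrite subspace_continuousP; split => xc t Dt.
  move=> e e0; have /cvgrPdist_lt/(_ e e0) := xc t Dt.
  rewrite near_withinE => /nbhs_ballP[d/= d0 xd]; exists d => // u Du ut.
  by rewrite distrC; apply: xd => //; rewrite /ball/= distrC.
apply/cvgrPdist_lt => e /(xc t Dt)[d d0 xd]; rewrite near_withinE.
apply/nbhs_ballP; exists d => // u ut Du; rewrite distrC; apply: xd => //.
by rewrite distrC.
Qed.

(** A right derivative as a first-order expansion: no quotient to handle, it also covers t = 0, and
    it is the form of hypothesis used by [dini_growth]. *)
Definition rderiv x (t : R) (v : 'rV[R]_n) := forall e : R, 0 < e ->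
  exists2 d : R, 0 < d &
    forall h, 0 < h -> h < d -> enorm (x (t + h) - x t - h *: v) <= e * h.

Lemma derivP x (t : R) v : is_derive t 1 x v <-> forall e : R, 0 < e ->
  exists2 d : R, 0 < d & forall h, h != 0 -> `|h| < d ->
    enorm (x (t + h) - x t - h *: v) <= e * `|h|.
Proof.
have E h : h != 0 -> enorm (h^-1 *: (x (t + h) - x t) - v) =
    `|h|^-1 * enorm (x (t + h) - x t - h *: v).
  move=> h0; rewrite -normfV -enormZ; congr enorm.
  by rewrite [RHS]scalerBr scalerA mulVf// scale1r.
have K : (h^-1 *: ((x \o shift t) (h *: 1) - x t) @[h --> 0^'] --> v) <->
    forall e : R, 0 < e -> exists2 d : R, 0 < d & forall h, h != 0 -> `|h| < d ->
    enorm (x (t + h) - x t - h *: v) <= e * `|h|.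
  rewrite cvg_enormP; split => H e e0.
    have := H e e0; rewrite near_withinE => /nbhs_ballP[d/= d0 xd].
    exists d => // h h0 hd.
    have := xd h; rewrite /ball/= sub0r normrN => /(_ hd h0).
    rewrite [h *: 1]mulr1 [h + t]addrC (E _ h0).
    by rewrite mulrC ltr_pdivrMr ?normr_gt0// => /ltW.
  have e2 : 0 < e / 2 by rewrite divr_gt0.
  have [d d0 xd] := H _ e2; rewrite near_withinE.
  apply/nbhs_ballP; exists d => // h; rewrite /ball/= sub0r normrN => hd h0.
  rewrite [h *: 1]mulr1 [h + t]addrC (E _ h0) mulrC ltr_pdivrMr ?normr_gt0//.
  apply: le_lt_trans (xd _ h0 hd) _.
  by rewrite ltr_pM2r ?normr_gt0// ltr_pdivrMr// ltr_pMr// ltr1n.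
split=> [[dx dxv]|].
  by apply/K; rewrite -dxv; exact: dx.
move=> /K vx; apply: DeriveDef; first by apply/cvg_ex; exists v.
by apply/cvg_lim.
Qed.

Lemma deriv_rderiv x (t : R) v : is_derive t 1 x v -> rderiv x t v.
Proof.
move=> /derivP H e /H[d d0 xd]; exists d => // h h0 hd.
by have := xd h; rewrite gt_eqF// gtr0_norm// => /(_ isT hd).
Qed.

Lemma rderiv0P x v :
  (h^-1 *: (x h - x 0) @[h --> 0^'+] --> v) <-> rderiv x 0 v.
Proof.
have E h : h != 0 -> enorm (h^-1 *: (x h - x 0) - v) =
    `|h|^-1 * enorm (x h - x 0 - h *: v).
  move=> h0; rewrite -normfV -enormZ; congr enorm.
  by rewrite [RHS]scalerBr scalerA mulVf// scale1r.
rewrite cvg_enormP; split => H e e0.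
  have := H e e0; rewrite near_withinE => /nbhs_ballP[d/= d0 xd].
  exists d => // h h0 hd; rewrite add0r.
  have := xd h; rewrite /ball/= sub0r normrN gtr0_norm// => /(_ hd h0).
  by rewrite E ?gt_eqF// gtr0_norm// mulrC ltr_pdivrMr// => /ltW.
have e2 : 0 < e / 2 by rewrite divr_gt0.
have [d d0 xd] := H _ e2; rewrite near_withinE.
apply/nbhs_ballP; exists d => // h; rewrite /ball/= sub0r normrN => hd h0.
rewrite E ?gt_eqF// gtr0_norm// mulrC ltr_pdivrMr//.
rewrite gtr0_norm// in hd; have := xd _ h0 hd; rewrite add0r => /le_lt_trans; apply.
by rewrite ltr_pM2r ?normr_gt0// ltr_pdivrMr// ltr_pMr// ltr1n.
Qed.

End EpsilonDelta.

Lemma within_continuousM {R : realType} (D : set R) (g h : R -> R) :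
  {within D, continuous g} -> {within D, continuous h} ->
  {within D, continuous (fun t => g t * h t)}.
Proof.
by rewrite !subspace_continuousP => gc hc t Dt; apply: cvgM; [exact: gc|exact: hc].
Qed.

Lemma within_continuousB {R : realType} (D : set R) (g h : R -> R) :
  {within D, continuous g} -> {within D, continuous h} ->
  {within D, continuous (fun t => g t - h t)}.
Proof.
by rewrite !subspace_continuousP => gc hc t Dt; apply: cvgB; [exact: gc|exact: hc].
Qed.

(** * Growth of a continuous function from its upper right derivative *)

Section GrowthBound.
Context {R : realType}.

(** For slack e > 0, the times t with v t - v a <= (c + e)(t - a) contain their supremum by
    continuity, and the local hypothesis pushes past any supremum smaller than b. Then e tends to
    0. *)
Lemma dini_growth (v : R -> R) (a b c : R) : a <= b ->
  {within `[a, b], continuous v} ->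
  (forall t, a <= t -> t < b -> forall e : R, 0 < e -> exists2 d : R, 0 < d &
     forall h, 0 < h -> h < d -> v (t + h) - v t <= (c + e) * h) ->
  v b - v a <= c * (b - a).
Proof.
move=> ab vc vd.
have {vc}vc := (rcontP _ _).1 vc.
suff H e : 0 < e -> v b - v a <= (c + e) * (b - a).
  apply/ler_addgt0Pr => e e0.
  (* The length b - a may vanish, hence the [+ 1] in the denominator. *)
  have b1 : 0 < b - a + 1 by rewrite ltr_wpDl ?subr_ge0.
  have /H := divr_gt0 e0 b1; rewrite mulrDl => /le_trans; apply.
  rewrite lerD2l mulrAC ler_pdivrMr// ler_pM2l// lerDl//.
move=> e0; rewrite leNgt; apply/negP => ltab.
pose S := [set t | a <= t <= b /\ v t - v a <= (c + e) * (t - a)].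
have Sa : S a by split; rewrite ?lexx ?ab// !subrr mulr0.
have hS : has_sup S by split; [exists a | exists b => t [/andP[]]].
set s := sup S.
have as_ : a <= s by apply: ub_le_sup => //; case: hS.
have sb : s <= b by apply: ge_sup; [exists a | move=> t [/andP[]]].
have Ss : S s.
  split; first by rewrite as_ sb.
  rewrite leNgt; apply/negP => gs.
  set g := v s - v a - (c + e) * (s - a).
  have g0 : 0 < g by rewrite subr_gt0.
  have g2 : 0 < g / 2 by rewrite divr_gt0.
  have sab : `[a, b]%classic s by rewrite /= in_itv/= as_ sb.
  have [d d0 H] := vc s sab _ g2.
    set k := `|c + e| + 1.
    have k0 : 0 < k by rewrite ltr_wpDl.
    have m0 : 0 < Num.min d (g / 2 / k) by rewrite lt_min d0/= divr_gt0.
    have [t [tab St] st] := sup_adherent m0 hS.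
    have ts : t <= s by apply: ub_le_sup => //; case: hS.
    have := st; rewrite -/s ltrBlDr -ltrBlDl lt_min => /andP[std stg].
    have := H t; rewrite distrC ger0_norm ?subr_ge0// /= in_itv/= => /(_ tab std).
    rewrite ltr_norml => /andP[vt _].
    have : (c + e) * (s - t) >= - (g / 2).
      have : `|(c + e) * (s - t)| <= g / 2.
        rewrite normrM (ger0_norm (_ : 0 <= s - t)) ?subr_ge0//.
        rewrite ltr_pdivlMr// in stg; apply: le_trans (ltW stg).
        by rewrite mulrC ler_wpM2l ?subr_ge0// lerDl.
      by rewrite ler_norml => /andP[].
    move: St vt; rewrite /g; nra.
have slb : s < b.
  rewrite lt_neqAle sb andbT; apply/negP => /eqP E.
  by case: Ss => _; rewrite E leNgt ltab.
have [d d0 H] := vd s as_ slb _ e0.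
pose h := Num.min (d / 2) (b - s).
have h0 : 0 < h by rewrite lt_min subr_gt0 slb divr_gt0.
have hd : h < d.
  by rewrite gt_min; apply/orP; left; rewrite ltr_pdivrMr// ltr_pMr// ltr1n.
have hb : s + h <= b by rewrite -lerBrDl ge_min lexx orbT.
have := H h h0 hd => vh.
have : S (s + h).
  split; first by rewrite hb andbT (le_trans as_)// lerDl ltW.
  by case: Ss => _; nra.
move=> /(ub_le_sup (proj2 hS)); rewrite -/s; lra.
Qed.

End GrowthBound.

(** * History segments and the delay Gronwall inequality *)

Section Segments.
Context {R : realType} {n : nat}.
Implicit Types (x y phi : R -> 'rV[R]_n) (a b t u s h : R).

Lemma econt_segmentP a b x : econt `[a, b] x <->
  forall t, a <= t <= b -> forall e : R, 0 < e -> exists2 d : R, 0 < d &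
    forall u, a <= u <= b -> `|u - t| < d -> enorm (x u - x t) < e.
Proof.
split=> xc t; rewrite ?set_itvE/= => tab e e0.
  have [|d d0 H] := xc t _ e e0; first by rewrite /= in_itv.
  by exists d => // u uab; apply: H; rewrite /= in_itv.
have [|d d0 H] := xc t _ e e0; first by move: tab; rewrite /= ?in_itv.
by exists d => // u uab; apply: H; move: uab; rewrite /= ?in_itv.
Qed.

(** Heine-Cantor by continuous induction on the right end: two close points either both lie in a
    piece [[a, t]] already treated, or both lie in the ball of continuity around the supremum s. *)
Lemma econt_uniform a b x : econt `[a, b] x -> forall e : R, 0 < e ->
  exists2 d : R, 0 < d & forall u v, a <= u <= b -> a <= v <= b ->
    `|u - v| < d -> enorm (x u - x v) < e.
Proof.
move=> /econt_segmentP xc e e0.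
have [ba|ab] := ltP b a.
  exists 1 => // u v /andP[au ub]; move: (le_trans au ub); lra.
pose P t := exists2 d : R, 0 < d & forall u v, a <= u <= t -> a <= v <= t ->
    `|u - v| < d -> enorm (x u - x v) < e.
pose S := [set t | a <= t <= b /\ P t].
have Sa : S a.
  split; first by rewrite lexx ab.
  by exists 1 => // u v /le_anti -> /le_anti -> _; rewrite subrr enorm0.
have hS : has_sup S by split; [exists a | exists b => t [/andP[]]].
set s := sup S.
have as_ : a <= s by apply: ub_le_sup => //; case: hS.
have sb : s <= b by apply: ge_sup; [exists a | move=> t [/andP[]]].
have [||d d0 H] := xc s _ (e / 2); [by rewrite as_ sb|by rewrite divr_gt0|].
have d2 : 0 < d / 2 by rewrite divr_gt0.
have [t St st] := sup_adherent d2 hS.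
have ts : t <= s by apply: ub_le_sup => //; case: hS.
have [tab [k k0 tk]] := St.
pose w := Num.min b (s + d / 2).
have Pw : P w.
  exists (Num.min k (d / 2)); first by rewrite lt_min k0.
  have near_s u : a <= u <= w -> s - d < u -> enorm (x u - x s) < e / 2.
    rewrite le_min => /andP[au /andP[ub us]] su; apply: H; first by rewrite au ub.
    rewrite ltr_norml; apply/andP; split; lra.
  have far u v : a <= u <= w -> a <= v <= w -> t < u -> `|u - v| < d / 2 ->
      enorm (x u - x v) < e.
    move=> uw vw tu; rewrite ltr_norml => /andP[uv1 uv2].
    have := near_s u uw; have := near_s v vw.
    have := enorm_triangle (x s) (x u) (x v); rewrite (enormBC (x s)) -/s in st *.
    move=> tri hv hu.
    have {}hv : enorm (x v - x s) < e / 2 by apply: hv; lra.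
    have {}hu : enorm (x u - x s) < e / 2 by apply: hu; lra.
    lra.
  move=> u v uw vw; rewrite lt_min => /andP[uvk uvd].
  have [tu|ut] := ltP t u; first exact: far.
  have [tv|vt] := ltP t v; first by rewrite enormBC far// distrC.
  case/andP: uw => au _; case/andP: vw => av _.
  by apply: tk; rewrite ?au ?av.
have Sw : S w.
  split => //; rewrite /w ge_min lexx le_min ab/= andbT; lra.
have ws : w <= s by apply: ub_le_sup => //; case: hS.
have wb : w = b.
  by move: ws; rewrite /w; case: (leP b (s + d / 2)) => //; lra.
by case: Sw; rewrite wb.
Qed.

Lemma enorm_cont (D : set R) x : econt D x -> {within D, continuous (fun t => enorm (x t))}.
Proof.
move=> xc; apply/rcontP => t Dt e /(xc t Dt)[d d0 H]; exists d => // u Du ut.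
by apply: le_lt_trans (H u Du ut); exact: enorm_lipschitz.
Qed.

Variables (hM : R) (hM_gt0 : 0 < hM).

Lemma supnorm_le phi (B : R) :
  (forall s, - hM <= s <= 0 -> enorm (phi s) <= B) -> supnorm hM phi <= B.
Proof.
move=> H; apply: ge_sup.
  by exists (enorm (phi 0)); exists 0 => //; rewrite /= in_itv/= lexx oppr_le0 ltW.
by move=> _ [s + <-]; rewrite /= in_itv/=; exact: H.
Qed.

(** Continuity on the compact interval makes the supremum genuine; the [sup] of an unbounded set is
    only a default value. *)
Lemma le_supnorm phi s : econt `[- hM, 0] phi -> - hM <= s <= 0 ->
  enorm (phi s) <= supnorm hM phi.
Proof.
move=> /enorm_cont phic sM; apply: ub_le_sup; last first.
  by exists s => //; rewrite /= in_itv.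
have M0 : - hM <= 0 by rewrite oppr_le0 ltW.
have [c _ cm] := EVT_max M0 phic.
by exists (enorm (phi c)) => _ [u uM <-]; exact: cm.
Qed.

Lemma supnorm_ge0 phi : econt `[- hM, 0] phi -> 0 <= supnorm hM phi.
Proof.
move=> phic; apply: le_trans (enorm_ge0 (phi 0)) (le_supnorm phic _).
by rewrite lexx oppr_le0 ltW.
Qed.

Lemma segE x t s : - hM <= s <= 0 -> seg hM x t s = x (t + s).
Proof. by move=> sM; rewrite /seg patchE mem_set//= in_itv. Qed.

Lemma seg_out x t s : ~~ (- hM <= s <= 0) -> seg hM x t s = 0.
Proof.
move=> sM; rewrite /seg patchE; case: ifPn => [|_]; last by apply/rowP => i; rewrite !mxE.
by rewrite inE/= in_itv/= (negbTE sM).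
Qed.

Lemma seg_at0 x t : seg hM x t 0 = x t.
Proof. by rewrite segE ?addr0// lexx oppr_le0 ltW. Qed.

Lemma seg_eq x y t t' : (forall s, - hM <= s <= 0 -> x (t + s) = y (t' + s)) ->
  seg hM x t = seg hM y t'.
Proof.
move=> xy; apply/funext => s; have [sM|sM] := boolP (- hM <= s <= 0).
  by rewrite !segE// xy.
by rewrite !seg_out.
Qed.

Lemma seg_econt x t : econt `[t - hM, t] x -> econt `[- hM, 0] (seg hM x t).
Proof.
move=> /econt_segmentP xc; apply/econt_segmentP => s sM e e0.
have [|d d0 H] := xc (t + s) _ e e0; first by lra.
exists d => // u uM us; rewrite !segE//; apply: H; first by lra.
by rewrite opprD addrACA subrr add0r.
Qed.

Lemma seg_C0 x t : econt `[t - hM, t] x -> C0 `[- hM, 0] (seg hM x t).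
Proof.
move=> xc; split; first by apply/econtP; exact: seg_econt.
apply/funext => s; rewrite patchE; case: ifPn => // sM.
rewrite [RHS]seg_out; first by apply/rowP => i; rewrite !mxE.
by move: sM; rewrite notin_setE/= in_itv/= => /negP.
Qed.

Lemma C0_econt (D : set R) x : C0 D x -> econt D x.
Proof. by move=> [/econtP]. Qed.

Lemma C0_seg phi : C0 `[- hM, 0] phi -> seg hM phi 0 = phi.
Proof.
move=> [_ <-]; apply/funext => s; rewrite /seg !patchE.
by case: ifPn => // sM; rewrite add0r sM.
Qed.

Lemma supnorm_seg_le x t (B : R) :
  (forall u, t - hM <= u <= t -> enorm (x u) <= B) -> supnorm hM (seg hM x t) <= B.
Proof. by move=> H; apply: supnorm_le => s sM; rewrite segE//; apply: H; lra. Qed.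

Lemma supnorm_segB_le x y t t' (B : R) :
  (forall s, - hM <= s <= 0 -> enorm (x (t + s) - y (t' + s)) <= B) ->
  supnorm hM (seg hM x t \- seg hM y t') <= B.
Proof. by move=> H; apply: supnorm_le => s sM /=; rewrite !segE//; exact: H. Qed.

Lemma seg_supnorm_cont x a b t : econt `[a, b] x -> a + hM <= t <= b ->
  forall e : R, 0 < e -> exists2 d : R, 0 < d &
  forall u, a + hM <= u <= b -> `|u - t| < d ->
    supnorm hM (seg hM x u \- seg hM x t) < e.
Proof.
move=> xc tab e e0; have e2 : 0 < e / 2 by rewrite divr_gt0.
have [d d0 H] := econt_uniform xc e2.
exists d => // u uab ut; apply: (@le_lt_trans _ _ (e / 2)); last by lra.
apply: supnorm_segB_le => s sM; apply: ltW; apply: H; [lra|lra|].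
by rewrite opprD addrACA subrr addr0.
Qed.

(** An integral-free mean value inequality: [phi] stands for a primitive of the speed bound [psi],
    and [dini_growth] with c = 0 applies to enorm (x t - x a) - phi t. *)
Lemma mean_value_le x (v : R -> 'rV[R]_n) (phi psi : R -> R) a b : a <= b ->
  econt `[a, b] x -> {within `[a, b], continuous phi} ->
  (forall t, a <= t -> t < b -> rderiv x t (v t)) ->
  (forall t, a <= t -> t < b -> enorm (v t) <= psi t) ->
  (forall t h, a <= t -> t < b -> 0 < h -> psi t * h <= phi (t + h) - phi t) ->
  enorm (x b - x a) <= phi b - phi a.
Proof.
move=> ab xc phic xv vpsi psiphi.
have /(_ _ _)/wrap[] := @dini_growth R (fun t => enorm (x t - x a) - phi t) a b 0 ab.
- apply: within_continuousB => //.
  apply: (enorm_cont (x := fun t => x t - x a)) => t tab e /(xc t tab)[d d0 H].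
  by exists d => // u uab /(H u uab); rewrite opprB addrA subrK.
- move=> t at_ tb e /(xv t at_ tb)[d d0 H]; exists d => // h h0 hd.
  have := H h h0 hd.
  have := vpsi t at_ tb; have := psiphi t h at_ tb h0.
  have := enorm_triangle (x t) (x (t + h)) (x a).
  have := enormD (x (t + h) - x t - h *: v t) (h *: v t).
  rewrite subrK enormZ gtr0_norm//; nra.
by rewrite subrr enorm0 mul0r; lra.
Qed.

End Segments.

Section Gronwall.
Context {R : realType} {n : nat}.
Variables (hM : R) (hM_gt0 : 0 < hM).
Implicit Types (t u s h : R).

(** The exponential lies above its tangents; this is the condition that [mean_value_le] puts on an
    exponential [phi]. *)
Lemma expR_mul_growth (k t h : R) : expR (k * t) * k * h <= expR (k * (t + h)) - expR (k * t).
Proof.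
rewrite mulrDr expRD -mulrA -[leRHS](_ : expR (k * t) * (expR (k * h) - 1) = _).
  by rewrite ler_wpM2l ?expR_ge0// lerBrDr addrC expR_ge1Dx.
by rewrite mulrBr mulr1.
Qed.

Lemma continuous_expRM (k : R) : continuous (fun t => expR (k * t)).
Proof.
move=> t; apply: continuous_comp; last exact: continuous_expR.
exact: mulrl_continuous.
Qed.

(** Let m be the maximum of enorm (z t) exp(-2Lt) on [0, T], attained at c. The history at time t is
    at most (D + m) exp(2Lt), and the primitive of L exp(2Lt) is only half of exp(2Lt), so m
    exp(2Lc) <= D + (D + m)/2 exp(2Lc). Since exp(2Lc) >= 1, m is absorbed and m <= 3D. This
    explains both the rate 2L and the factor 3. *)
Lemma gronwall_delay (z v : R -> 'rV[R]_n) (L D T : R) :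
  0 < L -> 0 <= T -> econt `[- hM, T] z ->
  (forall t, - hM <= t <= 0 -> enorm (z t) <= D) ->
  (forall t, 0 <= t -> t < T -> rderiv z t (v t)) ->
  (forall t B, 0 <= t -> t < T -> (forall u, t - hM <= u <= t -> enorm (z u) <= B) ->
     enorm (v t) <= L * B) ->
  forall t, 0 <= t <= T -> enorm (z t) <= 3 * D * expR (2 * L * t).
Proof.
move=> L0 T0 zc zD zv vL.
have zc0 : econt `[0, T] z.
  apply: econtW zc => t /=; rewrite !in_itv/= => /andP[t0 ->].
  by rewrite andbT (le_trans _ t0)// oppr_le0 ltW.
have D0 : 0 <= D by apply: le_trans (enorm_ge0 (z 0)) (zD 0 _); rewrite lexx oppr_le0 ltW.
have mc : {within `[0, T], continuous (fun t => enorm (z t) * expR (- (2 * L) * t))}.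
  apply: within_continuousM; first exact: enorm_cont.
  by apply: continuous_subspaceT; exact: continuous_expRM.
have [c cT cm] := EVT_max T0 mc.
rewrite in_itv/= in cT; case/andP: (cT) => c0 cT'.
set m := enorm (z c) * expR (- (2 * L) * c) in cm.
have m0 : 0 <= m by rewrite /m mulr_ge0 ?expR_ge0 ?enorm_ge0.
have zm t : 0 <= t <= T -> enorm (z t) <= m * expR (2 * L * t).
  move=> tT; rewrite -ler_pdivrMr ?expR_gt0// -expRN -mulNr.
  by apply: cm; rewrite in_itv.
have E0 : expR (2 * L * 0) = 1 by rewrite mulr0 expR0.
have win t : 0 <= t -> t < T -> enorm (v t) <= L * ((D + m) * expR (2 * L * t)).
  move=> t0 tT; apply: vL => // u /andP[tu ut]; have [u0|u0] := leP u 0.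
    have [uM|uM] := leP (- hM) u.
      apply: (@le_trans _ _ D); first by apply: zD; rewrite uM u0.
      have : 1 <= expR (2 * L * t) by rewrite -expR0 ler_expR mulr_ge0// mulr_ge0 ?ltW.
      nra.
    by exfalso; lra.
  have uT : 0 <= u <= T by lra.
  have := zm u uT.
  have : expR (2 * L * u) <= expR (2 * L * t) by rewrite ler_expR ler_pM2l// mulr_gt0.
  have := expR_ge0 (2 * L * t); nra.
have key : enorm (z c - z 0) <=
    (D + m) / 2 * expR (2 * L * c) - (D + m) / 2 * expR (2 * L * 0).
  apply: (@mean_value_le _ _ z v (fun t => (D + m) / 2 * expR (2 * L * t))
    (fun t => L * ((D + m) * expR (2 * L * t)))) => //.
  - by apply: econtW zc0 => t /=; rewrite !in_itv/=; lra.
  - apply: within_continuousM; apply: continuous_subspaceT => t.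
      exact: cvg_cst.
    exact: continuous_expRM.
  - by move=> t t0 tc; apply: zv => //; lra.
  - by move=> t t0 tc; apply: win => //; lra.
  - move=> t h t0 tc h0; rewrite -mulrBr.
    have := expR_mul_growth (2 * L) t h; set E := expR _; set E' := expR _ => H.
    have : 0 <= (D + m) / 2 by rewrite divr_ge0 ?addr_ge0.
    nra.
have zc3 : enorm (z c) <= D + (D + m) / 2 * expR (2 * L * c).
  have := enormD (z c - z 0) (z 0); rewrite subrK.
  have := zD 0; rewrite lexx oppr_le0 ltW// => /(_ isT).
  rewrite E0 in key; lra.
have m3 : m <= 3 * D.
  have Ec : 1 <= expR (2 * L * c) by rewrite -expR0 ler_expR mulr_ge0// mulr_ge0 ?ltW.
  have : enorm (z c) = m * expR (2 * L * c).
    by rewrite /m mulNr expRN divfK// gt_eqF ?expR_gt0.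
  nra.
move=> t tT; apply: (le_trans (zm t tT)); rewrite ler_wpM2r// expR_ge0//.
Qed.

End Gronwall.

(** * Picard iteration *)

Section Antiderivative.
Context {R : realType}.

(** The lower limit -1 leaves room on the left of 0, so the primitive has a two-sided derivative at
    0 as well. *)
Lemma antiderivative (g : R -> R) : continuous g ->
  exists G : R -> R, forall t : R, - 1 < t -> is_derive t 1 G (g t).
Proof.
move=> gc; exists (fun x => \int[lebesgue_measure]_(s in `[- 1, x]) g s) => t t1.
have gi : lebesgue_measure.-integrable `[- 1, t + 1] (EFin \o g).
  apply: continuous_compact_integrable; first exact: segment_compact.
  exact: continuous_subspaceT.
have tt1 : t < t + 1 by rewrite ltrDl.
have [dG] := continuous_FTC1_closed tt1 gi t1 (gc t).
by rewrite derive1E => Gt; apply: DeriveDef.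
Qed.

Lemma antiderivative_rV (n : nat) (g : R -> 'rV[R]_n) : econt setT g ->
  exists G : R -> 'rV[R]_n, forall t : R, - 1 < t -> is_derive t 1 G (g t).
Proof.
move=> gc.
have /choice[G GP] (i : 'I_n) : exists G : R -> R,
    forall t : R, - 1 < t -> is_derive t 1 G (g t 0 i).
  apply: antiderivative => t; apply/cvgrPdist_lt => e e0.
  have [//|d d0 H] := gc t I e; apply/nbhs_ballP; exists d => //= u tu.
  have := H u I; rewrite distrC => /(_ tu); apply: le_lt_trans.
  by have := coord_le_enorm (g u - g t) i; rewrite !mxE distrC.
exists (fun t => \row_i G i t) => t t1.
have dG : derivable (fun t => \row_i G i t) t 1.
  apply/derivable_mxP => i j.
  rewrite [X in derivable X](_ : _ = G j); last by apply/funext => u; rewrite mxE.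
  by have [] := GP j t t1.
apply: DeriveDef => //; rewrite derive_mx//; apply/rowP => i; rewrite mxE.
transitivity ('D_1 (G i) t); last by have [] := GP i t t1.
by congr ('D_1 _ t); apply/funext => u; rewrite mxE.
Qed.

End Antiderivative.

Section HalfPowers.
Context {R : realType}.

Lemma exp2_gt0 k : 0 < (2 : R) ^+ k. Proof. by rewrite exprn_gt0. Qed.

Lemma half_pow_lt (C e : R) : 0 < e -> exists k : nat, C / 2 ^+ k < e.
Proof.
move=> e0; have [k Ck] : exists k : nat, C / e < k%:R.
  exists (Num.Def.archi_bound (C / e)); apply: le_lt_trans (ler_norm _) _.
  by have := archi_boundP (normr_ge0 (C / e)); rewrite /Num.Def.archi_bound ?normr_id.
exists k; rewrite ltr_pdivrMr ?exp2_gt0//.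
rewrite ltr_pdivrMr// in Ck; apply: lt_trans Ck _.
by rewrite mulrC ltr_pM2l// -natrX ltr_nat ltn_expl.
Qed.

(** The number c k = 2C/2^k is the sum of all increments from k on, so the intervals
    [u k - c k, u k + c k] are nested. The supremum of their left ends lies in each of them, which
    gives the limit with its rate. *)
Lemma half_pow_cvg (u : nat -> R) (C : R) :
  (forall k, `|u k.+1 - u k| <= C / 2 ^+ k) ->
  exists l, forall k, `|u k - l| <= 2 * C / 2 ^+ k.
Proof.
move=> uC; pose c k := 2 * C / 2 ^+ k.
have cS k : c k - c k.+1 = C / 2 ^+ k.
  by rewrite /c exprS; field; rewrite expf_neq0.
have C0 : 0 <= C by have := uC 0%N; rewrite expr0 divr1; exact: le_trans.
have c0 k : 0 <= c k by rewrite /c divr_ge0 ?mulr_ge0// ltW// exp2_gt0.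
have aS k m : u k - c k <= u (k + m)%N - c (k + m)%N.
  elim: m => [|m IH]; first by rewrite addn0.
  have := uC (k + m)%N; rewrite -cS addnS ler_norml; lra.
have bS k m : u (k + m)%N + c (k + m)%N <= u k + c k.
  elim: m => [|m IH]; first by rewrite addn0.
  have := uC (k + m)%N; rewrite -cS addnS ler_norml; lra.
have ab k m : u k - c k <= u m + c m.
  have := aS k m; have := bS m k; rewrite (addnC m); have := c0 (k + m)%N; lra.
pose S := range (fun k => u k - c k).
have hS : has_sup S.
  by split; [exists (u 0%N - c 0%N); exists 0%N | exists (u 0%N + c 0%N) => _ [k _ <-]].
exists (sup S) => k; rewrite -/(c k).
have : sup S <= u k + c k by apply: ge_sup; [case: hS | move=> _ [m _ <-]].
have : u k - c k <= sup S by apply: ub_le_sup; [case: hS | exists k].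
by rewrite ler_norml; lra.
Qed.

Lemma half_pow_cvg_rV (n : nat) (u : nat -> 'rV[R]_n) (C : R) :
  (forall k, enorm (u k.+1 - u k) <= C / 2 ^+ k) ->
  exists l, forall k, enorm (u k - l) <= n%:R * (2 * C / 2 ^+ k).
Proof.
move=> uC.
have /choice[l lP] (i : 'I_n) : exists l, forall k, `|u k 0 i - l| <= 2 * C / 2 ^+ k.
  apply: (@half_pow_cvg (fun k => u k 0 i)) => k; apply: le_trans (uC k).
  by have := coord_le_enorm (u k.+1 - u k) i; rewrite !mxE.
exists (\row_i l i) => k; apply: (le_trans (enorm_le_sum _)).
apply: (@le_trans _ _ (\sum_(i < n) (2 * C / 2 ^+ k))).
  by apply: ler_sum => i _; rewrite !mxE.
by rewrite sumr_const card_ord -[leLHS]mulr_natl.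
Qed.

End HalfPowers.

Section Lipschitz.
Context {R : realType}.

Lemma maxr_lip (u t c : R) : `|Num.max u c - Num.max t c| <= `|u - t|.
Proof.
set k := `|u - t|; have k1 : u - t <= k by exact: ler_norm.
have k2 : t - u <= k by rewrite /k distrC ler_norm.
have k0 : 0 <= k by rewrite /k normr_ge0.
by rewrite ler_norml; case: (leP u c) => ?; case: (leP t c) => ?; lra.
Qed.

Lemma minr_lip (u t c : R) : `|Num.min u c - Num.min t c| <= `|u - t|.
Proof.
set k := `|u - t|; have k1 : u - t <= k by exact: ler_norm.
have k2 : t - u <= k by rewrite /k distrC ler_norm.
have k0 : 0 <= k by rewrite /k normr_ge0.
by rewrite ler_norml; case: (leP u c) => ?; case: (leP t c) => ?; lra.
Qed.

Lemma derive_near_lip (n : nat) (x : R -> 'rV[R]_n) (t : R) v : is_derive t 1 x v ->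
  exists K : R, exists2 d : R, 0 < K /\ 0 < d &
    forall h, `|h| < d -> enorm (x (t + h) - x t) <= K * `|h|.
Proof.
move=> /derivP/(_ 1 ltr01)[d d0 H]; exists (1 + enorm v).
exists d; first by split => //; rewrite ltr_wpDr.
move=> h hd; have [->|h0] := eqVneq h 0.
  by rewrite addr0 subrr enorm0 normr0 mulr0.
have := H h h0 hd.
have := enormD (x (t + h) - x t - h *: v) (h *: v).
rewrite subrK enormZ mulrDl; lra.
Qed.

End Lipschitz.

Section Picard.
Context {R : realType} {n : nat}.
Implicit Types (x y z v : R -> 'rV[R]_n) (t u s h : R).
Variables (hM : R) (hM_gt0 : 0 < hM).

Lemma rderivB x y (t : R) (v w : 'rV[R]_n) :
  rderiv x t v -> rderiv y t w -> rderiv (x \- y) t (v - w).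
Proof.
move=> xv yw e e0; have e2 : 0 < e / 2 by rewrite divr_gt0.
have [d d0 H] := xv _ e2; have [d' d'0 H'] := yw _ e2.
exists (Num.min d d'); first by rewrite lt_min d0.
move=> h h0; rewrite lt_min => /andP[hd hd'].
have := H h h0 hd; have := H' h h0 hd'.
have := enormB (x (t + h) - x t - h *: v) (y (t + h) - y t - h *: w).
rewrite (_ : _ - _ - (_ - _ - _) =
  (x \- y) (t + h) - (x \- y) t - h *: (v - w)); first lra.
by rewrite /= scalerBr; apply/rowP => i; rewrite !mxE; ring.
Qed.

Lemma econtB (D : set R) x y : econt D x -> econt D y -> econt D (x \- y).
Proof.
move=> xc yc t Dt e e0; have e2 : 0 < e / 2 by rewrite divr_gt0.
have [d d0 H] := xc t Dt _ e2; have [d' d'0 H'] := yc t Dt _ e2.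
exists (Num.min d d'); first by rewrite lt_min d0.
move=> u Du; rewrite lt_min => /andP[ud ud'].
have := H u Du ud; have := H' u Du ud'.
have := enormB (x u - x t) (y u - y t).
rewrite (_ : _ - _ - (_ - _) = (x \- y) u - (x \- y) t); first lra.
by apply/rowP => i; rewrite !mxE; ring.
Qed.

(* In the norm weighted by expR (- 2 L t) one Picard step contracts by 1/2. *)
Lemma exp_weighted_halving z v (L C : R) : 0 < L -> 0 <= C -> econt `[0, +oo[ z ->
  z 0 = 0 -> (forall t, 0 <= t -> rderiv z t (v t)) ->
  (forall t, 0 <= t -> enorm (v t) <= L * (C * expR (2 * L * t))) ->
  forall t, 0 <= t -> enorm (z t) <= C / 2 * expR (2 * L * t).
Proof.
move=> L0 C0 zc z0 zv vC t t0; have C2 : 0 <= C / 2 by rewrite divr_ge0.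
have := @mean_value_le _ _ z v (fun t => C / 2 * expR (2 * L * t))
    (fun t => L * (C * expR (2 * L * t))) 0 t t0.
rewrite z0 subr0 => /(_ _ _ _ _ _)/wrap[].
- by apply: econtW zc => u /=; rewrite !in_itv/= => /andP[->].
- apply: within_continuousM; apply: continuous_subspaceT => u.
    exact: cvg_cst.
  exact: continuous_expRM.
- by move=> s s0 _; exact: zv.
- by move=> s s0 _; exact: vC.
- move=> s h s0 _ h0; rewrite -mulrBr.
  have := expR_mul_growth (2 * L) s h; set E := expR _; set E' := expR _ => H.
  nra.
rewrite mulr0 expR0 mulr1; lra.
Qed.

(** The right-hand side is abstracted to a globally Lipschitz, time-dependent [F]; the instance used
    later is the projected equation. *)
Variables (F : R -> (R -> 'rV[R]_n) -> 'rV[R]_n) (L : R) (L_gt0 : 0 < L).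
Hypothesis F0 : forall t, 0 <= t -> F t (fun=> 0) = 0.
Hypothesis F_lip : forall t phi psi, 0 <= t ->
  C0 `[- hM, 0] phi -> C0 `[- hM, 0] psi ->
  enorm (F t phi - F t psi) <= L * supnorm hM (phi \- psi).
Hypothesis F_cont : forall x, econt setT x ->
  econt `[0, +oo[ (fun t => F t (seg hM x t)).

Lemma seg_C0T x t : econt setT x -> C0 `[- hM, 0] (seg hM x t).
Proof. by move=> xc; apply: seg_C0 => //; apply: econtW xc. Qed.

Lemma F_segB x y t (B : R) : econt setT x -> econt setT y -> 0 <= t ->
  (forall u, t - hM <= u <= t -> enorm (x u - y u) <= B) ->
  enorm (F t (seg hM x t) - F t (seg hM y t)) <= L * B.
Proof.
move=> xc yc t0 H; apply: (le_trans (F_lip _ (seg_C0T _ xc) (seg_C0T _ yc))) => //.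
rewrite ler_pM2l//; apply: supnorm_segB_le => // s sM; apply: H; lra.
Qed.

Lemma F_seg x t (B : R) : econt setT x -> 0 <= t ->
  (forall u, t - hM <= u <= t -> enorm (x u) <= B) ->
  enorm (F t (seg hM x t)) <= L * B.
Proof.
move=> xc t0 H; have zc : econt setT (fun _ : R => 0 : 'rV[R]_n).
  by move=> ? _ e e0; exists 1 => // ? _ _; rewrite subrr enorm0.
have := @F_segB x (fun=> 0) t B xc zc t0.
have -> : seg hM (fun=> 0 : 'rV[R]_n) t = fun=> 0.
  apply/funext => s; have [sM|sM] := boolP (- hM <= s <= 0).
    by rewrite segE.
  by rewrite seg_out.
by rewrite F0// subr0; apply => u uM; rewrite subr0; exact: H.
Qed.

Variables (x0 : R -> 'rV[R]_n) (x0_C0 : C0 `[- hM, 0] x0).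

(** Projection of R onto [-hM, 0]. A function in [C0] vanishes outside that interval and may jump at
    its ends; composing it with [clamp] gives a continuous extension to R, constant on either
    side. *)
Definition clamp (t : R) : R := Num.min (Num.max t (- hM)) 0.

Lemma clamp_in t : - hM <= clamp t <= 0.
Proof.
rewrite /clamp ge_min lexx orbT andbT le_min oppr_le0 (ltW hM_gt0) andbT.
by rewrite le_max lexx orbT.
Qed.

Lemma clamp_id t : - hM <= t <= 0 -> clamp t = t.
Proof. by move=> /andP[tM t0]; rewrite /clamp max_l// min_l. Qed.

Lemma clamp_ge0 t : 0 <= t -> clamp t = 0.
Proof.
by move=> t0; rewrite /clamp min_r// le_max t0.
Qed.

Lemma clamp_lip u t : `|clamp u - clamp t| <= `|u - t|.
Proof. exact: le_trans (minr_lip _ _ _) (maxr_lip _ _ _). Qed.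

Lemma clamp_cont : econt setT (x0 \o clamp).
Proof.
move=> t _ e e0; have /econt_segmentP x0c := C0_econt x0_C0.
have [|d d0 H] := x0c (clamp t) _ e e0; first exact: clamp_in.
exists d => // u _ ut; apply: H; first exact: clamp_in.
by apply: le_lt_trans ut; exact: clamp_lip.
Qed.

Definition extends_x0 x := econt setT x /\ forall t, t <= 0 -> x t = x0 (clamp t).

(** A Picard step as a relation between derivatives: integrals occur only in the construction of one
    such [y], never in the estimates. *)
Definition picard_step x y := forall t, 0 <= t ->
  rderiv y t (F t (seg hM x t)) /\ (0 < t -> is_derive t 1 y (F t (seg hM x t))).

Lemma picard_step_exists x : extends_x0 x ->
  exists y, extends_x0 y /\ picard_step x y.
Proof.
move=> [xc xx0].
(* Freezing the integrand at its value at 0 for negative t makes it continuous on all of R. *)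
pose g t := F (Num.max t 0) (seg hM x (Num.max t 0)).
have gc : econt setT g.
  move=> t _ e e0; have t0 : `[0, +oo[%classic (Num.max t 0).
    by rewrite /= in_itv/= andbT le_max lexx orbT.
  have [d d0 H] := F_cont xc t0 e0; exists d => // u _ ut; apply: H.
    by rewrite /= in_itv/= andbT le_max lexx orbT.
  by apply: le_lt_trans ut; exact: maxr_lip.
have [G GP] := antiderivative_rV gc.
pose y t := x0 (clamp t) + (G (Num.max t 0) - G 0).
have yG t : 0 <= t -> y t = x0 0 + (G t - G 0).
  by move=> t0; rewrite /y clamp_ge0// max_l.
have gE t : 0 <= t -> g t = F t (seg hM x t) by move=> t0; rewrite /g max_l.
have yd t : 0 <= t -> forall e : R, 0 < e -> exists2 d : R, 0 < d & forall h, h != 0 ->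
    `|h| < d -> 0 <= t + h -> enorm (y (t + h) - y t - h *: F t (seg hM x t)) <= e * `|h|.
  move=> t0 e e0.
  have /derivP/(_ e e0)[d d0 H] : is_derive t 1 G (g t) by apply: GP; lra.
  exists d => // h h0 hd th; have := H h h0 hd; rewrite gE// !yG//.
  rewrite (_ : _ - _ - _ = x0 0 + (G (t + h) - G 0) - (x0 0 + (G t - G 0)) -
    h *: F t (seg hM x t))//.
  by apply/rowP => i; rewrite !mxE; ring.
have yr t : 0 <= t -> rderiv y t (F t (seg hM x t)).
  move=> t0 e e0; have [d d0 H] := yd t t0 e e0; exists d => // h h0 hd.
  by have := H h; rewrite gt_eqF// gtr0_norm//; apply => //; lra.
exists y; split; last first.
  move=> t t0; split => [|tp]; first exact: yr.
  apply/derivP => e e0; have [d d0 H] := yd t t0 e e0.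
  exists (Num.min d t); first by rewrite lt_min d0.
  move=> h h0; rewrite lt_min => /andP[hd ht]; apply: H => //.
  by move: ht; rewrite ltr_norml; lra.
split; last by move=> t t0; rewrite /y max_r// subrr addr0.
move=> t _ e e0; have e2 : 0 < e / 2 by rewrite divr_gt0.
have [d1 d10 H1] := clamp_cont (t := t) I e2.
have m1 : - 1 < Num.max t 0 by rewrite lt_max ltrN10 orbT.
have [K [d [K0 d0] H]] := derive_near_lip (GP _ m1).
exists (Num.min d1 (Num.min d (e / 2 / K))); first by rewrite !lt_min d10 d0 !divr_gt0.
move=> u _; rewrite !lt_min => /and3P[ud1 ud ue].
have mut := maxr_lip u t 0.
have := H (Num.max u 0 - Num.max t 0) (le_lt_trans mut ud).
rewrite [Num.max t 0 + _]addrC subrK => Hu.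
have {}Hu : enorm (G (Num.max u 0) - G (Num.max t 0)) < e / 2.
  apply: le_lt_trans Hu _; rewrite mulrC -ltr_pdivlMr//; exact: le_lt_trans mut ue.
have := H1 u I ud1; rewrite /= => Hx.
have := enormD (x0 (clamp u) - x0 (clamp t)) (G (Num.max u 0) - G (Num.max t 0)).
rewrite (_ : _ - _ + _ = y u - y t); first lra.
by rewrite /y; apply/rowP => i; rewrite !mxE; ring.
Qed.

(** The indicator factor records that both functions equal the initial condition at negative times,
    so the discrepancy in a segment comes from its nonnegative times only. *)
Lemma picard_step_diff x x' y y' (C : R) : 0 <= C ->
  econt setT x -> econt setT x' -> extends_x0 y -> extends_x0 y' ->
  picard_step x y -> picard_step x' y' ->
  (forall t, enorm (x t - x' t) <= C * expR (2 * L * t) * (0 <= t)%R%:R) ->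
  forall t, enorm (y t - y' t) <= C / 2 * expR (2 * L * t) * (0 <= t)%R%:R.
Proof.
move=> C0 xc xc' [yc y0] [yc' y0'] Sy Sy' xx t.
have [t0|t0] := leP 0 t; last first.
  by rewrite (y0 _ (ltW t0)) (y0' _ (ltW t0)) subrr enorm0 mulr0.
rewrite mulr1; apply: (@exp_weighted_halving (y \- y')
  (fun t => F t (seg hM x t) - F t (seg hM x' t))) => //.
- by apply: econtB; [exact: econtW yc|exact: econtW yc'].
- by rewrite /= y0// y0'// subrr.
- by move=> s s0; apply: rderivB; [have [] := Sy s s0|have [] := Sy' s s0].
- move=> s s0; apply: F_segB => // u /andP[_ us].
  apply: (le_trans (xx u)); rewrite -mulrA ler_wpM2l//.
  have [u0|u0] := leP 0 u; last by rewrite mulr0 expR_ge0.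
  by rewrite mulr1 ler_expR ler_pM2l// mulr_gt0.
Qed.

Lemma global_solution_exists : exists x, [/\ econt setT x,
  forall s, - hM <= s <= 0 -> x s = x0 s,
  forall t, 0 <= t -> rderiv x t (F t (seg hM x t)) &
  forall t, 0 < t -> is_derive t 1 x (F t (seg hM x t))].
Proof.
(* The step is made a total operator; its value on functions that do not extend the initial
   condition is irrelevant. *)
have /choice[S SP] x : exists y, extends_x0 x -> extends_x0 y /\ picard_step x y.
  have [/picard_step_exists[y yP]|xN] := pselect (extends_x0 x); first by exists y.
  by exists x.
pose X k := iter k S (x0 \o clamp).
have XP k : extends_x0 (X k).
  elim: k => [|k IH]; last by have [] := SP _ IH.
  by split; [exact: clamp_cont|].
have XS k : picard_step (X k) (X k.+1) by have [] := SP _ (XP k).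
pose D := supnorm hM x0.
have D0 : 0 <= D by apply: supnorm_ge0 => //; exact: C0_econt.
have XD t : enorm (X 0%N t) <= D.
  by rewrite /X /= le_supnorm ?clamp_in//; exact: C0_econt.
have exp_ge1 t : 0 <= t -> 1 <= expR (2 * L * t).
  by move=> t0; rewrite -expR0 ler_expR mulr_ge0// mulr_ge0 ?ltW.
have diff k t : enorm (X k.+1 t - X k t) <= D / 2 ^+ k * expR (2 * L * t) * (0 <= t)%R%:R.
  elim: k t => [t|k IH t].
    have [t0|t0] := leP 0 t; last first.
      by have [_ /(_ _ (ltW t0)) ->] := XP 1%N; rewrite subrr enorm0 mulr0.
    rewrite mulr1 expr0 divr1.
    (* The zeroth iterate is bounded by D, so the first one moves away from x0 0 with speed at most
       L * D. *)
    have /le_trans : enorm (X 1%N t - X 0%N t) <= D / 2 * expR (2 * L * t).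
      have -> : X 0%N t = x0 0 by rewrite /X /= clamp_ge0.
      apply: (@exp_weighted_halving (fun t => X 1%N t - x0 0) (fun t => F t (seg hM (X 0%N) t))) => //.
      - have [Xc _] := XP 1%N => u _ e e0; have [d d0 H] := Xc u I e e0.
        by exists d => // w _ wu; rewrite opprB addrA subrK; exact: H.
      - by have [_ ->//] := XP 1%N; rewrite clamp_ge0// subrr.
      - move=> s s0 e e0; have [/(_ e e0)[d d0 H] _] := XS 0%N s s0.
        by exists d => // h h0 hd; rewrite opprB addrA subrK; exact: H.
      - move=> s s0; apply: F_seg => //; first by have [] := XP 0%N.
        move=> u _; apply: (le_trans (XD u)).
        by rewrite -{1}(mulr1 D) ler_wpM2l// exp_ge1.
    by apply; rewrite ler_wpM2r ?expR_ge0//; lra.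
  rewrite exprS invfM mulrCA (mulrC 2^-1).
  apply: (@picard_step_diff (X k.+1) (X k)) => //.
  - by rewrite divr_ge0// ltW// exp2_gt0.
  - by have [] := XP k.+1.
  - by have [] := XP k.
pose W t : R := expR (2 * L * t) * (0 <= t)%R%:R.
have W0 t : 0 <= W t by rewrite mulr_ge0 ?expR_ge0.
have /choice[x xP] t : exists l, forall k, enorm (X k t - l) <= n%:R * (2 * (D * W t) / 2 ^+ k).
  apply: half_pow_cvg_rV => k; apply: (le_trans (diff k t)).
  by rewrite -!mulrA (mulrCA _ (2 ^+ k)^-1) (mulrC (2 ^+ k)^-1) -!mulrA.
pose C := n%:R * (2 * D).
have C_ge0 : 0 <= C by rewrite mulr_ge0// mulr_ge0.
have {}xP k t : enorm (X k t - x t) <= C / 2 ^+ k * expR (2 * L * t) * (0 <= t)%R%:R.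
  apply: (le_trans (xP t k)); rewrite /C /W le_eqVlt; apply/orP; left; apply/eqP.
  by ring.
have Ck k : 0 <= C / 2 ^+ k by rewrite divr_ge0// ltW// exp2_gt0.
have xc : econt setT x.
  (* The weight exp(2Lu) is bounded by E for u within 1 of t, so convergence is uniform there and
     the limit is continuous: e/4 at each end, e/2 for the iterate in between. *)
  move=> t _ e e0; set E := expR (2 * L * (`|t| + 1)).
  have [k kP] := @half_pow_lt _ (C * E) _ (divr_gt0 e0 (ltr0n R 4)).
  have near u : `|u - t| < 1 -> enorm (X k u - x u) < e / 4.
    move=> ut; apply: le_lt_trans kP; apply: (le_trans (xP k u)).
    have uE : expR (2 * L * u) <= E.
      rewrite ler_expR ler_pM2l ?mulr_gt0//.
      have := ler_norm t; move: ut; rewrite ltr_norml; lra.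
    apply: (@le_trans _ _ (C / 2 ^+ k * expR (2 * L * u))).
      by apply: ler_piMr; [exact: mulr_ge0 (Ck k) (expR_ge0 _) | rewrite lern1 leq_b1].
    by rewrite (mulrAC C E); exact: ler_wpM2l (Ck k) _ _ uE.
  have [Xc _] := XP k.
  have [d d0 H] := Xc t I _ (divr_gt0 e0 (ltr0n R 2)).
  exists (Num.min d 1); first by rewrite lt_min d0 ltr01.
  move=> u _; rewrite lt_min => /andP[ud u1].
  have := near u u1; have := near t; rewrite subrr normr0 => /(_ ltr01).
  have := H u I ud.
  have := enorm_triangle (X k u) (x u) (x t).
  have := enorm_triangle (X k t) (X k u) (x t); rewrite (enormBC (x u) (X k u)); lra.
have xx0 : extends_x0 x.
  split => // t t0; apply/eqP; rewrite -subr_eq0; apply/eqP/enorm_eq0/le_anti.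
  rewrite enorm_ge0 andbT; apply/ler_addgt0Pr => e e0; rewrite add0r.
  have [k kP] := @half_pow_lt _ (C * 1) _ e0.
  have [_ <-//] := XP k.
  rewrite enormBC; apply: (le_trans (xP k t)); apply: le_trans (ltW kP).
  rewrite mulr1 -[leRHS]mulr1 -!mulrA !ler_wpM2l ?invr_ge0 ?(ltW (exp2_gt0 _))//.
  have [t0'|] := leP 0 t; last by rewrite mulr0.
  by have -> : t = 0; [lra|rewrite !mulr0 expR0 mulr1].
(* Fixed point: the iterates X k.+1 approach both x and its image y at geometric rate, so y = x and
   x inherits the derivatives of y. *)
have [y0 yS] := SP _ xx0; set y := S x in y0 yS.
have yx t : y t = x t.
  apply/eqP; rewrite -subr_eq0; apply/eqP/enorm_eq0/le_anti.
  rewrite enorm_ge0 andbT; apply/ler_addgt0Pr => e e0; rewrite add0r.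
  set E := expR (2 * L * t) * (0 <= t)%R%:R.
  have E0 : 0 <= E by rewrite mulr_ge0 ?expR_ge0.
  have [k kP] := @half_pow_lt _ (C * E) _ e0.
  have [Xc _] := XP k.
  have := picard_step_diff (Ck k) Xc xc (XP k.+1) y0 (XS k) yS (xP k) t.
  have := xP k.+1 t; have := enorm_triangle (X k.+1 t) (y t) (x t).
  rewrite (enormBC (y t) (X k.+1 t)).
  have -> : C / 2 ^+ k.+1 * expR (2 * L * t) * (0 <= t)%R%:R = C * E / 2 ^+ k / 2.
    by rewrite exprS invfM /E; ring.
  have -> : C / 2 ^+ k / 2 * expR (2 * L * t) * (0 <= t)%R%:R = C * E / 2 ^+ k / 2.
    by rewrite /E; ring.
  lra.
have {}yx : y = x by apply/funext.
rewrite yx in yS; exists x; split => //.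
- by move=> s /[dup] sM /andP[_ s0]; have [_ ->//] := xx0; rewrite clamp_id.
- by move=> t t0; have [] := yS t t0.
- by move=> t t0; have [_ /(_ t0)] := yS t (ltW t0).
Qed.

End Picard.

(** * Truncation, maximal extension and translation of trajectories *)

Section Locality.
Context {R : realType} {n : nat}.
Implicit Types (x y : R -> 'rV[R]_n) (t u h d : R).

Lemma is_derive_local x y t d v : 0 < d -> (forall u, `|u - t| < d -> y u = x u) ->
  is_derive t 1 x v -> is_derive t 1 y v.
Proof.
move=> d0 yx /derivP xv; apply/derivP => e /xv[d' d'0 H].
exists (Num.min d d'); first by rewrite lt_min d0.
move=> h h0; rewrite lt_min => /andP[hd hd'].
rewrite !yx ?subrr ?normr0//; first exact: H.
by rewrite addrAC subrr add0r.
Qed.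

Lemma rderiv_local x y t d v : 0 < d ->
  (forall u, t <= u -> u < t + d -> y u = x u) -> rderiv x t v -> rderiv y t v.
Proof.
move=> d0 yx xv e /xv[d' d'0 H].
exists (Num.min d d'); first by rewrite lt_min d0.
move=> h h0; rewrite lt_min => /andP[hd hd'].
by rewrite !yx; [exact: H|lra|lra|lra|lra].
Qed.

Lemma econt_local (D1 D2 : set R) x y : econt D1 x ->
  forall t d, D1 t -> 0 < d ->
  (forall u, D2 u -> `|u - t| < d -> D1 u /\ y u = x u) -> y t = x t ->
  forall e : R, 0 < e -> exists2 d : R, 0 < d &
    forall u, D2 u -> `|u - t| < d -> enorm (y u - y t) < e.
Proof.
move=> xc t d Dt d0 yx yt e e0; have [d' d'0 H] := xc t Dt e e0.
exists (Num.min d d'); first by rewrite lt_min d0.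
move=> u Du; rewrite lt_min => /andP[ud ud'].
by have [D1u ->] := yx u Du ud; rewrite yt; exact: H.
Qed.

Lemma is_derive_shift_arg x t a v :
  is_derive (t + a) 1 x v <-> is_derive t 1 (fun u => x (u + a)) v.
Proof.
rewrite !derivP; split => H e /H[d d0 K]; exists d => // h h0 hd.
  by have := K h h0 hd; rewrite (addrAC t).
by have := K h h0 hd; rewrite (addrAC t).
Qed.

Lemma rderiv_shift_arg x t a v :
  rderiv x (t + a) v <-> rderiv (fun u => x (u + a)) t v.
Proof.
split => H e /H[d d0 K]; exists d => // h h0 hd.
  by have := K h h0 hd; rewrite (addrAC t).
by have := K h h0 hd; rewrite (addrAC t).
Qed.

End Locality.

Section Truncation.
Context {R : realType} {n : nat}.
Variables (H : R) (H_gt0 : 0 < H).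
Implicit Types (x y : 'rV[R]_n).

(** Radial projection onto the closed ball of radius H; the maximum spares a definition by cases. *)
Definition clip x : 'rV[R]_n := (H / Num.max H (enorm x)) *: x.

Let max_gt0 x : 0 < Num.max H (enorm x).
Proof. by rewrite lt_max H_gt0. Qed.

Lemma clip_le x : enorm (clip x) <= H.
Proof.
rewrite enormZ ger0_norm; last by rewrite divr_ge0// ltW.
rewrite mulrAC ler_pdivrMr// ler_pM2l// le_max lexx orbT//.
Qed.

Lemma clip_id x : enorm x <= H -> clip x = x.
Proof. by move=> xH; rewrite /clip max_l// divff ?scale1r// gt_eqF. Qed.

Lemma clip0 : clip 0 = 0.
Proof. by rewrite /clip scaler0. Qed.

(** The difference splits into a change of point and a change of scaling factor, each of size at
    most enorm (x - y). *)
Lemma clip_lip x y : enorm (clip x - clip y) <= 2 * enorm (x - y).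
Proof.
set a := Num.max H (enorm x); set b := Num.max H (enorm y).
have a0 : 0 < a := max_gt0 x; have b0 : 0 < b := max_gt0 y.
have Ha : H <= a by rewrite le_max lexx.
have yb : enorm y <= b by rewrite le_max lexx orbT.
have ab : `|b - a| <= enorm (x - y).
  apply: le_trans (_ : `|enorm y - enorm x| <= _).
    rewrite /a /b ![Num.max H _]maxC; exact: maxr_lip.
  by rewrite enormBC; exact: enorm_lipschitz.
have -> : clip x - clip y = (H / a) *: (x - y) + (H * (b - a) / (a * b)) *: y.
  apply/rowP => i; rewrite !mxE -/a -/b; field.
  by rewrite !gt_eqF.
have Ha1 : H / a <= 1 by rewrite ler_pdivrMr// mul1r.
have Ha0 : 0 <= H / a by rewrite divr_ge0 ?ltW.
apply: (le_trans (enormD _ _)); rewrite !enormZ.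
have -> : `|H * (b - a) / (a * b)| = H / a * (`|b - a| / b).
  rewrite !normrM !normfV normrM (gtr0_norm H_gt0) (gtr0_norm a0) (gtr0_norm b0).
  by field; rewrite !gt_eqF.
rewrite (ger0_norm Ha0).
have h1 : H / a * enorm (x - y) <= enorm (x - y) by rewrite ler_piMl.
have h2 : `|b - a| / b * enorm y <= enorm (x - y).
  apply: le_trans ab; rewrite mulrAC ler_pdivrMr//.
  by rewrite ler_wpM2l.
have h3 : 0 <= `|b - a| / b * enorm y by rewrite !mulr_ge0 ?invr_ge0// ltW.
rewrite -mulrA.
have h4 : H / a * (`|b - a| / b * enorm y) <= `|b - a| / b * enorm y by rewrite ler_piMl.
lra.
Qed.

Variables (hM : R) (hM_gt0 : 0 < hM).

Lemma econt_clip (D : set R) (x : R -> 'rV[R]_n) : econt D x -> econt D (clip \o x).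
Proof.
move=> xc t Dt e e0; have [d d0 K] := xc t Dt _ (divr_gt0 e0 (ltr0n R 2)).
exists d => // u Du ut; have := K u Du ut; have := clip_lip (x u) (x t).
rewrite /=; lra.
Qed.

Lemma clip_seg (x : R -> 'rV[R]_n) (t : R) :
  clip \o seg hM x t = seg hM (clip \o x) t.
Proof.
apply/funext => s; have [sM|sM] := boolP (- hM <= s <= 0); first by rewrite /= !segE.
by rewrite /= !seg_out// clip0.
Qed.

Lemma C0_clip (phi : R -> 'rV[R]_n) : C0 `[- hM, 0] phi -> C0 `[- hM, 0] (clip \o phi).
Proof.
move=> phi0; rewrite -(C0_seg phi0) clip_seg; apply: seg_C0.
by rewrite sub0r; apply: econt_clip; exact: C0_econt.
Qed.

End Truncation.

Section DelayEquation.
Context {R : realType} {r n : nat}.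
Variables (hM : R) (hM_gt0 : 0 < hM).
Variables (A : set 'rV[R]_r) (f : 'rV[R]_r -> (R -> 'rV[R]_n) -> 'rV[R]_n).
Hypothesis f_cont : continuous_on_prod A (C0 `[- hM, 0]) (supnorm hM) (@enorm R n) f.
Implicit Types (x y : R -> 'rV[R]_n) (zeta : R -> 'rV[R]_r) (t u s a T : R).

Lemma vector_field_cont zeta x T : econt `[0, +oo[ zeta ->
  (forall t, 0 <= t -> A (zeta t)) -> econt `[- hM, T] x ->
  econt `[0, T] (fun t => f (zeta t) (seg hM x t)).
Proof.
move=> zc zA xc t /=; rewrite in_itv/= => /andP[t0 tT] e e0.
have xct u : 0 <= u <= T -> C0 `[- hM, 0] (seg hM x u).
  move=> uT; apply: seg_C0 => //; apply: econtW xc => s /=; rewrite !in_itv/=; lra.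
have [d d0 K] := f_cont (zA t t0) (xct t (introT andP (conj t0 tT))) e0.
have [|d1 d10 K1] := zc t _ d d0; first by rewrite /= in_itv/= t0.
have [|d2 d20 K2] := seg_supnorm_cont hM_gt0 (t := t) xc _ d0; first by lra.
exists (Num.min d1 d2); first by rewrite lt_min d10.
move=> u; rewrite in_itv/= => /[dup] uT /andP[u0 _].
rewrite lt_min => /andP[ut1 ut2]; apply: K; [exact: zA|exact: xct| |].
  by apply: K1 => //; rewrite /= in_itv/= u0.
by apply: K2 => //; lra.
Qed.

Lemma econt_halfline m (g : R -> 'rV[R]_m) :
  (forall T, econt `[0, T] g) -> econt `[0, +oo[ g.
Proof.
move=> gc t /=; rewrite in_itv/= andbT => t0 e e0.
have [|d d0 K] := gc (t + 1) t _ e e0; first by rewrite /= in_itv/=; lra.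
exists (Num.min d 1); first by rewrite lt_min d0 ltr01.
move=> u; rewrite in_itv/= andbT => u0; rewrite lt_min => /andP[ud].
by rewrite ltr_norml => u1; apply: K => //; rewrite /= in_itv/=; lra.
Qed.

Definition esolution zeta x0 (tf : \bar R) x :=
  [/\ (0 < tf)%E,
      econt [set t : R | - hM <= t /\ (t%:E < tf)%E] x,
      forall s, - hM <= s <= 0 -> x s = x0 s,
      forall t, 0 < t -> (t%:E < tf)%E -> is_derive t 1 x (f (zeta t) (seg hM x t)) &
      rderiv x 0 (f (zeta 0) (seg hM x 0))].

Lemma solutionP zeta x0 tf x : solution hM f zeta x0 tf x <-> esolution zeta x0 tf x.
Proof.
by split => -[? /econtP ? ? ? /rderiv0P].
Qed.

Lemma esolution_rderiv zeta x0 tf x t : esolution zeta x0 tf x -> 0 <= t ->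
  (t%:E < tf)%E -> rderiv x t (f (zeta t) (seg hM x t)).
Proof.
case=> _ _ _ xd xr; rewrite le_eqVlt => /predU1P[<- //|t0 ttf].
exact/deriv_rderiv/xd.
Qed.

Lemma esolution_econt zeta x0 tf x T : esolution zeta x0 tf x -> (T%:E < tf)%E ->
  econt `[- hM, T] x.
Proof.
case=> _ xc _ _ _ Ttf; apply: econtW xc => t /=; rewrite in_itv/= => /andP[-> tT].
by split => //; apply: le_lt_trans Ttf; rewrite lee_fin.
Qed.

(** Zorn's lemma on pairs (end, function) ordered by extension. This is only a preorder, since
    functions with the same end may differ outside the interval of existence. *)
Lemma maximal_extension zeta x0 tf x : esolution zeta x0 tf x ->
  exists tf' x', trajectory hM f zeta x0 tf' x'.
Proof.
move=> sol; have hM0 := hM_gt0.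
pose S := {p : \bar R * (R -> 'rV[R]_n) | solution hM f zeta x0 p.1 p.2}.
pose le (p q : S) : Prop := ((sval p).1 <= (sval q).1)%E /\
  forall t, - hM <= t -> (t%:E < (sval p).1)%E -> (sval q).2 t = (sval p).2 t.
pose s0 : S := exist _ (tf, x) ((solutionP _ _ _ _).2 sol).
have [||C Ctot|[[tf' x'] sol'] maxl] := @ZL_preorder S s0 (fun p q => `[< le p q >]).
- by move=> p; apply/asboolP; split.
- move=> p q u /asboolP[pq1 pq2] /asboolP[qu1 qu2]; apply/asboolP; split.
    exact: le_trans qu1.
  by move=> t tM tp; rewrite qu2 ?pq2//; exact: lt_le_trans pq1.
- have [[p0 Cp0]|C0] := pselect (C !=set0); last first.
    by exists s0 => s Cs; exfalso; apply: C0; exists s.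
  pose T := ereal_sup [set (sval p).1 | p in C].
  have pT p : C p -> ((sval p).1 <= T)%E by move=> Cp; apply: ereal_sup_ubound; exists p.
  (* The upper bound of a chain ends at the supremum of the ends; at each time its value is taken
     from some member still defined there, and comparability of members makes the choice
     immaterial. *)
  have /choice[ch chP] t : exists p : S, (t%:E < T)%E -> C p /\ (t%:E < (sval p).1)%E.
    have [tT|tT] := pselect (t%:E < T)%E; last by exists p0.
    have [_ [p Cp <-] tp] := ereal_sup_gt tT; by exists p.
  pose X t := (sval (ch t)).2 t.
  have Xp p t : C p -> - hM <= t -> (t%:E < (sval p).1)%E -> X t = (sval p).2 t.
    move=> Cp tM tp; have [Cc tc] := chP t (lt_le_trans tp (pT _ Cp)).
    rewrite /X; case: (Ctot _ _ Cc Cp) => /asboolP[_ K]; first by rewrite K.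
    by rewrite K.
  have Xseg p t : C p -> 0 <= t -> (t%:E < (sval p).1)%E ->
      seg hM X t = seg hM (sval p).2 t.
    move=> Cp t0 tp; apply: seg_eq => s /andP[sM s0'].
    by apply: Xp => //; [lra|apply: le_lt_trans tp; rewrite lee_fin; lra].
  have solp p : C p -> esolution zeta x0 (sval p).1 (sval p).2.
    by move=> _; apply/solutionP; exact: (svalP p).
  (* Intervals of existence are open on the right, so a member defined at t agrees with the union on
     a neighbourhood of t, as continuity and derivatives require. *)
  have room (b : \bar R) t : (t%:E < b)%E -> exists2 d, 0 < d & ((t + d)%:E < b)%E.
    case: b => [b|_|//]; last by exists 1 => //; rewrite ltry.
    by rewrite lte_fin => tb; exists ((b - t) / 2); rewrite ?lte_fin; lra.
  suff solX : solution hM f zeta x0 T X.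
    exists (exist _ (T, X) solX) => p Cp; apply/asboolP; split => /=; first exact: pT.
    by move=> t tM tp; exact: Xp.
  apply/solutionP; have [p00 p0c p0i p0d p0r] := solp _ Cp0; split.
  + exact: lt_le_trans p00 (pT _ Cp0).
  + move=> t [tM tT]; have [Cc tc] := chP t tT.
    have [_ cc _ _ _] := solp _ Cc; have [d d0 td] := room _ _ tc.
    apply: (@econt_local _ _ _ _ _ _ cc t d) => //.
    move=> u [uM uT] ut; have uc : (u%:E < (sval (ch t)).1)%E.
      by apply: le_lt_trans td; rewrite lee_fin; move: ut; rewrite ltr_norml; lra.
    by split; [split|exact: Xp].
  + move=> s sM; rewrite -p0i//; apply: Xp => //; first by case/andP: sM.
    by apply: le_lt_trans p00; rewrite lee_fin; case/andP: sM.
  + move=> t t0 tT; have [Cc tc] := chP t tT.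
    have [_ _ _ dc _] := solp _ Cc; have [d d0 td] := room _ _ tc.
    rewrite (Xseg _ _ Cc (ltW t0) tc).
    apply: (@is_derive_local _ _ (sval (ch t)).2 X t (Num.min d t)).
    * by rewrite lt_min d0.
    * move=> u; rewrite lt_min !ltr_norml => /andP[ud ut].
      apply: Xp => //; last by apply: le_lt_trans td; rewrite lee_fin; lra.
      lra.
    * exact: dc.
  + rewrite (Xseg _ _ Cp0 (lexx 0) p00); have [d d0 td] := room _ _ p00.
    rewrite add0r in td.
    apply: (rderiv_local d0 _ p0r) => u u0 ud; apply: Xp => //; first lra.
    by apply: le_lt_trans td; rewrite lee_fin; lra.
exists tf', x'; split => // tf2 x2 sol2 le2 agree.
have /asboolP[/= K _] := maxl (exist _ (tf2, x2) sol2) (asboolT (conj le2 agree)).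
by apply/le_anti; rewrite K.
Qed.

Lemma shift_seg x t a : seg hM (fun u => x (u + a)) t = seg hM x (t + a).
Proof. by apply: seg_eq => s _; rewrite addrAC. Qed.

(** Extended by 0 exactly as in [forward_invariant], so that the translate is a member of [HH]
    without any rewriting. *)
Definition shifted zeta a := (fun t => zeta (t + a)) \_ `[0, +oo[.

Lemma shiftedE zeta a t : 0 <= t -> shifted zeta a t = zeta (t + a).
Proof. by move=> t0; rewrite /shifted patchE mem_set//= in_itv/= t0. Qed.

(** The point is maximality: an extension of the translate, glued to x at time a, would extend x
    itself. *)
Lemma trajectory_shift zeta x0 tf x a : trajectory hM f zeta x0 tf x ->
  0 < a -> (a%:E < tf)%E ->
  trajectory hM f (shifted zeta a) (seg hM x a) (tf - a%:E)%E (fun t => x (t + a)).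
Proof.
move=> [/solutionP sol maxl] a0 atf; have hM0 := hM_gt0.
have sub t : (t%:E < tf - a%:E)%E = ((t + a)%:E < tf)%E by rewrite lteBrDr.
split.
  apply/solutionP; have [_ xc _ xd xr] := sol; split.
  - by rewrite lteBrDr// add0e.
  - move=> t [tM tt] e e0; have [|d d0 K] := xc (t + a) _ e e0.
      by split; [lra|rewrite -sub].
    exists d => // u [uM ut] utd; apply: K; last by rewrite opprD addrACA subrr addr0.
    by split; [lra|rewrite -sub].
  - by move=> s sM; rewrite segE// addrC.
  - move=> t t0 tt; rewrite shift_seg shiftedE ?ltW//; apply/is_derive_shift_arg.
    by apply: xd; rewrite ?addr_gt0// -sub.
  - rewrite shift_seg shiftedE//; apply/rderiv_shift_arg.
    by apply: (esolution_rderiv sol); rewrite add0r// ltW.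
move=> tf' x' /solutionP sol' le' agree.
have [tf'0 x'c x'i x'd x'r] := sol'.
have [tf0 xc xi xd xr] := sol.
pose X t := if t < a then x t else x' (t - a).
have Xx t : - hM <= t -> (t%:E < tf)%E -> X t = x t.
  move=> tM tt; rewrite /X; case: ltP => // at_.
  by rewrite agree ?subrK//; [lra|rewrite sub subrK].
have Xx' t : a - hM <= t -> X t = x' (t - a).
  move=> tM; rewrite /X; case: ltP => // ta.
  rewrite agree ?subrK//; first lra.
  by rewrite sub subrK; apply: lt_trans atf; rewrite lte_fin.
have sub' t : (t%:E < tf' + a%:E)%E = ((t - a)%:E < tf')%E.
  by rewrite EFinB lteBlDr.
have Xsol : esolution zeta x0 (tf' + a%:E)%E X.
  split.
  - by rewrite adde_gt0// lte_fin.
  - move=> t [tM tt]; have [ta|at_] := ltP t a.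
      apply: (@econt_local _ _ _ _ _ _ xc t (a - t)).
      + by split => //; apply: lt_trans atf; rewrite lte_fin.
      + lra.
      + move=> u [uM _]; rewrite ltr_norml => ut.
        have utf : (u%:E < tf)%E by apply: lt_trans atf; rewrite lte_fin; lra.
        by split; [split|exact: Xx].
      + by rewrite /X ta.
    have yc : econt [set t | a - hM <= t /\ ((t - a)%:E < tf')%E] (fun t => x' (t - a)).
      move=> u [uM ut] e e0; have [|d d0 K] := x'c (u - a) _ e e0; first by split; [lra|].
      exists d => // w [wM wt] wu; apply: K; first by split; [lra|].
      by rewrite opprB addrA subrK.
    apply: (@econt_local _ _ _ _ _ _ yc t hM) => //.
    + by split; [lra|rewrite -sub'].
    + move=> u [uM ut]; rewrite ltr_norml => utM.
      by split; [split; [lra|rewrite -sub']|rewrite Xx'//; lra].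
    + by rewrite Xx'//; lra.
  - move=> s /[dup] sM /andP[s1 s2]; rewrite Xx ?xi//.
    by apply: le_lt_trans tf0; rewrite lee_fin.
  - move=> t t0 tt; have [ta|at_] := ltP t a.
      rewrite (_ : seg hM X t = seg hM x t); last first.
        apply: seg_eq => s sM; apply: Xx; first lra.
        by apply: lt_trans atf; rewrite lte_fin; lra.
      apply: (@is_derive_local _ _ x X t (Num.min t (a - t))).
      + by rewrite lt_min t0 subr_gt0.
      + move=> u; rewrite lt_min !ltr_norml => /andP[u1 u2].
        by apply: Xx; [lra|apply: lt_trans atf; rewrite lte_fin; lra].
      + by apply: xd => //; apply: lt_trans atf; rewrite lte_fin.
    have segX : seg hM X t = seg hM x' (t - a).
      by apply: seg_eq => s sM; rewrite Xx' 1?addrAC//; lra.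
    (* At the seam t = a the translated solution provides a right derivative only. As a < tf, [x] is
       differentiable there and [X] coincides with it on both sides. *)
    move: at_; rewrite le_eqVlt => /predU1P[at_|at_].
      have -> : f (zeta t) (seg hM X t) = f (zeta t) (seg hM x t).
        rewrite -at_; congr f; apply: seg_eq => s sM; apply: Xx; first lra.
        by apply: le_lt_trans atf; rewrite lee_fin; lra.
      have [b b0 ab] : exists2 b, 0 < b & ((a + b)%:E < tf)%E.
        move: atf; case: (tf) => [c|_|//]; last by exists 1 => //; rewrite ltry.
        by rewrite lte_fin => ac; exists ((c - a) / 2); rewrite ?lte_fin; lra.
      apply: (@is_derive_local _ _ x X t (Num.min t b)).
      + by rewrite lt_min t0.
      + move=> u; rewrite lt_min !ltr_norml => /andP[u1 u2].
        by apply: Xx; [lra|apply: lt_trans ab; rewrite lte_fin; lra].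
      + by apply: xd => //; rewrite -at_.
    have ta0 : 0 < t - a by lra.
    have := x'd (t - a) ta0; rewrite -sub' => /(_ tt); rewrite shiftedE ?ltW// subrK -segX.
    move=> /(is_derive_shift_arg (x') t (- a) _).1.
    apply: (@is_derive_local _ _ _ _ _ hM) => // u; rewrite ltr_norml => ut.
    by rewrite Xx'//; lra.
  - rewrite (_ : seg hM X 0 = seg hM x 0); last first.
      apply: seg_eq => s sM; apply: Xx; first lra.
      by apply: lt_trans atf; rewrite lte_fin; lra.
    apply: (rderiv_local a0 _ xr) => u u0 ua; apply: Xx; first lra.
    by apply: lt_trans atf; rewrite lte_fin; lra.
have le2 : (tf <= tf' + a%:E)%E by rewrite -leeBlDr.
have := maxl _ _ ((solutionP _ _ _ _).2 Xsol) le2 Xx.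
by move=> <-; rewrite addeK.
Qed.

End DelayEquation.

(** * Existence, uniqueness and continuation inside the ball of radius H *)

Section WellPosedness.
Context {R : realType} {r n : nat}.
Variables (hM : R) (hM_gt0 : 0 < hM).
Variables (A : set 'rV[R]_r) (f : 'rV[R]_r -> (R -> 'rV[R]_n) -> 'rV[R]_n).
Hypothesis f_cont : continuous_on_prod A (C0 `[- hM, 0]) (supnorm hM) (@enorm R n) f.
Hypothesis f0 : forall xi, A xi -> f xi (fun=> 0) = 0.
Variables (H L : R) (H_gt0 : 0 < H) (L_gt0 : 0 < L).
Hypothesis f_lip : forall xi phi psi, A xi ->
  C0 `[- hM, 0] phi -> supnorm hM phi <= H ->
  C0 `[- hM, 0] psi -> supnorm hM psi <= H ->
  enorm (f xi phi - f xi psi) <= L * supnorm hM (phi \- psi).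
Variables (zeta : R -> 'rV[R]_r).
Hypothesis zeta_cont : econt `[0, +oo[ zeta.
Hypothesis zeta_A : forall t, 0 <= t -> A (zeta t).
Implicit Types (x y : R -> 'rV[R]_n) (t u s a b T : R).

(** The Lipschitz bound against the zero segment, where f vanishes; B <= H keeps both segments in
    the ball where that bound holds. *)
Lemma vector_field_le x t (B : R) : 0 <= t -> econt `[t - hM, t] x -> B <= H ->
  (forall u, t - hM <= u <= t -> enorm (x u) <= B) ->
  enorm (f (zeta t) (seg hM x t)) <= L * B.
Proof.
move=> t0 xc BH xB; have hM0 := hM_gt0.
have xs : C0 `[- hM, 0] (seg hM x t) by exact: seg_C0.
have z0 : C0 `[- hM, 0] (fun=> 0 : 'rV[R]_n).
  split; first by apply/econtP => u _ e e0; exists 1 => // ? _ _; rewrite subrr enorm0.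
  by apply/funext => s; rewrite patchE; case: ifP => // _; apply/rowP => i; rewrite !mxE.
have sB : supnorm hM (seg hM x t) <= B by exact: supnorm_seg_le.
have := f_lip (zeta_A t0) xs (le_trans sB BH) z0.
rewrite f0 ?subr0; last exact: zeta_A.
have -> : seg hM x t \- (fun=> 0) = seg hM x t by apply/funext => s; rewrite /= subr0.
have -> : supnorm hM (fun=> 0 : 'rV[R]_n) <= H.
  by apply: supnorm_le => // s _; rewrite enorm0 ltW.
by move=> /(_ isT)/le_trans; apply; rewrite ler_pM2l.
Qed.

Definition truncated t (phi : R -> 'rV[R]_n) := f (zeta t) (clip H \o phi).

Lemma supnorm_clip (phi : R -> 'rV[R]_n) : supnorm hM (clip H \o phi) <= H.
Proof. by apply: supnorm_le => // s _; exact: clip_le. Qed.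

Lemma truncated0 t : 0 <= t -> truncated t (fun=> 0) = 0.
Proof.
move=> t0; rewrite /truncated (_ : _ \o _ = fun=> 0) ?f0//; first exact: zeta_A.
by apply/funext => s; rewrite /= clip0.
Qed.

Lemma truncated_lip t phi psi : 0 <= t -> C0 `[- hM, 0] phi -> C0 `[- hM, 0] psi ->
  enorm (truncated t phi - truncated t psi) <= 2 * L * supnorm hM (phi \- psi).
Proof.
move=> t0 phic psic; apply: (le_trans (f_lip (zeta_A t0) _ _ _ _)).
- exact: C0_clip.
- exact: supnorm_clip.
- exact: C0_clip.
- exact: supnorm_clip.
rewrite (mulrC 2) -mulrA ler_pM2l//; apply: supnorm_le => // s sM.
apply: (le_trans (clip_lip H_gt0 _ _)); rewrite ler_pM2l//.
rewrite -[phi s - psi s]/((phi \- psi) s); apply: le_supnorm => //.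
by apply: econtB; exact: C0_econt.
Qed.

Lemma truncated_cont x : econt setT x -> econt `[0, +oo[ (fun t => truncated t (seg hM x t)).
Proof.
move=> xc; apply: econt_halfline => T.
have := @vector_field_cont R r n hM hM_gt0 A f f_cont zeta (clip H \o x) T zeta_cont zeta_A.
have E : (fun t => f (zeta t) (seg hM (clip H \o x) t)) =
    (fun t => truncated t (seg hM x t)).
  by apply/funext => t; rewrite /truncated clip_seg.
by rewrite E; apply; apply: econt_clip => //; exact: econtW xc.
Qed.

Variables (x0 : R -> 'rV[R]_n) (x0_C0 : C0 `[- hM, 0] x0).

Definition truncated_solution y := [/\ econt setT y,
  forall s, - hM <= s <= 0 -> y s = x0 s,
  forall t, 0 <= t -> rderiv y t (truncated t (seg hM y t)) &
  forall t, 0 < t -> is_derive t 1 y (truncated t (seg hM y t))].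

Lemma truncated_solution_exists : exists y, truncated_solution y.
Proof.
have L2 : 0 < 2 * L by rewrite mulr_gt0.
exact: (global_solution_exists hM_gt0 L2 truncated0 truncated_lip truncated_cont x0_C0).
Qed.

Lemma clip_seg_id x t : (forall u, t - hM <= u <= t -> enorm (x u) <= H) ->
  clip H \o seg hM x t = seg hM x t.
Proof.
move=> xH; rewrite clip_seg//; apply: seg_eq => s sM; rewrite /= clip_id//.
by apply: xH; lra.
Qed.

(** Gronwall with zero initial discrepancy: while enorm x <= H the projection does not act on x, so
    both functions solve the globally Lipschitz equation. *)
Lemma truncated_solution_unique y tf x : truncated_solution y ->
  esolution hM f zeta x0 tf x ->
  (forall t, - hM <= t -> (t%:E < tf)%E -> enorm (x t) <= H) ->
  forall t, - hM <= t -> (t%:E < tf)%E -> x t = y t.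
Proof.
move=> [yc yi yr yd] sol xH t tM tt; have [_ _ xi _ _] := sol; have hM0 := hM_gt0.
have [t0|t0] := leP t 0; first by rewrite xi ?yi// tM t0.
have L2 : 0 < 2 * L by rewrite mulr_gt0.
apply/eqP; rewrite -subr_eq0; apply/eqP/enorm_eq0/le_anti; rewrite enorm_ge0 andbT.
have := @gronwall_delay _ _ hM hM_gt0 (x \- y)
  (fun t => f (zeta t) (seg hM x t) - truncated t (seg hM y t)) (2 * L) 0 t L2 (ltW t0).
rewrite mulr0 => K; apply: le_trans (K _ _ _ _ t _) _; last by rewrite mul0r.
- apply: econtB; last exact: econtW yc.
  exact: esolution_econt sol _.
- by move=> s sM; rewrite /= xi// yi// subrr enorm0.
- move=> s s0 st; apply: rderivB; last exact: yr.
  by apply: (esolution_rderiv sol) => //; apply: lt_trans tt; rewrite lte_fin.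
- move=> s B s0 st sB.
  have ss : (s%:E < tf)%E by apply: lt_trans tt; rewrite lte_fin.
  have xs : clip H \o seg hM x s = seg hM x s.
    apply: clip_seg_id => u /andP[u1 u2]; apply: xH; first by lra.
    by apply: le_lt_trans ss; rewrite lee_fin.
  rewrite -{1}xs; apply: le_trans (truncated_lip s0 _ _) _.
  + apply: seg_C0 => //; apply: econtW (esolution_econt sol ss) => u /=.
    by rewrite !in_itv/=; lra.
  + exact: seg_C0T.
  + rewrite ler_pM2l//; apply: supnorm_segB_le => // u uM.
    by apply: sB; lra.
- by rewrite lexx ltW.
Qed.

Lemma truncated_esolution y T : truncated_solution y -> 0 < T ->
  (forall t, - hM <= t -> t < T -> enorm (y t) <= H) -> esolution hM f zeta x0 T%:E y.
Proof.
move=> [yc yi yr yd] T0 yH; have hM0 := hM_gt0.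
have ys t : 0 <= t -> t < T -> f (zeta t) (seg hM y t) = truncated t (seg hM y t).
  by move=> t0 tT; rewrite /truncated clip_seg_id// => u uM; apply: yH; lra.
split => //.
- exact: econtW yc.
- by move=> t t0 tT; rewrite ys//; [exact: yd|exact: ltW].
- by rewrite ys//; exact: yr.
Qed.

(* The projected equation is solved globally; its solution solves the original one
   for a short time, which is enough to start the maximal extension. *)
Lemma trajectory_exists : supnorm hM x0 < H ->
  exists tf x, trajectory hM f zeta x0 tf x.
Proof.
move=> x0H; have hM0 := hM_gt0.
have [y ysol] := truncated_solution_exists; have [yc yi _ _] := ysol.
have y0s s : - hM <= s <= 0 -> enorm (y s) <= supnorm hM x0.
  by move=> sM; rewrite yi//; apply: le_supnorm => //; exact: C0_econt.
have HS : 0 < H - supnorm hM x0 by rewrite subr_gt0.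
have [d d0 K] := yc 0 I _ HS.
apply: (maximal_extension hM_gt0 (truncated_esolution ysol d0 _)) => t tM td.
have [t0|t0] := leP t 0; first by apply: le_trans (ltW x0H); apply: y0s; rewrite tM.
have := K t I; rewrite subr0 gtr0_norm// => /(_ td).
have := enormD (y t - y 0) (y 0); rewrite subrK.
have := y0s 0; rewrite lexx andbT => /(_ _)/wrap[]; lra.
Qed.

(** If the end T were finite, x would coincide up to T with the global solution y of the projected
    equation. By continuity y stays in the ball of radius H a little beyond T, because b < H, so y
    would be a proper extension of x. *)
Lemma bounded_trajectory_global tf x b : trajectory hM f zeta x0 tf x -> b < H ->
  (forall t, - hM <= t -> (t%:E < tf)%E -> enorm (x t) <= b) -> tf = +oo%E.
Proof.
move=> [/solutionP sol maxl] bH xb; have hM0 := hM_gt0.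
have [tf0 _ _ _ _] := sol.
have [y ysol] := truncated_solution_exists; have [yc yi _ _] := ysol.
have xy : forall t, - hM <= t -> (t%:E < tf)%E -> x t = y t.
  apply: truncated_solution_unique => // t tM tt; apply: le_trans (ltW bH).
  exact: xb.
move: tf0 maxl xb xy {sol}; case: tf => [T|//|//]; rewrite lte_fin => T0 maxl xb xy.
have Hb : 0 < H - b by rewrite subr_gt0.
have [d d0 K] := yc T I _ (divr_gt0 Hb (ltr0n R 2)).
have yTd t : - hM <= t -> t < T + d -> enorm (y t) <= H.
  move=> tM tT; have [tT'|Tt] := ltP t T.
    by rewrite -xy// ?lte_fin//; apply: le_trans (ltW bH); apply: xb.
  (* A time just before T, where the bound b is known. Two errors of (H - b)/2, from u to T and from
     T to t, then give enorm (y t) <= H. *)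
  pose u := Num.max 0 (T - d / 2).
  have uT : u < T by rewrite gt_max T0/=; lra.
  have u0 : 0 <= u by rewrite le_max lexx.
  have ud : T - d / 2 <= u by rewrite le_max lexx orbT.
  have yu : enorm (y u) <= b by rewrite -xy ?lte_fin//; [apply: xb; rewrite ?lte_fin//; lra|lra].
  have := K t I; rewrite ger0_norm ?subr_ge0// => /(_ _)/wrap[]; first by lra.
  have := K u I; rewrite distrC gtr0_norm ?subr_gt0// => /(_ _)/wrap[]; first by lra.
  have := enorm_triangle (y T) (y t) (y u); rewrite (enormBC (y T) (y u)).
  have := enormD (y t - y u) (y u); rewrite subrK; lra.
have Td0 : 0 < T + d by lra.
have TTd : (T%:E <= (T + d)%:E)%E by rewrite lee_fin lerDl ltW.
have := maxl (T + d)%:E y ((solutionP _ _ _ _ _ _).2 (truncated_esolution ysol Td0 yTd)) TTd.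
move=> /(_ _)/wrap[]; first by move=> t tM tt; rewrite xy.
by move=> /(congr1 fine)/= E; exfalso; lra.
Qed.

Lemma solution_growth tf x T (D : R) : esolution hM f zeta x0 tf x ->
  0 <= T -> (T%:E < tf)%E ->
  (forall t, - hM <= t -> t <= T -> enorm (x t) <= H) ->
  supnorm hM x0 <= D ->
  forall t, 0 <= t <= T -> enorm (x t) <= 3 * D * expR (2 * L * t).
Proof.
move=> sol T0 Ttf xH x0D; have [_ _ xi _ _] := sol; have hM0 := hM_gt0.
have xc := esolution_econt sol Ttf.
apply: (gronwall_delay hM_gt0 L_gt0 T0 xc (v := fun t => f (zeta t) (seg hM x t))).
- move=> t tM; rewrite xi//; apply: le_trans x0D; apply: le_supnorm => //.
  exact: C0_econt.
- by move=> t t0 tT; apply: (esolution_rderiv sol) => //; apply: lt_trans Ttf; rewrite lte_fin.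
- move=> t B t0 tT xB.
  have xct : econt `[t - hM, t] x.
    by apply: econtW xc => u /=; rewrite !in_itv/=; lra.
  (* The Lipschitz bound stops at H; a larger B is replaced by H, which also bounds x on the
     window. *)
  have [BH|HB] := leP B H; first exact: vector_field_le.
  apply: le_trans (_ : L * H <= _); last by rewrite ler_pM2l// ltW.
  by apply: vector_field_le => // u uM; apply: xH; lra.
Qed.

End WellPosedness.

(** * Du Bois-Reymond lemma *)

Section TestFunctions.
Context {R : realType}.
Implicit Types (t u s h w : R).

Lemma real_is_deriveP (g : R -> R) t v : is_derive t 1 g v <->
  forall e : R, 0 < e -> exists2 d : R, 0 < d & forall h, h != 0 -> `|h| < d ->
    `|g (t + h) - g t - h * v| <= e * `|h|.
Proof.
have E h : h != 0 -> `|h^-1 *: (g (t + h) - g t) - v| =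
    `|h|^-1 * `|g (t + h) - g t - h * v|.
  move=> h0; rewrite -normfV -normrM; congr `|_|.
  by rewrite mulrBr mulKf.
have K : (h^-1 *: ((g \o shift t) (h *: 1) - g t) @[h --> 0^'] --> v) <->
    forall e : R, 0 < e -> exists2 d : R, 0 < d & forall h, h != 0 -> `|h| < d ->
    `|g (t + h) - g t - h * v| <= e * `|h|.
  split => [/cvgrPdist_lt H e e0|H].
    have := H e e0; rewrite near_withinE => /nbhs_ballP[d/= d0 xd].
    exists d => // h h0 hd.
    have := xd h; rewrite /ball/= sub0r normrN => /(_ hd h0).
    rewrite [h *: 1]mulr1 [h + t]addrC distrC (E _ h0).
    by rewrite mulrC ltr_pdivrMr ?normr_gt0// => /ltW.
  apply/cvgrPdist_lt => e e0; have e2 : 0 < e / 2 by rewrite divr_gt0.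
  have [d d0 xd] := H _ e2; rewrite near_withinE.
  apply/nbhs_ballP; exists d => // h; rewrite /ball/= sub0r normrN => hd h0.
  rewrite [h *: 1]mulr1 [h + t]addrC distrC (E _ h0) mulrC ltr_pdivrMr ?normr_gt0//.
  apply: le_lt_trans (xd _ h0 hd) _.
  by rewrite ltr_pM2r ?normr_gt0// ltr_pdivrMr// ltr_pMr// ltr1n.
split=> [[dx dxv]|].
  by apply/K; rewrite -dxv; exact: dx.
move=> /K vx; apply: DeriveDef; first by apply/cvg_ex; exists v.
by apply/cvg_lim.
Qed.

(** Squaring the positive part removes its kink: the derivative 2 max(w, 0) is continuous. *)
Definition pos_sqr w : R := Num.max w 0 ^+ 2.

Lemma pos_sqr_ge0 w : 0 <= pos_sqr w. Proof. exact: sqr_ge0. Qed.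

Lemma is_derive_pos_sqr w : is_derive w 1 pos_sqr (2 * Num.max w 0).
Proof.
apply/real_is_deriveP => e e0; exists e => // h h0 he.
apply: (@le_trans _ _ (`|h| * `|h|)); last by rewrite ler_pM2r ?normr_gt0// ltW.
rewrite -normrM ger0_norm; last by rewrite -expr2 sqr_ge0.
rewrite /pos_sqr ler_norml.
by case: (leP w 0) => w0; case: (leP (w + h) 0) => wh; apply/andP; split; nra.
Qed.

(* k q / (1 + k q) with q = max ((s - a)(b - s), 0)^2, a C^1 function supported
   in [a, b]; it increases to the indicator of ]a, b[ with k. *)
Definition bump a b (k : R) s : R :=
  1 - (1 + k * pos_sqr ((s - a) * (b - s)))^-1.

Definition bump_deriv a b (k : R) s : R :=
  (1 + k * pos_sqr ((s - a) * (b - s))) ^- 2 *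
  (k * (2 * Num.max ((s - a) * (b - s)) 0 * (a + b - 2 * s))).

Lemma bump_den_ge1 a b (k : R) s : 0 <= k -> 1 <= 1 + k * pos_sqr ((s - a) * (b - s)).
Proof. by move=> k0; rewrite lerDl mulr_ge0// pos_sqr_ge0. Qed.

Lemma is_derive_bump a b (k : R) s : 0 <= k ->
  is_derive s 1 (bump a b k) (bump_deriv a b k s).
Proof.
move=> k0; have D0 : 1 + k * pos_sqr ((s - a) * (b - s)) != 0.
  by rewrite gt_eqF// (lt_le_trans ltr01)// bump_den_ge1.
have du : is_derive s 1 (fun s : R => (s - a) * (b - s)) (a + b - 2 * s).
  apply/real_is_deriveP => e e0; exists e => // h h0 he.
  rewrite (_ : _ - _ - _ = - (h * h)); last by ring.
  by rewrite normrN normrM ler_pM2r ?normr_gt0// ltW.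
have dq := @is_derive1_comp R pos_sqr (fun s : R => (s - a) * (b - s)) s _ _
  (is_derive_pos_sqr _) du.
have dD : is_derive s 1 (fun s => 1 + k * pos_sqr ((s - a) * (b - s)))
    (k * (2 * Num.max ((s - a) * (b - s)) 0 * (a + b - 2 * s))).
  apply/real_is_deriveP => e e0.
  have k1 : 0 < k + 1 by rewrite ltr_wpDl.
  have [d d0 K] := (real_is_deriveP _ _ _).1 dq (e / (k + 1)) (divr_gt0 e0 k1).
  exists d => // h h0 hd; have {}K := K h h0 hd.
  rewrite (_ : _ - _ - _ = k * (pos_sqr ((s + h - a) * (b - (s + h))) -
    pos_sqr ((s - a) * (b - s)) - h * (2 * Num.max ((s - a) * (b - s)) 0 * (a + b - 2 * s)))).
    rewrite normrM ger0_norm//; apply: (le_trans (ler_wpM2l k0 K)).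
    rewrite mulrA ler_pM2r ?normr_gt0// mulrA ler_pdivrMr// (mulrC k) ler_wpM2l ?ltW//.
    by rewrite ltrDl.
  by ring.
have dV := @is_deriveV R (fun s : R => 1 + k * pos_sqr ((s - a) * (b - s))) s _ 1 D0 dD.
apply/real_is_deriveP => e e0; have [d d0 K] := (real_is_deriveP _ _ _).1 dV e e0.
exists d => // h h0 hd; have := K h h0 hd; rewrite -normrN; congr (`|_| <= _).
by rewrite /bump /bump_deriv /GRing.scale/=; ring.
Qed.

Lemma continuous_bump_deriv a b (k : R) : 0 <= k -> continuous (bump_deriv a b k).
Proof.
move=> k0 s.
have cu : {for s, continuous (fun s : R => (s - a) * (b - s))}.
  apply: continuousM; first by apply: continuousB; [exact: cvg_id|exact: cvg_cst].
  by apply: continuousB; [exact: cvg_cst|exact: cvg_id].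
have cm : {for s, continuous (fun s : R => Num.max ((s - a) * (b - s)) 0)}.
  apply/cvgrPdist_lt => e e0; have /cvgrPdist_lt/(_ e e0) := cu.
  by apply: filterS => t; apply: le_lt_trans; exact: maxr_lip.
have cD : {for s, continuous (fun s : R => 1 + k * pos_sqr ((s - a) * (b - s)))}.
  apply: cvgD; first exact: cvg_cst.
  apply: cvgM; first exact: cvg_cst.
  by rewrite /pos_sqr /=; under eq_fun do rewrite expr2; apply: cvgM; exact: cm.
have D0 : 1 + k * pos_sqr ((s - a) * (b - s)) != 0.
  by rewrite gt_eqF// (lt_le_trans ltr01)// bump_den_ge1.
rewrite /continuous_at /bump_deriv; apply: cvgM.
  apply: cvgV; first by rewrite expf_neq0.
  by rewrite expr2; under eq_fun do rewrite expr2; apply: cvgM; exact: cD.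
apply: cvgM; first exact: cvg_cst.
apply: cvgM; first by apply: cvgM; [exact: cvg_cst|exact: cm].
apply: cvgB; first exact: cvg_cst.
by apply: cvgM; [exact: cvg_cst|exact: cvg_id].
Qed.

Lemma bump_out a b (k : R) s : a < b -> ~~ (a <= s <= b) -> bump a b k s = 0.
Proof.
move=> ab sab; rewrite /bump /pos_sqr max_r ?expr0n ?mulr0 ?addr0 ?invr1 ?subrr//.
by move: sab; rewrite negb_and -!ltNge => /orP[]; nra.
Qed.

Lemma bump_ge0_le1 a b (k : R) s : 0 <= k -> 0 <= bump a b k s <= 1.
Proof.
move=> k0; have D1 := bump_den_ge1 a b s k0.
have D0 := lt_le_trans ltr01 D1.
rewrite /bump subr_ge0 invf_le1// D1/= gerBl invr_ge0.
exact: ltW.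
Qed.

Lemma bump_cvg a b s : a < b ->
  bump a b k%:R s @[k --> \oo] --> (\1_(`]a, b[%classic) s : R).
Proof.
move=> ab; rewrite indicE; have [sab|sab] := boolP (a < s < b); last first.
  rewrite memNset; last by rewrite /= in_itv/=; exact/negP.
  rewrite [X in X @ _](_ : _ = cst 0); first exact: cvg_cst.
  apply/funext => k; have [|sab'] := boolP (a <= s <= b); last exact: bump_out.
  move=> /andP[as_ sb]; rewrite /bump /pos_sqr max_r ?expr0n ?mulr0 ?addr0 ?invr1 ?subrr//.
  by move: sab; rewrite negb_and -!leNgt => /orP[]; nra.
rewrite mem_set/=; last by rewrite in_itv.
have q0 : 0 < pos_sqr ((s - a) * (b - s)).
  by rewrite /pos_sqr exprn_gt0// lt_max; apply/orP; left; case/andP: sab => *; nra.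
set q := pos_sqr _ in q0.
apply/cvgrPdist_lt => e e0.
exists (Num.truncn (e * q)^-1).+1 => // k /= ke; rewrite /bump -/q.
have eq0 : 0 < e * q by rewrite mulr_gt0.
rewrite opprB addrC subrK ger0_norm; last by rewrite invr_ge0 addr_ge0// mulr_ge0// ltW.
have kq : 0 <= k%:R * q by rewrite mulr_ge0// ltW.
rewrite invf_plt ?posrE//; last by lra.
apply: (@lt_trans _ _ (k%:R * q)); last by rewrite ltrDr.
rewrite -ltr_pdivrMr// -invfM; apply: lt_le_trans (_ : (Num.truncn (e * q)^-1).+1%:R <= _).
  exact: truncnS_gt.
by rewrite ler_nat.
Qed.

Lemma test_function_bump (hM : R) a b (k : R) : 0 <= k -> - hM < a -> a < b -> b < 0 ->
  test_function hM (bump a b k).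
Proof.
move=> k0 Ma ab b0; split.
- by move=> s; have [] := is_derive_bump a b s k0.
- rewrite (_ : derive1 _ = bump_deriv a b k); first exact: continuous_bump_deriv.
  by apply/funext => s; rewrite derive1E; have [_] := is_derive_bump a b s k0.
- by exists a, b; split => // s; exact: bump_out.
Qed.

Lemma test_function_cont (hM : R) (psi : R -> R) : test_function hM psi -> continuous psi.
Proof.
by move=> [dpsi _ _] s; apply: differentiable_continuous; apply/derivable1_diffP.
Qed.

End TestFunctions.

Section FundamentalLemma.
Context {R : realType}.
Variables (hM : R) (hM_gt0 : 0 < hM).
Notation mu := (@lebesgue_measure R).
Notation J := (`[- hM, 0]%classic : set R).
Implicit Types (t u s h w : R) (g : R -> R).

Lemma continuous_integrable g : {within J, continuous g} -> mu.-integrable J (EFin \o g).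
Proof. by apply: continuous_compact_integrable; exact: segment_compact. Qed.

Lemma integrableM_cont g psi : mu.-integrable J (EFin \o g) -> {within J, continuous psi} ->
  mu.-integrable J (EFin \o (fun s => g s * psi s)).
Proof.
move=> gi psic.
have [M MP] : exists M, forall s, J s -> `|psi s| <= M.
  have M0 : - hM <= 0 by rewrite oppr_le0 ltW.
  have npsic : {within J, continuous (fun s => `|psi s|)}.
    by move=> s; apply: continuous_comp; [exact: psic|exact: norm_continuous].
  have [c _ cm] := EVT_max M0 npsic.
  by exists `|psi c| => s /= sM; exact: cm.
have mpsi : measurable_fun J psi by exact: subspace_continuous_measurable_fun.
have bpsi : [bounded psi x | x in J].
  exists M; split; first exact: num_real.
  by move=> y My s Js; apply: le_trans (MP s Js) (ltW My).
exact: (integrableMl _ gi mpsi bpsi).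
Qed.

(** At a Lebesgue point s, g s is the derivative at s of the integral over ]c, y] as a function of
    y, and that integral is zero for y near s. Almost every point is a Lebesgue point, and the two
    ends of the interval are null. *)
Lemma null_intervals_ae g : mu.-integrable J (EFin \o g) ->
  (forall a b, - hM < a -> a < b -> b < 0 -> \int[mu]_(s in `]a, b]) g s = 0) ->
  ae_eq mu J (EFin \o g) (cst 0%E).
Proof.
move=> gi gab.
have mJ : measurable J by exact: measurable_itv.
have lp := lebesgue_differentiation (integrable_locally mJ gi).
have ne (c : R) : {ae mu, forall s, s <> c}.
  exists [set c]; split; [exact: measurable_set1|exact: lebesgue_measure_set1|].
  by move=> s /= /contrapT.
have F : Filter (almost_everywhere mu) := ae_filter_ringOfSetsType mu.
suff key s : lebesgue_pt (g \_ J) s -> - hM < s -> s < 0 -> g s = 0.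
  have := @filterI _ _ F _ _ lp (@filterI _ _ F _ _ (ne (- hM)) (ne 0)).
  apply: (@filterS _ _ F) => s [slp [sM s0]]; rewrite /= in_itv/= => /andP[sM' s0'].
  congr EFin; apply: key => //.
    by rewrite lt_neqAle sM' andbT; apply/eqP => E; apply: sM.
  by rewrite lt_neqAle s0' andbT; apply/eqP.
move=> slp sM s0.
pose c := (- hM + s) / 2; have cM : - hM < c by rewrite /c; lra.
have cs : c < s by rewrite /c; lra.
have su : s < s / 2 by lra.
have gi' : mu.-integrable `]c, s / 2] (EFin \o (g \_ J)).
  have gi2 : mu.-integrable `]c, s / 2] (EFin \o g).
    apply: (integrableS _ _ _ gi); [exact: measurable_itv|exact: measurable_itv|].
    by move=> t; rewrite /= !in_itv/= => /andP[ct ts]; apply/andP; split; lra.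
  apply: eq_integrable gi2; first exact: measurable_itv.
  move=> t; rewrite inE/= in_itv/= => /andP[ct ts].
  by rewrite patchE mem_set//= in_itv/=; apply/andP; split; lra.
have cbs : (BRight c < BRight s)%O by rewrite bnd_simp.
have [_] := FTC1_lebesgue_pt su gi' cbs slp.
rewrite [in X in _ = X -> _]patchE mem_set/=; last by rewrite in_itv/= !ltW.
move=> <-; rewrite derive1E.
have -> : 'D_1 (fun y => \int[mu]_(t in `]c, y]) (g \_ J) t) s = 'D_1 (cst (0 : R)) s.
  apply: near_eq_derive => //.
  near=> y.
  have cy : c < y by near: y; exact: lt_nbhsr.
  have y0 : y < 0 by near: y; exact: lt_nbhsl.
  rewrite /= -[RHS](gab c y cM cy y0); apply: eq_Rintegral => t.
  rewrite inE/= in_itv/= patchE => /andP[ct ty]; rewrite mem_set//= in_itv/=.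
  by apply/andP; split; lra.
by rewrite derive_cst.
Unshelve. all: by end_near. Qed.

(** Testing against the bumps on ]a, b[ and letting k grow, dominated by |g|, shows that g has zero
    integral over every inner interval. *)
Lemma fundamental_lemma g : mu.-integrable J (EFin \o g) ->
  (forall psi, test_function hM psi -> \int[mu]_(s in J) (g s * psi s) = 0) ->
  ae_eq mu J (EFin \o g) (cst 0%E).
Proof.
move=> gi gpsi; apply: null_intervals_ae => // a b Ma ab b0.
have mJ : measurable J by exact: measurable_itv.
have mg : measurable_fun J g by apply/measurable_EFinP; case/integrableP: gi.
have cb k : continuous (bump a b k%:R).
  exact: test_function_cont (test_function_bump (hM := hM) (ler0n R k) Ma ab b0).
have gb k : mu.-integrable J (EFin \o (fun s => g s * bump a b k%:R s)).
  by apply: integrableM_cont => //; exact: continuous_subspaceT.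
pose f_ (k : nat) s := (g s * bump a b k%:R s)%:E.
pose f s := (g s * \1_(`]a, b[%classic) s)%:E.
have [] := @dominated_convergence _ _ _ mu J mJ f_ f (fun s => `|g s|%:E).
- by move=> k; case/integrableP: (gb k).
- apply/measurable_EFinP; apply: measurable_funM => //.
- apply: aeW => s _; apply: cvg_EFin; first by apply: nearW.
  by apply: cvgMr; exact: bump_cvg.
- exact: integrable_norm.
- apply: aeW => s k _; rewrite /f_ /= lee_fin normrM ler_piMr//.
  by have /andP[b1 b2] := bump_ge0_le1 a b s (ler0n R k); rewrite ger0_norm.
move=> fi _ fcvg.
have f0 : (\int[mu]_(s in J) f s = 0)%E.
  apply: (cvg_unique _ fcvg) => //.
  rewrite (_ : (fun _ => _) = cst 0%E); first exact: cvg_cst.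
  apply/funext => k /=; rewrite -[LHS]fineK; last first.
    by apply: integrable_fin_num => //; exact: gb.
  have := gpsi _ (test_function_bump (hM := hM) (ler0n R k) Ma ab b0).
  by rewrite /Rintegral => ->.
rewrite -Rintegral_itv_bndo_bndc; last first.
  apply: (integrableS _ _ _ gi); [exact: measurable_itv|exact: measurable_itv|].
  move=> s; rewrite /= !in_itv/=.
  by move=> /andP[as_ sb]; apply/andP; split; lra.
rewrite /Rintegral; have -> : (\int[mu]_(s in `]a, b[) (g s)%:E = \int[mu]_(s in J) f s)%E.
  rewrite [RHS](_ : _ = \int[mu]_(s in J) ((fun s => (g s)%:E) \_ `]a, b[) s)%E.
    rewrite -integral_mkcondr; congr (integral _ _ _).
    apply/seteqP; split => s /=; rewrite !in_itv/=; last by case.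
    by move=> /andP[as_ sb]; split; apply/andP; split; lra.
  apply: eq_integral => s _; rewrite /f patchE indicE.
  by case: ifP; rewrite ?mulr1 ?mulr0.
by rewrite f0.
Qed.

End FundamentalLemma.

(** * The W-norm of C^1 segments *)

Section SmoothSegments.
Context {R : realType} {n : nat}.
Variables (hM : R) (hM_gt0 : 0 < hM).
Notation mu := (@lebesgue_measure R).
Notation J := (`[- hM, 0]%classic : set R).
Implicit Types (t u s h : R) (phi g : R -> 'rV[R]_n).

Lemma coord_within_continuous (D : set R) phi i : econt D phi ->
  {within D, continuous (fun s => phi s 0 i)}.
Proof.
move=> phic; apply/rcontP => t Dt e /(phic t Dt)[d d0 K]; exists d => // u Du ut.
by apply: le_lt_trans (K u Du ut); have := coord_le_enorm (phi u - phi t) i; rewrite !mxE.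
Qed.

Lemma coord_is_derive phi s v i : is_derive s 1 phi v ->
  is_derive s 1 (fun s => phi s 0 i) (v 0 i).
Proof.
move=> /derivP phiv; apply/real_is_deriveP => e /phiv[d d0 K]; exists d => // h h0 hd.
apply: le_trans (K h h0 hd).
by have := coord_le_enorm (phi (s + h) - phi s - h *: v) i; rewrite !mxE.
Qed.

(** Both kinds of derivative are recorded: two-sided inside for integration by parts, and to the
    right, left end included, for [mean_value_le]. *)
Definition C1_segment phi g := [/\ C0 J phi, econt J g,
  forall s, - hM < s -> s < 0 -> is_derive s 1 phi (g s) &
  forall s, - hM <= s -> s < 0 -> rderiv phi s (g s)].

(** Integration by parts; the boundary terms vanish because psi is zero at both ends. *)
Lemma C1_weak_derivative phi g : C1_segment phi g -> weak_derivative hM phi g.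
Proof.
move=> [phiC gc phid _] i; have gic := coord_within_continuous (i := i) gc; split.
  exact: (continuous_integrable gic).
move=> psi psiT; have psic := test_function_cont psiT.
have [psid dpsic [a [b [Ma b0 psi0]]]] := psiT.
have M0 : - hM < 0 by rewrite oppr_lt0.
have phiic := coord_within_continuous (i := i) (C0_econt phiC).
have psi_0 : psi 0 = 0 by apply: psi0; rewrite negb_and -!ltNge b0 orbT.
have psi_M : psi (- hM) = 0 by apply: psi0; rewrite negb_and -!ltNge Ma.
rewrite (@Rintegration_by_parts _ (fun s => phi s 0 i) psi (fun s => g s 0 i)
  (derive1 psi) (- hM) 0 M0 gic).
- by rewrite psi_0 psi_M !mulr0 subrr add0r.
- have [_ ? ?] := (continuous_within_itvP _ M0).1 phiic; split => //.
  move=> s; rewrite in_itv/= => /andP[s1 s2].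
  by have [] := coord_is_derive i (phid s s1 s2).
- move=> s; rewrite in_itv/= => /andP[s1 s2]; rewrite derive1E.
  by have [] := coord_is_derive i (phid s s1 s2).
- exact: continuous_subspaceT.
- have [_ ? ?] := (continuous_within_itvP _ M0).1 (continuous_subspaceT psic).
  by split => // s _; exact: psid.
- by [].
Qed.

(** [Wnorm] integrates a weak derivative picked by choice; uniqueness almost everywhere allows it to
    be computed with any other one. *)
Lemma weak_derivative_unique phi g g' : weak_derivative hM phi g ->
  weak_derivative hM phi g' -> forall i,
  ae_eq mu J (fun s => (g s 0 i)%:E) (fun s => (g' s 0 i)%:E).
Proof.
move=> wg wg' i; have [gi gpsi] := wg i; have [gi' gpsi'] := wg' i.
have mJ : measurable J by exact: measurable_itv.
have di : mu.-integrable J (EFin \o (fun s => g s 0 i - g' s 0 i)).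
  rewrite (_ : EFin \o _ = (fun s => (g s 0 i)%:E - (g' s 0 i)%:E)%E).
    by apply: integrableB => //; exact: measurable_itv.
  by apply/funext => s; rewrite /= EFinB.
have d0 psi : test_function hM psi -> \int[mu]_(s in J) ((g s 0 i - g' s 0 i) * psi s) = 0.
  move=> psiT; have psic : {within J, continuous psi}.
    by apply: continuous_subspaceT; exact: test_function_cont psiT.
  under eq_Rintegral do rewrite mulrBl.
  rewrite RintegralB//.
  - by have := gpsi _ psiT; rewrite (gpsi' _ psiT) => /oppr_inj ->; rewrite subrr.
  - exact: integrableM_cont.
  - exact: integrableM_cont.
have := fundamental_lemma hM_gt0 di d0.
have F : Filter (almost_everywhere mu) := ae_filter_ringOfSetsType mu.
apply: (@filterS _ _ F) => s H Js; have := H Js.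
by move=> /= [] /eqP; rewrite subr_eq0 => /eqP ->.
Qed.

Lemma measurable_sqr_enorm g :
  (forall i, measurable_fun J (fun s => g s 0 i)) ->
  measurable_fun J (fun s => enorm (g s) ^+ 2).
Proof.
move=> mg; rewrite (_ : (fun s => _) = (fun s => \sum_(i < n) g s 0 i * g s 0 i)).
  by apply: measurable_sum => i; apply: measurable_funM; exact: mg.
by apply/funext => s; rewrite sqr_enorm; apply: eq_bigr => i _; rewrite expr2.
Qed.

Lemma sqr_enorm_within_continuous g : econt J g ->
  {within J, continuous (fun s => enorm (g s) ^+ 2)}.
Proof.
move=> gc; rewrite (_ : (fun s => _) = (fun s => enorm (g s) * enorm (g s))); last first.
  by apply/funext => s; rewrite expr2.
by apply: within_continuousM; exact: enorm_cont.
Qed.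

Lemma C1_segment_W phi g : C1_segment phi g -> W hM phi.
Proof.
move=> C1; have [phiC gc phid phir] := C1; split => //; last first.
  exists g; first exact: C1_weak_derivative.
  exact: (continuous_integrable (sqr_enorm_within_continuous gc)).
have M0 : - hM <= 0 by rewrite oppr_le0 ltW.
have [c _ cm] := EVT_max M0 (enorm_cont gc).
(* The [+ 1] keeps the Lipschitz constant positive, so that delta = eps / B makes sense. *)
pose B := enorm (g c) + 1.
have B0 : 0 < B by rewrite ltr_wpDl.
have lip a b : - hM <= a -> a <= b -> b <= 0 -> enorm (phi b - phi a) <= B * (b - a).
  move=> Ma ab b0; rewrite mulrBr.
  apply: (@mean_value_le _ _ phi g (fun t => B * t) (fun=> B)) => //.
  - apply: econtW (C0_econt phiC) => s /=; rewrite !in_itv/= => /andP[as_ sb].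
    by rewrite (le_trans Ma)// (le_trans sb).
  - by apply: continuous_subspaceT; exact: mulrl_continuous.
  - by move=> t at_ tb; apply: phir; [exact: le_trans at_|exact: lt_le_trans b0].
  - move=> t at_ tb; apply: (@le_trans _ _ (enorm (g c))); last by rewrite lerDl.
    by apply: cm; rewrite in_itv/= (le_trans Ma)//= ltW// (lt_le_trans tb).
  - by move=> t h _ _ _; rewrite -mulrBr [t + h]addrC addrK.
move=> eps eps0; exists (eps / B); first by rewrite divr_gt0.
move=> N a b ab _ sab; apply: (@le_lt_trans _ _ (\sum_(i < N) B * (b i - a i))).
  by apply: ler_sum => i _; have [? ? ?] := ab i; exact: lip.
by rewrite -mulr_sumr mulrC -ltr_pdivlMr.
Qed.

Lemma C1_segment_Wnorm phi g (B0 B1 : R) : C1_segment phi g ->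
  enorm (phi 0) <= B0 -> (forall s, - hM <= s <= 0 -> enorm (g s) <= B1) ->
  Wnorm hM phi <= Num.sqrt (B0 ^+ 2 + hM * B1 ^+ 2).
Proof.
move=> C1 phiB gB; have [phiC gc phid phir] := C1.
have B0_ge0 : 0 <= B0 := le_trans (enorm_ge0 _) phiB.
have B1_ge0 : 0 <= B1.
  by apply: le_trans (enorm_ge0 (g 0)) (gB 0 _); rewrite lexx oppr_le0 ltW.
have wg := C1_weak_derivative C1.
have ww : weak_derivative hM phi (wderiv hM phi).
  by apply: getPex; exists g.
have mJ : measurable J by exact: measurable_itv.
have meas k : weak_derivative hM phi k -> measurable_fun J (fun s => (enorm (k s) ^+ 2)%:E).
  move=> wk; apply/measurable_EFinP; apply: measurable_sqr_enorm => i.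
  by have [/integrableP[/measurable_EFinP]] := wk i.
rewrite ler_sqrt ?addr_ge0 ?mulr_ge0 ?sqr_ge0 ?(ltW hM_gt0)//.
apply: lerD; first by rewrite ler_pXn2r ?nnegrE.
rewrite /Rintegral (_ : (\int[mu]_(s in J) (enorm (wderiv hM phi s) ^+ 2)%:E =
  \int[mu]_(s in J) (enorm (g s) ^+ 2)%:E)%E); last first.
  apply: ae_eq_integral => //; [exact: meas|exact: meas|].
  have := @filter_forall _ _ _ (almost_everywhere mu) (ae_filter_ringOfSetsType mu)
    (weak_derivative_unique ww wg).
  have F : Filter (almost_everywhere mu) := ae_filter_ringOfSetsType mu.
  apply: (@filterS _ _ F) => s H Js; congr EFin; rewrite !sqr_enorm.
  by apply: eq_bigr => i _; have [->] := H i Js.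
rewrite -[leLHS]/(\int[mu]_(s in J) (enorm (g s) ^+ 2)).
apply: (@le_trans _ _ (\int[mu]_(s in J) (B1 ^+ 2))).
  apply: le_Rintegral => //.
  - exact: (continuous_integrable (sqr_enorm_within_continuous gc)).
  - by apply: continuous_integrable; exact: continuous_subspaceT (@cst_continuous _ _ _).
  - by move=> s /=; rewrite in_itv/= => /gB gs; rewrite ler_pXn2r ?nnegrE.
have muJ : mu J = hM%:E.
  by rewrite lebesgue_measure_itv/= lte_fin oppr_lt0 hM_gt0/= add0e opprK.
rewrite Rintegral_cst// [X in fine X](_ : _ = hM%:E); last exact: muJ.
by rewrite /= mulrC.
Qed.

Lemma C1_segmentB phi g phi' g' : C1_segment phi g -> C1_segment phi' g' ->
  C1_segment (phi \- phi') (g \- g').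
Proof.
move=> [phiC gc phid phir] [phiC' gc' phid' phir']; split.
- rewrite -(C0_seg phiC) -(C0_seg phiC').
  rewrite (_ : _ \- _ = seg hM (phi \- phi') 0).
    apply: seg_C0 => //; rewrite sub0r; apply: econtB; exact: C0_econt.
  apply/funext => s /=; have [sM|sM] := boolP (- hM <= s <= 0).
    by rewrite !segE.
  by rewrite !seg_out// subrr.
- exact: econtB.
- by move=> s Ms s0; apply: is_deriveB; [exact: phid|exact: phid'].
- by move=> s Ms s0; apply: rderivB; [exact: phir|exact: phir'].
Qed.

End SmoothSegments.

(** * Class KL majorants *)

Section ClassKLMajorant.
Context {R : realType}.
Implicit Types (s t v e d B : R).

Definition clip01 (w : R) : R := Num.max 0 (Num.min 1 w).

Lemma clip01_itv w : 0 <= clip01 w <= 1.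
Proof. by rewrite /clip01 le_max lexx/= ge_max ler01/= ge_min lexx. Qed.

Lemma clip01_mono w w' : w <= w' -> clip01 w <= clip01 w'.
Proof.
move=> ww; rewrite /clip01; case: (leP 1 w) => h1; case: (leP 1 w') => h2;
  rewrite ?(max_r ler01)//; last (case: (leP 0 w) => h3; case: (leP 0 w') => h4);
  try (case: (leP 0 w) => h3); lra.
Qed.

Lemma clip01_lip w w' : `|clip01 w - clip01 w'| <= `|w - w'|.
Proof.
set k := `|w - w'|; have k1 : w - w' <= k by exact: ler_norm.
have k2 : w' - w <= k by rewrite /k distrC ler_norm.
have k0 : 0 <= k by rewrite /k normr_ge0.
rewrite ler_norml /clip01; case: (leP 1 w) => h1; case: (leP 1 w') => h2;
  rewrite ?(max_r ler01); try (case: (leP 0 w) => h3); try (case: (leP 0 w') => h4); lra.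
Qed.

Lemma clip01_le0 w : w <= 0 -> clip01 w = 0.
Proof. by move=> w0; rewrite /clip01 max_l// ge_min w0 orbT. Qed.

Lemma clip01_ge1 w : 1 <= w -> clip01 w = 1.
Proof. by move=> w1; rewrite /clip01 min_l// max_r. Qed.

(** Read P s t v as: some trajectory with initial norm s has norm v at time t. The three hypotheses
    are then uniform boundedness, stability at small sizes and uniform attractivity. *)
Variable P : R -> R -> R -> Prop.
Hypothesis P_bounded : forall s, 0 < s -> exists B, forall s' t v,
  0 <= s' <= s -> 0 <= t -> P s' t v -> v <= B.
Hypothesis P_small : forall e, 0 < e -> exists2 d, 0 < d & forall s t v,
  0 <= s <= d -> 0 <= t -> P s t v -> v <= e.
Hypothesis P_decay : forall s e, 0 < s -> 0 < e -> exists T, forall s' t v,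
  0 <= s' <= s -> 0 <= t -> T <= t -> P s' t v -> v <= e.

(* 1 at (s', t') = (s, t), 0 for s' >= 2 s or t' <= t - 1, and locally Lipschitz
   in (s, t): the supremum of the weighted values is therefore continuous. *)
Definition weight s t s' t' : R := clip01 (2 - s' / s) * clip01 (1 + t' - t).

(** The element 0 makes the set nonempty and its supremum nonnegative. *)
Definition envelope_set s t : set R := [set w | w = 0 \/ exists s' t' v,
  [/\ 0 <= s', 0 <= t', 0 <= v, P s' t' v & w = v * weight s t s' t']].

(** The weight divides by s; at s = 0 the value 0 is the one that continuity imposes, by
    [P_small]. *)
Definition envelope s t : R := if 0 < s then sup (envelope_set s t) else 0.

Let weight_itv s t s' t' : 0 <= weight s t s' t' <= 1.
Proof.
have /andP[a0 a1] := clip01_itv (2 - s' / s).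
have /andP[b0 b1] := clip01_itv (1 + t' - t).
by rewrite /weight mulr_ge0//= mulr_ile1.
Qed.

Let weight_far s t s' t' : 0 < s -> 2 * s <= s' -> weight s t s' t' = 0.
Proof.
by move=> s0 ss; rewrite /weight clip01_le0 ?mul0r// subr_le0 ler_pdivlMr.
Qed.

Let weight_past s t s' t' : t' <= t - 1 -> weight s t s' t' = 0.
Proof. by move=> tt; rewrite /weight (clip01_le0 (w := 1 + t' - t)) ?mulr0//; lra. Qed.

Lemma envelope_le s t B : 0 <= B -> 0 < s ->
  (forall s' t' v, 0 <= s' <= 2 * s -> 0 <= t' -> t - 1 <= t' -> P s' t' v -> v <= B) ->
  envelope s t <= B.
Proof.
move=> B0 s0 PB; rewrite /envelope s0; apply: ge_sup; first by exists 0; left.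
move=> _ [->//|[s' [t' [v [s'0 t'0 v0 Pv ->]]]]].
have [ss|ss] := leP (2 * s) s'; first by rewrite weight_far// mulr0.
have [tt|tt] := leP t' (t - 1); first by rewrite weight_past// mulr0.
have vB : v <= B by apply: (PB s' t') => //; [rewrite s'0 ltW|exact: ltW].
have /andP[w0 w1] := weight_itv s t s' t'; apply: le_trans vB; exact: ler_piMr.
Qed.

Lemma envelope_has_sup s t : 0 < s -> has_sup (envelope_set s t).
Proof.
move=> s0; split; first by exists 0; left.
have [B PB] := @P_bounded (2 * s) (mulr_gt0 (ltr0n R 2) s0).
exists (Num.max 0 B) => _ [->|[s' [t' [v [s'0 t'0 v0 Pv ->]]]]]; first by rewrite le_max lexx.
have [ss|ss] := leP (2 * s) s'; first by rewrite weight_far// mulr0 le_max lexx.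
have vB : v <= B by apply: (PB s' t') => //; rewrite s'0 ltW.
have /andP[w0 w1] := weight_itv s t s' t'; rewrite le_max; apply/orP; right.
apply: le_trans vB; exact: ler_piMr.
Qed.

Lemma envelope_ge0 s t : 0 <= envelope s t.
Proof.
rewrite /envelope; case: ifP => // s0; apply: ub_le_sup; last by left.
by have [] := envelope_has_sup t s0.
Qed.

Lemma envelope_ge s t s' t' v : 0 < s -> 0 <= s' -> 0 <= t' -> 0 <= v ->
  P s' t' v -> v * weight s t s' t' <= envelope s t.
Proof.
move=> s0 s'0 t'0 v0 Pv; rewrite /envelope s0; apply: ub_le_sup.
  by have [] := envelope_has_sup t s0.
by right; exists s', t', v.
Qed.

Lemma le_envelope s t v : 0 < s -> 0 <= t -> P s t v -> v <= envelope s t.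
Proof.
move=> s0 t0 Pv; have [v0|/ltW v0] := leP 0 v; last exact: le_trans (envelope_ge0 _ _).
have := envelope_ge t s0 (ltW s0) t0 v0 Pv.
by rewrite /weight divff ?gt_eqF// !clip01_ge1 ?mulr1//; lra.
Qed.

Lemma envelope_compare s t s1 t1 e : 0 < s -> 0 <= e ->
  (forall s' t' v, 0 <= s' -> 0 <= t' -> 0 <= v -> P s' t' v ->
    v * weight s t s' t' <= envelope s1 t1 + e) ->
  envelope s t <= envelope s1 t1 + e.
Proof.
move=> s0 e0 K; rewrite [X in X <= _]/envelope s0; apply: ge_sup; first by exists 0; left.
move=> _ [->|[s' [t' [v [s'0 t'0 v0 Pv ->]]]]]; last exact: K.
by rewrite addr_ge0// envelope_ge0.
Qed.

Lemma envelope_mono s s1 t : s <= s1 -> envelope s t <= envelope s1 t.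
Proof.
move=> ss; have [s0|s0] := ltP 0 s; last first.
  by rewrite {1}/envelope ltNge s0/= envelope_ge0.
have s10 := lt_le_trans s0 ss.
rewrite -[leRHS]addr0; apply: envelope_compare => // s' t' v s'0 t'0 v0 Pv.
rewrite addr0; apply: le_trans (envelope_ge t s10 s'0 t'0 v0 Pv).
rewrite ler_wpM2l// ler_wpM2r//; first by have /andP[] := clip01_itv (1 + t' - t).
by apply: clip01_mono; rewrite lerD2l lerN2 ler_wpM2l// lef_pV2.
Qed.

Lemma envelope_anti s t t1 : t <= t1 -> envelope s t1 <= envelope s t.
Proof.
move=> tt; have [s0|s0] := ltP 0 s; last by rewrite /envelope ltNge s0.
rewrite -[leRHS]addr0; apply: envelope_compare => // s' t' v s'0 t'0 v0 Pv.
rewrite addr0; apply: le_trans (envelope_ge t s0 s'0 t'0 v0 Pv).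
rewrite ler_wpM2l// ler_wpM2l//; first by have /andP[] := clip01_itv (2 - s' / s).
by apply: clip01_mono; lra.
Qed.

(** For s, s1 in [a, b] only s' <= 2b has nonzero weight. There v <= C, the quotient s'/s has slope
    at most 2b/a^2 in s, and the time factor has slope 1; q is the sum of the two slopes. *)
Lemma envelope_lip (a b : R) : 0 < a -> exists2 K, 0 < K & forall s t s1 t1,
  a <= s <= b -> a <= s1 <= b ->
  envelope s t <= envelope s1 t1 + K * (`|s - s1| + `|t - t1|).
Proof.
move=> a0; have [ba|ab] := ltP b a.
  by exists 1 => // s t s1 t1 /andP[as_ sb]; have := le_trans as_ sb; rewrite leNgt ba.
have b0 := lt_le_trans a0 ab.
have [B PB] := @P_bounded (2 * b) (mulr_gt0 (ltr0n R 2) b0).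
pose C := Num.max B 1; have C1 : 1 <= C by rewrite le_max lexx orbT.
have C0 := lt_le_trans ltr01 C1.
pose q := 2 * b / (a * a) + 1.
have q1 : 0 < 2 * b / (a * a) by rewrite divr_gt0// mulr_gt0.
exists (C * q); first by rewrite mulr_gt0// ltr_wpDl// ltW.
move=> s t s1 t1 /andP[as_ sb] /andP[as1 s1b].
have s0 := lt_le_trans a0 as_; have s10 := lt_le_trans a0 as1.
have q0 : 0 < q by rewrite /q ltr_wpDl// ltW.
have D0 : 0 <= `|s - s1| + `|t - t1| by rewrite addr_ge0.
apply: envelope_compare => //; first by rewrite !mulr_ge0// ltW.
move=> s' t' v s'0 t'0 v0 Pv.
have := envelope_ge t1 s10 s'0 t'0 v0 Pv.
suff : v * weight s t s' t' <= v * weight s1 t1 s' t' + C * q * (`|s - s1| + `|t - t1|) by lra.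
have [bs|sb'] := ltP (2 * b) s'.
  rewrite !weight_far// ?mulr0 ?add0r ?mulr_ge0// ?ltW//; lra.
have vC : v <= C by rewrite le_max (PB s' t')// s'0.
suff K : weight s t s' t' - weight s1 t1 s' t' <= q * (`|s - s1| + `|t - t1|).
  have := ler_wpM2l v0 K; rewrite mulrBr => K'.
  have : v * (q * (`|s - s1| + `|t - t1|)) <= C * (q * (`|s - s1| + `|t - t1|)).
    by rewrite ler_wpM2r// mulr_ge0// ltW.
  rewrite -mulrA; lra.
have k1 : clip01 (2 - s' / s) - clip01 (2 - s' / s1) <= 2 * b / (a * a) * `|s - s1|.
  apply: le_trans (ler_norm _) _; apply: le_trans (clip01_lip _ _) _.
  have -> : 2 - s' / s - (2 - s' / s1) = s' / (s * s1) * (s - s1).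
    by field; rewrite !gt_eqF.
  rewrite normrM ler_wpM2r// ger0_norm; last by rewrite divr_ge0// mulr_ge0// ltW.
  rewrite ler_pM//; first by rewrite invr_ge0 mulr_ge0// ltW.
  by rewrite lef_pV2 ?posrE ?mulr_gt0// ler_pM// ltW.
have k2 : clip01 (1 + t' - t) - clip01 (1 + t' - t1) <= `|t - t1|.
  apply: le_trans (ler_norm _) _; apply: le_trans (clip01_lip _ _) _.
  by rewrite distrC le_eqVlt; apply/orP; left; apply/eqP; congr (`|_|); ring.
have /andP[x0 x1] := clip01_itv (2 - s' / s).
have /andP[y0 y1] := clip01_itv (1 + t' - t1).
have st0 := normr_ge0 (s - s1); have tt0 := normr_ge0 (t - t1).
have : clip01 (2 - s' / s) * (clip01 (1 + t' - t) - clip01 (1 + t' - t1)) <= `|t - t1|.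
  apply: le_trans (ler_wpM2l x0 k2) _; exact: ler_piMl.
have : (clip01 (2 - s' / s) - clip01 (2 - s' / s1)) * clip01 (1 + t' - t1) <=
    2 * b / (a * a) * `|s - s1|.
  apply: le_trans (ler_wpM2r y0 k1) _; apply: ler_piMr => //.
  by rewrite mulr_ge0// ltW.
have : 0 <= 2 * b / (a * a) * `|t - t1| by rewrite mulr_ge0// ltW.
rewrite /weight /q mulrDl mul1r mulrDr; lra.
Qed.

(** The envelope is monotone in each variable, but perhaps not strictly; the added term makes it
    strict without affecting continuity or the limits. *)
Definition KL_envelope s t : R := envelope s t + s * expR (- t).

(** At s = 0 continuity comes from [P_small]; for s > 0 from the Lipschitz estimate on [s/2, 2s]. *)
Lemma envelope_cont s t e : 0 <= s -> 0 < e ->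
  exists2 d, 0 < d & forall s1 t1, 0 <= s1 -> `|s1 - s| < d -> `|t1 - t| < d ->
    0 <= t1 -> `|envelope s1 t1 - envelope s t| < e.
Proof.
rewrite le_eqVlt => /predU1P[<-|s0] e0.
  have e2 : 0 < e / 2 by rewrite divr_gt0.
  have [d d0 K] := P_small e2; exists (d / 2); first by rewrite divr_gt0.
  move=> s1 t1 s10; rewrite subr0 ger0_norm// => s1d _ t10.
  rewrite {2}/envelope ltxx subr0 ger0_norm ?envelope_ge0//.
  apply: (@le_lt_trans _ _ (e / 2)); last lra.
  have [s1p|s1n] := ltP 0 s1; last by rewrite /envelope ltNge s1n/= ltW.
  apply: envelope_le => //; first exact: ltW.
  by move=> s' t' v /andP[s'0 s's] t'0 _; apply: K => //; rewrite s'0/=; lra.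
have s2 : 0 < s / 2 by rewrite divr_gt0.
have [K K0 KP] := envelope_lip (2 * s) s2.
exists (Num.min (s / 2) (e / (2 * K + 1) )).
  by rewrite lt_min s2 divr_gt0// addr_gt0// mulr_gt0.
move=> s1 t1 s10; rewrite !lt_min => /andP[ss1 se] /andP[_ te] t10.
have ss : s / 2 <= s <= 2 * s by apply/andP; split; lra.
have ss1' : s / 2 <= s1 <= 2 * s.
  by move: ss1; rewrite ltr_norml => /andP[? ?]; apply/andP; split; lra.
have K1 : 0 < 2 * K + 1 by rewrite addr_gt0// mulr_gt0.
rewrite ltr_pdivlMr// in se; rewrite ltr_pdivlMr// in te.
have small : K * (`|s1 - s| + `|t1 - t|) < e.
  have h1 := normr_ge0 (s1 - s); have h2 := normr_ge0 (t1 - t); nra.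
have := KP s t s1 t1 ss ss1'; have := KP s1 t1 s t ss1' ss.
rewrite (distrC s s1) (distrC t t1) => h1 h2.
by rewrite ltr_norml; apply/andP; split; lra.
Qed.

Lemma KL_envelope_cont s t e : 0 <= s -> 0 <= t -> 0 < e ->
  exists2 d, 0 < d & forall s1 t1, 0 <= s1 -> 0 <= t1 -> `|s1 - s| < d ->
    `|t1 - t| < d -> `|KL_envelope s1 t1 - KL_envelope s t| < e.
Proof.
move=> s0 t0 e0; have e2 : 0 < e / 2 by rewrite divr_gt0.
have [d d0 K] := envelope_cont t s0 e2.
have pc : {for (s, t), continuous (fun p : R * R => p.1 * expR (- p.2))}.
  apply: (@cvgM _ _ _ _ (fun p : R * R => p.1) (fun p : R * R => expR (- p.2))).
    exact: cvg_fst.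
  apply: (@continuous_comp _ _ _ (fun p : R * R => - p.2) expR); last exact: continuous_expR.
  by apply: cvgN; exact: cvg_snd.
have /cvgrPdist_lt/(_ _ e2) := pc; move=> /nbhs_ballP[d' /= d'0 K'].
exists (Num.min d d'); first by rewrite lt_min d0.
move=> s1 t1 s10 t10; rewrite !lt_min => /andP[sd sd'] /andP[td td'].
have := K s1 t1 s10 sd td t10.
have := K' (s1, t1); rewrite /= => /(_ _)/wrap[].
  by split; rewrite /ball/= distrC.
rewrite !ltr_norml /KL_envelope => /andP[h1 h2] /andP[h3 h4].
by apply/andP; split; lra.
Qed.

Lemma KL_envelope_strict s s1 t : 0 <= s -> s < s1 -> KL_envelope s t < KL_envelope s1 t.
Proof.
move=> s0 ss; apply: ler_ltD; first exact/envelope_mono/ltW.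
by rewrite ltr_pM2r ?expR_gt0.
Qed.

Lemma classKL_envelope : classKL KL_envelope.
Proof.
split.
- apply/subspace_continuousP => -[s t] /= [s0 t0].
  apply/cvgrPdist_lt => e e0; have [d d0 K] := KL_envelope_cont s0 t0 e0.
  rewrite near_withinE; apply/nbhs_ballP; exists d => // -[s1 t1] /= [] /=.
  rewrite /ball/= => sd td [s10 t10]; rewrite distrC; apply: K => //; by rewrite distrC.
- move=> t t0; split.
  + apply/subspace_continuousP => s /=; rewrite in_itv/= andbT => s0.
    apply/cvgrPdist_lt => e e0; have [d d0 K] := KL_envelope_cont s0 t0 e0.
    rewrite near_withinE; apply/nbhs_ballP; exists d => // s1 /=.
    rewrite /ball/= in_itv/= andbT => sd s10; rewrite distrC; apply: K => //.
      by rewrite distrC.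
    by rewrite subrr normr0.
  + by move=> s s1 s0 ss; exact: KL_envelope_strict.
  + by rewrite /KL_envelope /envelope ltxx mul0r addr0.
- move=> s t t1 s0 t0 tt; apply: ler_ltD; first exact/envelope_anti/ltW.
  by rewrite ltr_pM2l// ltr_expR ltrN2.
- move=> s s0; apply/cvgrPdist_lt => e e0; have e2 : 0 < e / 2 by rewrite divr_gt0.
  have [T PT] := @P_decay (2 * s) _ (mulr_gt0 (ltr0n R 2) s0) e2.
  (* The weight looks back one unit of time, hence T + 1, and up to size 2s, hence the use of 2s in
     [P_decay]. The bound 2s/e makes s exp(-t) < e/2, because exp t >= 1 + t. *)
  exists (Num.max (T + 1) (2 * s / e)); split; first exact: num_real.
  move=> t; rewrite gt_max => /andP[tT te].
  rewrite sub0r normrN ger0_norm; last first.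
    by rewrite addr_ge0 ?envelope_ge0// mulr_ge0 ?expR_ge0// ltW.
  have env : envelope s t <= e / 2.
    apply: envelope_le => //; first exact: ltW.
    by move=> s' t' v s's t'0 tt; apply: PT => //; lra.
  have t0 : 0 < t by apply: lt_trans te; rewrite divr_gt0// mulr_gt0.
  rewrite ltr_pdivrMr// in te.
  have : s * expR (- t) < e / 2.
    rewrite expRN ltr_pdivrMr ?expR_gt0//.
    have := expR_ge1Dx t; nra.
  by rewrite /KL_envelope; lra.
Qed.

Lemma KL_majorant : exists2 beta, classKL beta &
  forall s t v, 0 <= s -> 0 <= t -> P s t v -> v <= beta s t.
Proof.
exists KL_envelope; first exact: classKL_envelope.
move=> s t v; rewrite le_eqVlt => /predU1P[<-|s0] t0 Pv.
  rewrite /KL_envelope /envelope ltxx mul0r addr0; apply/ler_addgt0Pr => e e0.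
  rewrite add0r; have [d d0 K] := P_small e0; apply: (K 0 t) => //.
  by rewrite lexx ltW.
apply: (le_trans (le_envelope s0 t0 Pv)); rewrite /KL_envelope lerDl.
by rewrite mulr_ge0 ?expR_ge0// ltW.
Qed.

End ClassKLMajorant.

(** The KL construction with all values placed at time 0: decay is vacuous from T = 1 on, and the
    slice of beta at t = 0 is of class K. *)
Lemma K_majorant (R : realType) (Q : R -> R -> Prop) :
  (forall s, 0 < s -> exists B, forall s' v, 0 <= s' <= s -> Q s' v -> v <= B) ->
  (forall e : R, 0 < e -> exists2 d : R, 0 < d & forall s v, 0 <= s <= d -> Q s v -> v <= e) ->
  exists2 alpha, classK alpha & forall s v, 0 <= s -> Q s v -> v <= alpha s.
Proof.
move=> Qb Qs.
have [||s e s0 e0|beta [_ betaK _ _] betaQ] := @KL_majorant R (fun s t v => t = 0 /\ Q s v).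
- by move=> s /Qb[B QB]; exists B => s' t v ss _ [_]; exact: QB.
- by move=> e /Qs[d d0 QB]; exists d => // s t v ss _ [_]; exact: QB.
- by exists 1 => s' t v _ _ t1 [t0 _]; move: t1; rewrite t0 ler10.
exists (beta^~ 0); first exact: betaK.
by move=> s v s0 Qv; apply: betaQ.
Qed.

(** * Lyapunov-Krasovskii estimates *)

Section ScalarLemmas.
Context {R : realType}.
Implicit Types (t u s h e d : R).

(** Here t is the supremum of the times up to which g stays below or at e. The level e may be
    touched earlier; what matters is the bound on all of [a, t] together with g t = e. *)
Lemma first_exit (g : R -> R) (a b e : R) : a <= b -> {within `[a, b], continuous g} ->
  g a < e -> e < g b ->
  exists t, [/\ a < t, t <= b, g t = e & forall u, a <= u <= t -> g u <= e].
Proof.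
move=> ab /rcontP gc ga gb.
have {}gc t : a <= t <= b -> forall e, 0 < e -> exists2 d, 0 < d & forall u,
    a <= u <= b -> `|u - t| < d -> `|g u - g t| < e.
  move=> tab e' e'0; have [|d d0 K] := gc t _ e' e'0; first by rewrite /= in_itv.
  by exists d => // u uab; apply: K; rewrite /= in_itv.
pose S := [set s | a <= s <= b /\ forall u, a <= u <= s -> g u <= e].
have Sa : S a by split; [rewrite lexx|move=> u /le_anti <-; exact: ltW].
have hS : has_sup S by split; [exists a | exists b => t [/andP[]]].
set t := sup S.
have at_ : a <= t by apply: ub_le_sup => //; case: hS.
have tb : t <= b by apply: ge_sup; [exists a | move=> s [/andP[]]].
have tab : a <= t <= b by rewrite at_.
have below u : a <= u -> u < t -> g u <= e.
  move=> au ut; have tu : 0 < t - u by rewrite subr_gt0.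
  have [s [_ Ss]] := sup_adherent tu hS; rewrite subKr => us.
  by apply: Ss; rewrite au ltW.
have gt_le : g t <= e.
  rewrite leNgt; apply/negP => egt; have D : 0 < g t - e by rewrite subr_gt0.
  have [d d0 K] := gc t tab _ D.
  have [ta|ta] := eqVneq t a; first by move: egt; rewrite ta ltNge (ltW ga).
  have {}ta : a < t by rewrite lt_neqAle eq_sym ta.
  pose u := Num.max a (t - d / 2).
  have ut : u < t by rewrite gt_max ta/=; lra.
  have au : a <= u by rewrite le_max lexx.
  have du : t - d / 2 <= u by rewrite le_max lexx orbT.
  have := K u; rewrite au/= (le_trans (ltW ut) tb) => /(_ isT)/(_ _)/wrap[].
    by rewrite ltr_norml; apply/andP; split; lra.
  have := below u au ut; rewrite ltr_norml => h /andP[h1 h2]; lra.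
have gte : g t = e.
  apply/eqP; rewrite eq_le gt_le leNgt; apply/negP => gte.
  have D : 0 < e - g t by rewrite subr_gt0.
  have [d d0 K] := gc t tab _ D.
  have tb' : t < b.
    by rewrite lt_neqAle tb andbT; apply/eqP => E; move: gt_le; rewrite E leNgt gb.
  pose w := Num.min b (t + d / 2).
  have tw : t < w by rewrite lt_min tb'/=; lra.
  have wb : w <= b by rewrite ge_min lexx.
  have wd : w <= t + d / 2 by rewrite ge_min lexx orbT.
  have : S w.
    split; first by rewrite wb (le_trans at_ (ltW tw)).
    move=> u /andP[au uw]; have [ut|tu] := ltP u t; first exact: below.
    have := K u; rewrite au (le_trans uw wb) => /(_ isT)/(_ _)/wrap[].
      by rewrite ltr_norml; apply/andP; split; lra.
    by rewrite ltr_norml => /andP[h1 h2]; lra.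
  by move=> /(ub_le_sup (proj2 hS)); rewrite -/t; lra.
exists t; split => //.
  rewrite lt_neqAle at_ andbT; apply/eqP => E; move: ga; rewrite E gte ltxx//.
move=> u /andP[au]; rewrite le_eqVlt => /predU1P[->|ut]; first exact: gt_le.
exact: below.
Qed.

Lemma dini_le_growth (v : R -> R) t (c : R) : (dini v t <= c%:E)%E ->
  forall e, 0 < e -> exists2 d, 0 < d & forall h, 0 < h -> h < d ->
    v (t + h) - v t <= (c + e) * h.
Proof.
move=> vc e e0.
have : (dini v t < (c + e)%:E)%E by apply: le_lt_trans vc _; rewrite lte_fin ltrDl.
rewrite /dini /limf_esup => /ereal_inf_lt[_ [U U0 <-] Uc].
have : \forall h \near (0 : R)^'+, U h by exact: U0.
rewrite near_withinE => /nbhs_ballP[d/= d0 K].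
exists d => // h h0 hd.
have Uh : U h by apply: K => //; rewrite /ball/= sub0r normrN gtr0_norm.
have : (((v (t + h) - v t) / h)%:E <= (c + e)%:E)%E.
  apply: le_trans (ltW Uc); apply: ereal_sup_ubound; by exists h.
by rewrite lee_fin ler_pdivrMr.
Qed.

Lemma classK_le (w : R -> R) s s' : classK w -> 0 <= s -> s <= s' -> w s <= w s'.
Proof.
move=> [_ wi _] s0; rewrite le_eqVlt => /predU1P[->//|ss]; exact/ltW/wi.
Qed.

Lemma classK_ge0 (w : R -> R) s : classK w -> 0 <= s -> 0 <= w s.
Proof. by move=> wK s0; have [_ _ <-] := wK; apply: classK_le. Qed.

Lemma classK_gt0 (w : R -> R) s : classK w -> 0 < s -> 0 < w s.
Proof. by move=> [_ wi w0] s0; rewrite -w0; exact: wi. Qed.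

Lemma classK_small (w : R -> R) e : classK w -> 0 < e ->
  exists2 d, 0 < d & forall s, 0 <= s -> s <= d -> w s < e.
Proof.
move=> [/rcontP wc _ w0] e0; have [|d d0 K] := wc 0 _ e e0.
  by rewrite /= in_itv/= lexx.
exists (d / 2); first by rewrite divr_gt0.
move=> s s0 sd; have := K s; rewrite /= in_itv/= s0 subr0 ger0_norm// w0 subr0.
move=> /(_ isT)/(_ _)/wrap[]; first lra.
by apply: le_lt_trans; exact: ler_norm.
Qed.

End ScalarLemmas.

Section LyapunovKrasovskii.
Context {R : realType} {r n : nat}.
Variables (hM : R) (hM_gt0 : 0 < hM).
Variables (A : set 'rV[R]_r) (f : 'rV[R]_r -> (R -> 'rV[R]_n) -> 'rV[R]_n).
Hypothesis f_cont : continuous_on_prod A (C0 `[- hM, 0]) (supnorm hM) (@enorm R n) f.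
Hypothesis f0 : forall xi, A xi -> f xi (fun=> 0) = 0.
Variables (HH : set (R -> 'rV[R]_r)).
Hypothesis HH_cont : HH `<=` C0 `[0, +oo[.
Hypothesis HH_inv : forward_invariant HH.
Hypothesis HH_A : forall zeta, HH zeta -> forall t : R, 0 <= t -> A (zeta t).
Variables (H L : R) (H_gt0 : 0 < H) (L_gt0 : 0 < L).
Hypothesis f_lip : forall xi phi psi, A xi ->
  C0 `[- hM, 0] phi -> supnorm hM phi <= H ->
  C0 `[- hM, 0] psi -> supnorm hM psi <= H ->
  enorm (f xi phi - f xi psi) <= L * supnorm hM (phi \- psi).
Variables (V : 'rV[R]_r -> (R -> 'rV[R]_n) -> R) (w1 w2 w : R -> R).
Hypothesis V_cont : continuous_on_prod A (W hM) (Wnorm hM) (fun y : R => `|y|) V.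
Hypothesis (w1_K : classK w1) (w2_K : classK w2).
Hypothesis V_bounds : forall xi phi, A xi -> QH hM H phi ->
  w1 (enorm (phi 0)) <= V xi phi <= w2 (Wnorm hM phi).
(** The rate [w] is zero for stability and [w3] for attractivity, so only its sign is fixed here. *)
Hypothesis w_ge0 : forall s, 0 <= s -> 0 <= w s.
Hypothesis V_decay : dini_decay hM f HH V (QH hM H) w.
Implicit Types (x y : R -> 'rV[R]_n) (zeta : R -> 'rV[R]_r) (t u s a b e d B : R).

(* |x_t|_W <= Wgain * sup |x| for t >= hM, and |x| <= initial_gain * |x_0|_oo on
   [- hM, hM], as long as |x| <= H. *)
Definition Wgain : R := 2 + (1 + hM) * L.
Definition initial_gain : R := 3 * expR (2 * L * hM).

Let Wgain_ge2 : 2 <= Wgain.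
Proof. by rewrite lerDl mulr_ge0 ?addr_ge0// ltW. Qed.

Lemma initial_gain_ge3 : 3 <= initial_gain.
Proof.
rewrite /initial_gain -{1}(mulr1 3) ler_wpM2l// -expR0 ler_expR !mulr_ge0// ltW//.
Qed.

Lemma HH_econt zeta : HH zeta -> econt `[0, +oo[ zeta.
Proof. by move=> /HH_cont/C0_econt. Qed.

Section Along.
Variables (zeta : R -> 'rV[R]_r) (zetaH : HH zeta).
Variables (x0 : R -> 'rV[R]_n) (tf : \bar R) (x : R -> 'rV[R]_n).
Hypothesis traj : trajectory hM f zeta x0 tf x.

Let sol : esolution hM f zeta x0 tf x.
Proof. by apply/solutionP; case: traj. Qed.

Let velocity t := f (zeta t) (seg hM x t).

Lemma velocity_cont T : (T%:E < tf)%E -> econt `[0, T] velocity.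
Proof.
move=> Ttf; apply: (vector_field_cont hM_gt0 f_cont).
- exact: HH_econt.
- exact: HH_A.
- exact: esolution_econt sol Ttf.
Qed.

Lemma trajectory_econt T : (T%:E < tf)%E -> econt `[- hM, T] x.
Proof. exact: (esolution_econt sol). Qed.

(** From time hM on, the window [t - hM, t] lies in the nonnegative times, where the equation holds;
    the initial condition has left the state. *)
Lemma trajectory_C1_segment t : hM <= t -> (t%:E < tf)%E ->
  C1_segment hM (seg hM x t) (seg hM velocity t).
Proof.
move=> tM ttf; have hM0 := hM_gt0; have xc := trajectory_econt ttf.
have [_ _ _ xd _] := sol; split.
- by apply: seg_C0 => //; apply: econtW xc => u /=; rewrite !in_itv/=; lra.
- apply: seg_econt => //; apply: econtW (velocity_cont ttf) => u /=.
  by rewrite !in_itv/=; lra.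
- move=> s Ms s0; have sM : - hM <= s <= 0 by rewrite !ltW.
  have sttf : ((s + t)%:E < tf)%E by apply: lt_trans ttf; rewrite lte_fin; lra.
  have D : 0 < Num.min (s + hM) (- s) by rewrite lt_min; lra.
  rewrite segE// (addrC t s).
  apply: (@is_derive_local _ _ (fun u => x (u + t)) _ s _ _ D).
    move=> u; rewrite lt_min !ltr_norml => /andP[/andP[u1 _] /andP[_ u2]].
    by rewrite segE 1?addrC//; lra.
  by apply/is_derive_shift_arg; apply: xd => //; lra.
- move=> s Ms s0; have sM : - hM <= s <= 0 by rewrite Ms ltW.
  have sttf : ((s + t)%:E < tf)%E by apply: lt_trans ttf; rewrite lte_fin; lra.
  have D : 0 < - s by lra.
  rewrite segE// (addrC t s).
  apply: (@rderiv_local _ _ (fun u => x (u + t)) _ s _ _ D).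
    by move=> u u1 u2; rewrite segE 1?addrC//; lra.
  by apply/rderiv_shift_arg; apply: (esolution_rderiv sol) => //; lra.
Qed.

Lemma trajectory_Wnorm t B : hM <= t -> (t%:E < tf)%E -> B <= H ->
  (forall u, - hM <= u <= t -> enorm (x u) <= B) ->
  W hM (seg hM x t) /\ Wnorm hM (seg hM x t) <= Wgain * B.
Proof.
move=> tM ttf BH xB; have hM0 := hM_gt0; have L0 := L_gt0.
have C1 := trajectory_C1_segment tM ttf; split; first exact: (C1_segment_W hM_gt0 C1).
have B0 : 0 <= B by apply: le_trans (enorm_ge0 (x t)) (xB t _); lra.
have x0B : enorm (seg hM x t 0) <= B by rewrite segE ?addr0; [apply: xB|]; lra.
have gB s : - hM <= s <= 0 -> enorm (seg hM velocity t s) <= L * B.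
  move=> sM; rewrite segE//.
  apply: (vector_field_le hM_gt0 f0 H_gt0 L_gt0 f_lip (HH_A zetaH)) => //; first by lra.
    apply: econtW (trajectory_econt ttf) => u /=; rewrite !in_itv/=; lra.
  by move=> u uM; apply: xB; lra.
(* With velocity at most L * B, what remains is 1 + hM L^2 <= Wgain^2. *)
apply: le_trans (C1_segment_Wnorm hM_gt0 C1 x0B gB) _.
rewrite -(@ger0_norm _ (Wgain * B)); last by rewrite mulr_ge0// (le_trans _ Wgain_ge2).
rewrite -sqrtr_sqr ler_sqrt ?sqr_ge0// exprMn [(Wgain * B) ^+ 2]exprMn mulrA.
rewrite -{1}(mul1r (B ^+ 2)) -mulrDl ler_wpM2r ?sqr_ge0// /Wgain.
have : 0 <= hM * L ^+ 2 by rewrite mulr_ge0 ?sqr_ge0// ltW.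
have : 0 <= hM ^+ 2 * L ^+ 2 by rewrite mulr_ge0 ?sqr_ge0// ltW.
have : 0 <= hM * L by rewrite mulr_ge0 ?ltW.
have : 0 <= L ^+ 2 by rewrite sqr_ge0.
rewrite sqrrD exprMn sqrrD; nra.
Qed.

Definition V_along t := V (zeta t) (seg hM x t).

(** Two C^1 segments at close times are close in the W-norm, because x and its velocity are both
    uniformly continuous. *)
Lemma V_along_cont T : (T%:E < tf)%E -> {within `[hM, T], continuous V_along}.
Proof.
move=> Ttf; have hM0 := hM_gt0; apply/rcontP => t; rewrite /= in_itv/= => /andP[tM tT] e e0.
have ttf u : u <= T -> (u%:E < tf)%E by move=> uT; apply: le_lt_trans Ttf; rewrite lee_fin.
have Wx u : hM <= u -> u <= T -> W hM (seg hM x u).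
  move=> uM uT; exact: (C1_segment_W hM_gt0 (trajectory_C1_segment uM (ttf u uT))).
have t0 : 0 <= t by lra.
have [d d0 K] := V_cont (HH_A zetaH t0) (Wx t tM tT) e0.
(* If values and velocities differ by at most eta, the W-norm of the difference is at most eta (1 +
   hM) = d/2. *)
pose eta := d / (2 * (1 + hM)).
have eta0 : 0 < eta by rewrite divr_gt0// mulr_gt0// addr_gt0.
have [|d1 d10 K1] := HH_econt zetaH (t := t) _ d0; first by rewrite /= in_itv/= t0.
have [d2 d20 K2] := econt_uniform (trajectory_econt Ttf) eta0.
have [d3 d30 K3] := econt_uniform (velocity_cont Ttf) eta0.
exists (Num.min d1 (Num.min d2 d3)); first by rewrite !lt_min d10 d20.
move=> u; rewrite in_itv/= => /andP[uM uT]; rewrite !lt_min => /and3P[ud1 ud2 ud3].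
apply: K; [by apply: (HH_A zetaH); lra|exact: Wx|by apply: K1 => //; rewrite /= in_itv/=; lra|].
have CB := C1_segmentB (trajectory_C1_segment uM (ttf u uT))
  (trajectory_C1_segment tM (ttf t tT)).
have b0 : enorm ((seg hM x u \- seg hM x t) 0) <= eta.
  by rewrite /= !seg_at0//; apply/ltW/K2; lra.
have b1 s : - hM <= s <= 0 -> enorm ((seg hM velocity u \- seg hM velocity t) s) <= eta.
  move=> sM; rewrite /= !segE//; apply/ltW/K3; [lra|lra|].
  by rewrite opprD addrACA subrr addr0.
apply: le_lt_trans (C1_segment_Wnorm hM_gt0 CB b0 b1) _.
apply: (@le_lt_trans _ _ (eta * (1 + hM))).
  rewrite -(@ger0_norm _ (eta * (1 + hM))); last by rewrite mulr_ge0 ?addr_ge0// ltW.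
  rewrite -sqrtr_sqr ler_sqrt ?sqr_ge0//.
  have -> : (eta * (1 + hM)) ^+ 2 = eta ^+ 2 * (1 + 2 * hM + hM ^+ 2) by ring.
  have : 0 <= eta ^+ 2 * hM by rewrite mulr_ge0 ?sqr_ge0// ltW.
  have : 0 <= eta ^+ 2 * hM ^+ 2 by rewrite mulr_ge0 ?sqr_ge0.
  rewrite (mulrC hM) !mulrDr mulr1 mulrCA; lra.
have -> : eta * (1 + hM) = d / 2 by rewrite /eta; field; rewrite gt_eqF// addr_gt0.
lra.
Qed.

(* The decay hypothesis only concerns initial states in W, so it is applied to the
   trajectory restarted at time hM. *)
Lemma V_along_growth t : hM <= t -> (t%:E < tf)%E -> QH hM H (seg hM x t) ->
  forall e, 0 < e -> exists2 d, 0 < d & forall h, 0 < h -> h < d ->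
    V_along (t + h) - V_along t <= (- w (enorm (x t)) + e) * h.
Proof.
move=> tM ttf Qt e e0; have hM0 := hM_gt0.
have Mtf : (hM%:E < tf)%E by apply: le_lt_trans ttf; rewrite lee_fin.
have WM := C1_segment_W hM_gt0 (trajectory_C1_segment (lexx hM) Mtf).
have shtraj := trajectory_shift hM_gt0 traj hM_gt0 Mtf.
have HHs : HH (shifted zeta hM) by exact: HH_inv.
have tM0 : 0 <= t - hM by rewrite subr_ge0.
have := V_decay WM HHs shtraj tM0.
rewrite lteBrDr// -EFinD => /(_ _)/wrap[]; first by rewrite subrK.
rewrite shift_seg subrK => /(_ Qt) /dini_le_growth/(_ e e0)[d d0 K].
exists d => // h h0 hd; have := K h h0 hd.
have th0 : 0 <= t - hM + h by rewrite addr_ge0// ltW.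
by rewrite !shift_seg !shiftedE// addrAC subrK.
Qed.

Lemma V_along_decrease t1 t2 (c : R) : hM <= t1 -> t1 <= t2 -> (t2%:E < tf)%E ->
  (forall u, t1 <= u <= t2 -> QH hM H (seg hM x u) /\ c <= w (enorm (x u))) ->
  V_along t2 <= V_along t1 - c * (t2 - t1).
Proof.
move=> t1M t12 t2f K.
have := @dini_growth R V_along t1 t2 (- c) t12.
rewrite mulNr => /(_ _ _)/wrap[]; last by lra.
- apply: continuous_subspaceW (V_along_cont t2f) => u /=.
  by rewrite !in_itv/= => /andP[tu ->]; rewrite (le_trans t1M).
- move=> t t1t tt2 e e0; have [|Qt ct] := K t; first by rewrite t1t ltW.
  have ttf : (t%:E < tf)%E by apply: lt_trans t2f; rewrite lte_fin.
  have [d d0 K'] := V_along_growth (le_trans t1M t1t) ttf Qt e0.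
  exists d => // h h0 hd; apply: le_trans (K' h h0 hd) _.
  by rewrite ler_pM2r// lerD2r lerN2.
Qed.

End Along.

(** The bound e is to hold for all initial sizes up to d. The second clause keeps the states in Q_H
    while |x| <= e, the fourth one settles the times up to hM, and the last one puts V at time hM
    strictly below the level w1 e needed to reach norm e. *)
Definition good_pair e d := [/\ 0 < e, Wgain * e <= H, 0 < d, initial_gain * d < e &
  w2 (Wgain * (initial_gain * d)) < w1 e].

(** Wgain >= 2 makes e < H strict, as the continuation argument of [bounded_trajectory_global]
    requires. *)
Lemma good_pair_lt e d : good_pair e d -> d < e /\ e < H.
Proof.
move=> [e0 eH d0 de _]; have := initial_gain_ge3; have := Wgain_ge2; split; nra.
Qed.

Section Bounded.
Variables (e d : R) (ed : good_pair e d).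
Variables (zeta : R -> 'rV[R]_r) (zetaH : HH zeta).
Variables (x0 : R -> 'rV[R]_n) (x0_C0 : C0 `[- hM, 0] x0) (x0d : supnorm hM x0 <= d).

Lemma good_trajectory_exists : exists tf x, trajectory hM f zeta x0 tf x.
Proof.
have [de eH] := good_pair_lt ed.
apply: (trajectory_exists hM_gt0 f_cont f0 H_gt0 L_gt0 f_lip (HH_econt zetaH)
  (HH_A zetaH) x0_C0).
by apply: le_lt_trans x0d _; exact: lt_trans de eH.
Qed.

Variables (tf : \bar R) (x : R -> 'rV[R]_n) (traj : trajectory hM f zeta x0 tf x).

Let sol : esolution hM f zeta x0 tf x.
Proof. by apply/solutionP; case: traj. Qed.

Lemma good_initial t1 : 0 <= t1 -> (t1%:E < tf)%E ->
  (forall u, - hM <= u <= t1 -> enorm (x u) <= H) ->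
  forall u, - hM <= u -> u <= t1 -> u <= hM -> enorm (x u) <= initial_gain * d.
Proof.
move=> t10 t1f xH u uM ut uh; have [_ _ xi _ _] := sol; have [e0 _ d0 _ _] := ed.
have g3 := initial_gain_ge3.
have [u0|u0] := leP u 0.
  rewrite xi ?uM//; apply: (@le_trans _ _ d); last by nra.
  by apply: le_trans x0d; apply: le_supnorm; rewrite ?uM//; exact: C0_econt.
apply: (@le_trans _ _ (3 * d * expR (2 * L * u))).
  apply: (solution_growth hM_gt0 f0 H_gt0 L_gt0 f_lip (HH_A zetaH) x0_C0 sol t10 t1f) => //.
    by move=> t tM tt; apply: xH; rewrite tM.
  by rewrite (ltW u0).
rewrite /initial_gain mulrAC ler_pM2r// ler_pM2l// ler_expR ler_pM2l// mulr_gt0//.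
Qed.

Lemma good_bound t : - hM <= t -> (t%:E < tf)%E -> enorm (x t) <= e.
Proof.
move=> tM ttf; rewrite leNgt; apply/negP => xt; have hM0 := hM_gt0.
have [e0 eH d0 de w12] := ed; have [lde leH] := good_pair_lt ed.
have [_ _ xi _ _] := sol.
have xinit s : - hM <= s <= 0 -> enorm (x s) <= d.
  by move=> sM; rewrite xi//; apply: le_trans x0d; apply: le_supnorm => //; exact: C0_econt.
have t0 : 0 < t.
  rewrite ltNge; apply/negP => t0; have := xinit t; rewrite tM t0 => /(_ isT); lra.
have xc : {within `[0, t], continuous (fun u => enorm (x u))}.
  apply: enorm_cont; apply: econtW (trajectory_econt traj ttf) => u /=.
  by rewrite !in_itv/=; lra.
have x0e : enorm (x 0) < e by apply: le_lt_trans lde; apply: xinit; lra.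
have [t1 [t10 t1t xt1 xe]] := first_exit (ltW t0) xc x0e xt.
have t1f : (t1%:E < tf)%E by apply: le_lt_trans ttf; rewrite lee_fin.
have xe' u : - hM <= u <= t1 -> enorm (x u) <= e.
  move=> ut; have [u0|u0] := leP u 0; last by apply: xe; lra.
  by apply: le_trans (ltW lde); apply: xinit; lra.
have xH u : - hM <= u <= t1 -> enorm (x u) <= H.
  by move=> /xe' /le_trans; apply; exact: ltW.
have init := good_initial (ltW t10) t1f xH.
have [t1M|t1M] := leP t1 hM.
  by have := init t1; rewrite xt1 => /(_ _ (lexx _) t1M)/wrap[]; lra.
have Qu u : hM <= u <= t1 -> QH hM H (seg hM x u).
  move=> /andP[uM ut]; have uf : (u%:E < tf)%E by apply: le_lt_trans t1f; rewrite lee_fin.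
  have [||Wu Wnu] := @trajectory_Wnorm zeta zetaH x0 tf x traj u e uM uf; first exact: ltW.
    by move=> s su; apply: xe'; lra.
  by split => //; exact: le_trans Wnu eH.
have Mf : (hM%:E < tf)%E by apply: lt_trans t1f; rewrite lte_fin.
have gd0 : initial_gain * d <= H by apply: ltW; apply: lt_trans leH.
(* At time hM the sharper bound initial_gain * d is available on the whole of [-hM, hM]; using it in
   place of e makes w2 of the W-norm smaller than w1 e. *)
have [|_ WM] := @trajectory_Wnorm zeta zetaH x0 tf x traj hM _ (lexx hM) Mf gd0.
  by move=> u uM; apply: init; lra.
have dec := @V_along_decrease zeta zetaH x0 tf x traj hM t1 0 (lexx hM) (ltW t1M) t1f.
have {}dec : V_along zeta x t1 <= V_along zeta x hM.
  rewrite -[leRHS]subr0 -(mul0r (t1 - hM)); apply: dec => u ut; split; first exact: Qu.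
  exact: w_ge0.
have Q1 : QH hM H (seg hM x t1) by apply: Qu; rewrite (ltW t1M) lexx.
have QM : QH hM H (seg hM x hM) by apply: Qu; rewrite (ltW t1M) lexx.
have /andP[lo _] := V_bounds (HH_A zetaH (ltW t10)) Q1; rewrite seg_at0// xt1 in lo.
have /andP[_ hi] := V_bounds (HH_A zetaH (ltW hM0)) QM.
have := classK_le w2_K (sqrtr_ge0 _) WM; rewrite -/(Wnorm hM (seg hM x hM)) => hi2.
move: lo dec; rewrite /V_along; lra.
Qed.

Lemma good_global : tf = +oo%E.
Proof.
have [de eH] := good_pair_lt ed.
apply: (bounded_trajectory_global hM_gt0 f_cont f0 H_gt0 L_gt0 f_lip (HH_econt zetaH)
  (HH_A zetaH) x0_C0 traj eH).
exact: good_bound.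
Qed.

Lemma good_QH t : hM <= t -> QH hM H (seg hM x t).
Proof.
move=> tM; have [_ eH _ _ _] := ed; have [_ leH] := good_pair_lt ed.
have ttf : (t%:E < tf)%E by rewrite good_global ltry.
have [||Wu Wnu] := @trajectory_Wnorm zeta zetaH x0 tf x traj t e tM ttf; first exact: ltW.
  by move=> u /andP[uM ut]; apply: good_bound; rewrite // good_global ltry.
by split => //; exact: le_trans Wnu eH.
Qed.

Lemma good_V_ge0 t : hM <= t -> 0 <= V_along zeta x t.
Proof.
move=> tM; have t0 : 0 <= t by apply: le_trans tM; exact: ltW.
have /andP[lo _] := V_bounds (HH_A zetaH t0) (good_QH tM).
by apply: le_trans lo; exact: classK_ge0.
Qed.

Lemma good_V_init : V_along zeta x hM <= w2 H.
Proof.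
have [Wx Wn] := good_QH (lexx hM).
have /andP[_ hi] := V_bounds (HH_A zetaH (ltW hM_gt0)) (good_QH (lexx hM)).
by apply: le_trans hi _; exact: classK_le w2_K (sqrtr_ge0 _) Wn.
Qed.

Lemma good_V_decrease t1 t2 (c : R) : hM <= t1 -> t1 <= t2 ->
  (forall u, t1 <= u <= t2 -> c <= w (enorm (x u))) ->
  V_along zeta x t2 <= V_along zeta x t1 - c * (t2 - t1).
Proof.
move=> t1M t12 K; apply: (V_along_decrease zetaH traj) => //.
  by rewrite good_global ltry.
by move=> u /[dup] /K cu /andP[tu _]; split => //; apply: good_QH; exact: le_trans tu.
Qed.

Lemma good_speed u h : 0 <= u -> 0 <= h -> enorm (x (u + h) - x u) <= L * e * h.
Proof.
move=> u0 h0; have hM0 := hM_gt0; have [_ leH] := good_pair_lt ed.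
have fin t : (t%:E < tf)%E by rewrite good_global ltry.
have uh : u <= u + h by rewrite lerDl.
have := @mean_value_le _ _ x (fun t => f (zeta t) (seg hM x t)) (fun t => L * e * t)
  (fun=> L * e) u (u + h) uh.
rewrite -mulrBr addrAC subrr add0r; apply.
- by apply: econtW (trajectory_econt traj (fin (u + h))) => t /=; rewrite !in_itv/=; lra.
- by apply: continuous_subspaceT; exact: mulrl_continuous.
- by move=> t ut _; apply: (esolution_rderiv sol) => //; lra.
- move=> t ut _.
  apply: (vector_field_le hM_gt0 f0 H_gt0 L_gt0 f_lip (HH_A zetaH)); [lra| |exact: ltW|].
    by apply: econtW (trajectory_econt traj (fin t)) => s /=; rewrite !in_itv/=; lra.
  by move=> s st; apply: good_bound => //; lra.
- by move=> t s _ _ _; rewrite -mulrBr addrAC subrr add0r.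
Qed.

End Bounded.

Lemma good_attraction e d e' d' : good_pair e d -> good_pair e' d' ->
  (forall s s', 0 <= s -> s <= s' -> w s <= w s') -> 0 < w (d' / 2) ->
  exists T, forall zeta x0 tf x, HH zeta -> C0 `[- hM, 0] x0 -> supnorm hM x0 <= d ->
    trajectory hM f zeta x0 tf x -> forall t, T <= t -> enorm (x t) <= e'.
Proof.
move=> ed ed' wmono wpos; have hM0 := hM_gt0; have L0 := L_gt0.
have [e0 _ _ _ _] := ed; have [_ _ d'0 _ _] := ed'.
(* At speed at most L * e, the norm needs at least time eta to fall from d' to d'/2; meanwhile V
   loses at least c. *)
pose eta := d' / (2 * (L * e)).
have Le0 : 0 < L * e by rewrite mulr_gt0.
have eta0 : 0 < eta by rewrite divr_gt0// mulr_gt0.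
pose c := w (d' / 2) * eta; have c0 : 0 < c by rewrite mulr_gt0.
(* A period is one window of length hM followed by eta, so that the loss after an excursion at the
   very end of the window is completed within the same period. *)
pose tau (k : nat) := hM + k%:R * (hM + eta).
have tauS k : tau k.+1 = tau k + hM + eta by rewrite /tau -natr1; ring.
have tauM k : hM <= tau k by rewrite lerDl mulr_ge0// ?addr_ge0// ltW.
(* N losses of c would exceed w2 H, which bounds V at time hM, and make V negative; so some window
   before [tau N] is small. *)
have [N NP] : exists N : nat, w2 H < N%:R * c.
  exists (Num.truncn (w2 H / c)).+1; rewrite -ltr_pdivrMr//; exact: truncnS_gt.
exists (tau N) => zeta x0 tf x zetaH x0C x0d traj t tT.
have tfoo := good_global ed zetaH x0C x0d traj.
have dich k : (exists a, [/\ hM <= a, a <= tau k & supnorm hM (seg hM x a) <= d']) \/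
    V_along zeta x (tau k) <= V_along zeta x hM - k%:R * c.
  elim: k => [|k [[a [a1 a2 a3]]|IH]].
  - by right; rewrite /tau mul0r addr0 mul0r subr0.
  - by left; exists a; split => //; apply: le_trans a2 _; rewrite tauS; lra.
  have [small|] := pselect (forall u, tau k <= u <= tau k + hM -> enorm (x u) <= d').
    left; exists (tau k + hM); split.
    + by have := tauM k; lra.
    + by rewrite tauS; lra.
    + by apply: supnorm_seg_le => // u uM; apply: small; lra.
  move=> /existsNP[u] /not_implyP[/andP[u1 u2] /negP]; rewrite -ltNge => xu; right.
  have tk := tauM k.
  have step1 : V_along zeta x u <= V_along zeta x (tau k) - 0 * (u - tau k).
    by apply: (good_V_decrease ed zetaH x0C x0d traj) => // s _; exact: w_ge0.
  have step2 : V_along zeta x (u + eta) <=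
      V_along zeta x u - w (d' / 2) * (u + eta - u).
    apply: (good_V_decrease ed zetaH x0C x0d traj); [lra|lra|].
    move=> s su; apply: wmono; first by lra.
    have := @good_speed e d ed zeta zetaH x0 x0C x0d tf x traj u (s - u).
    rewrite (addrC u) subrK => /(_ _ _)/wrap[]; [lra|lra|].
    have : L * e * (s - u) <= L * e * eta by rewrite ler_pM2l//; lra.
    have -> : L * e * eta = d' / 2 by rewrite /eta; field; rewrite !gt_eqF.
    have := enormB (x s) (x s - x u); rewrite subKr; lra.
  have step3 : V_along zeta x (tau k.+1) <=
      V_along zeta x (u + eta) - 0 * (tau k.+1 - (u + eta)).
    apply: (good_V_decrease ed zetaH x0C x0d traj); [lra|rewrite tauS; lra|].
    by move=> s _; exact: w_ge0.
  move: step1 step2 step3; rewrite !mul0r !subr0 (addrC u) addrK -/c -natr1 mulrDl mul1r; lra.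
have [[a [a1 a2 a3]]|VN] := dich N; last first.
  have := good_V_ge0 ed zetaH x0C x0d traj (tauM N).
  have := good_V_init ed zetaH x0C x0d traj; lra.
have a0 : 0 < a by lra.
have af : (a%:E < tf)%E by rewrite tfoo ltry.
(* The state at time a has norm at most d': restarted there, the trajectory stays within e' by the
   second good pair. *)
have shtraj := trajectory_shift hM_gt0 traj a0 af.
have HHs : HH (shifted zeta a) by exact: HH_inv.
have xaC : C0 `[- hM, 0] (seg hM x a).
  apply: seg_C0 => //; apply: econtW (trajectory_econt traj af) => u /=.
  by rewrite !in_itv/=; lra.
have := good_bound ed' HHs xaC a3 shtraj (t := t - a).
rewrite subrK; apply; first by lra.
by rewrite tfoo lteBrDr// ltry.
Qed.

End LyapunovKrasovskii.

Lemma good_pair_exists (R : realType) (hM H L : R) (w1 w2 : R -> R) (e : R) :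
  0 < hM -> 0 < L -> classK w1 -> classK w2 -> 0 < e -> Wgain hM L * e <= H ->
  exists d, good_pair hM H L w1 w2 e d.
Proof.
move=> hM0 L0 w1K w2K e0 eH.
have G0 : 0 < Wgain hM L by rewrite /Wgain ltr_wpDr// mulr_ge0 ?addr_ge0// ltW.
have I0 : 0 < initial_gain hM L by apply: lt_le_trans (initial_gain_ge3 hM0 L0).
have [d d0 K] := classK_small w2K (classK_gt0 w1K e0).
have GI0 : 0 < Wgain hM L * initial_gain hM L by rewrite mulr_gt0.
(* The first entry gives initial_gain * k <= e/2, the second brings the argument of w2 under the
   threshold d where w2 is smaller than w1 e. *)
pose k := Num.min (e / (2 * initial_gain hM L)) (d / (Wgain hM L * initial_gain hM L)).
have k0 : 0 < k by rewrite lt_min !divr_gt0// mulr_gt0.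
exists k; split => //.
  apply: (@le_lt_trans _ _ (e / 2)); last by lra.
  have ke : k <= e / (2 * initial_gain hM L) by rewrite ge_min lexx.
  have := ke; rewrite ler_pdivlMr; last by rewrite mulr_gt0.
  rewrite mulrCA (mulrC k); lra.
apply: K; first by rewrite !mulr_ge0// ltW.
have : k <= d / (Wgain hM L * initial_gain hM L) by rewrite ge_min lexx orbT.
by rewrite ler_pdivlMr// (mulrC k) mulrA.
Qed.

(** * From uniform bounds to comparison functions *)

Section StabilityFromBounds.
Context {R : realType} {r n : nat}.
Variables (hM : R) (hM_gt0 : 0 < hM).
Variables (f : 'rV[R]_r -> (R -> 'rV[R]_n) -> 'rV[R]_n) (HH : set (R -> 'rV[R]_r)).
Implicit Types (s t e d b v : R).

Definition bounded_by e d := forall zeta x0, HH zeta -> C0 `[- hM, 0] x0 ->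
  supnorm hM x0 <= d ->
  (exists tf x, trajectory hM f zeta x0 tf x) /\
  forall tf x, trajectory hM f zeta x0 tf x ->
    tf = +oo%E /\ forall t, 0 <= t -> enorm (x t) <= e.

Definition attracted d e := exists T, forall zeta x0 tf x, HH zeta ->
  C0 `[- hM, 0] x0 -> supnorm hM x0 <= d -> trajectory hM f zeta x0 tf x ->
  forall t, T <= t -> enorm (x t) <= e.

(** The relation handed to [KL_majorant], restricted to initial norms below rho. *)
Definition reach (rho : \bar R) s t v := exists zeta x0 tf x,
  [/\ HH zeta, C0 `[- hM, 0] x0, supnorm hM x0 = s, (s%:E < rho)%E &
      trajectory hM f zeta x0 tf x /\ v = enorm (x t)].

Lemma reach_small (rho : \bar R) :
  (forall e, 0 < e -> exists2 d, 0 < d & bounded_by e d) ->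
  forall e, 0 < e -> exists2 d, 0 < d & forall s t v, 0 <= s <= d -> 0 <= t ->
    reach rho s t v -> v <= e.
Proof.
move=> small e /small[d d0 K]; exists d => // s t v /andP[_ sd] t0.
move=> [zeta [x0 [tf [x [zH x0C x0s _ [traj ->]]]]]].
rewrite -x0s in sd; have [_ /(_ _ _ traj)[_]] := K zeta x0 zH x0C sd; exact.
Qed.

Lemma stable_from_bounds e0 d0 : 0 < d0 -> bounded_by e0 d0 ->
  (forall e, 0 < e -> exists2 d, 0 < d & bounded_by e d) -> stable hM f HH.
Proof.
move=> d00 bnd small.
have [s s0|e e0'|alpha aK aP] := @K_majorant R
    (fun s v => exists2 t, 0 <= t & reach d0%:E s t v).
- exists e0 => s' v _ [t t0 [zeta [x0 [tf [x [zH x0C x0s sd [traj ->]]]]]]].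
  rewrite -x0s lte_fin in sd.
  have [_ /(_ _ _ traj)[_]] := bnd zeta x0 zH x0C (ltW sd); exact.
- have [d dp K] := reach_small d0%:E small e0'; exists d => // s v sd [t t0].
  exact: K.
exists alpha, d0; split => // x0 zeta x0C x0d zH.
have [ex all] := bnd zeta x0 zH x0C (ltW x0d); split => // tf x traj.
have [-> _] := all _ _ traj; split => // t t0.
apply: aP; first by apply: supnorm_ge0 => //; exact: C0_econt.
by exists t => //; exists zeta, x0, tf, x; split.
Qed.

(** The number b caps the initial norms that are both at most s and below rho: it is a fixed radius
    in the local case and s itself in the global case. *)
Lemma uas_from_bounds (rho : \bar R) :
  (forall e, 0 < e -> exists2 d, 0 < d & bounded_by e d) ->
  (forall s, 0 < s -> exists b, [/\ forall s', s' <= s -> (s'%:E < rho)%E -> s' <= b,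
    exists e, bounded_by e b & forall e, 0 < e -> attracted b e]) ->
  uas_within hM f HH rho.
Proof.
move=> small large.
have [s s0|s e s0 e0|beta bKL bP] := @KL_majorant R (reach rho) _ (reach_small rho small) _.
- have [b [sb [e bnd] _]] := large s s0; exists e => s' t v /andP[_ ss] t0.
  move=> [zeta [x0 [tf [x [zH x0C x0s sr [traj ->]]]]]].
  have x0b : supnorm hM x0 <= b by rewrite x0s; exact: sb.
  have [_ /(_ _ _ traj)[_]] := bnd zeta x0 zH x0C x0b; exact.
- have [b [sb _ /(_ e e0)[T TP]]] := large s s0; exists T => s' t v /andP[_ ss] t0 tT.
  move=> [zeta [x0 [tf [x [zH x0C x0s sr [traj ->]]]]]].
  have x0b : supnorm hM x0 <= b by rewrite x0s; exact: sb.
  exact: (TP _ _ _ _ zH x0C x0b traj).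
exists beta => // x0 zeta x0C x0r zH.
have s0 : 0 <= supnorm hM x0 by apply: supnorm_ge0 => //; exact: C0_econt.
(* The initial condition may be zero, whereas [large] asks for a positive size. *)
have s1 : 0 < supnorm hM x0 + 1 by rewrite ltr_wpDl.
have [b [sb [e bnd] _]] := large _ s1.
have x0b : supnorm hM x0 <= b by apply: sb => //; rewrite lerDl.
have [ex all] := bnd zeta x0 zH x0C x0b; split => // tf x traj.
have [-> _] := all _ _ traj; split => // t t0.
by apply: bP => //; exists zeta, x0, tf, x; split.
Qed.

End StabilityFromBounds.

(** * Assembly of the local and global statements *)

Lemma lipschitz_snd_pos (R : realType) (r n : nat) (hM : R) (A : set 'rV[R]_r)
    (S : set (R -> 'rV[R]_n)) f : 0 < hM -> S `<=` C0 `[- hM, 0] ->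
  lipschitz_snd hM A S f -> exists2 L : R, 0 < L & forall xi phi psi, A xi ->
    S phi -> S psi -> enorm (f xi phi - f xi psi) <= L * supnorm hM (phi \- psi).
Proof.
(* The given constant may be 0, but the estimates divide by L, hence [L + 1]. *)
move=> hM0 SC [L L0 LP]; exists (L + 1); first by rewrite ltr_wpDl.
move=> xi phi psi Axi Sphi Spsi; apply: le_trans (LP _ _ _ Axi Sphi Spsi) _.
rewrite ler_wpM2r ?lerDl//; apply: supnorm_ge0 => //.
by apply: econtB; apply: C0_econt; exact: SC.
Qed.

Theorem mainTheorem2 (R : realType) (n r : nat) (hM : R) (hM_gt0 : 0 < hM)
    (A : set 'rV[R]_r) (f : 'rV[R]_r -> (R -> 'rV[R]_n) -> 'rV[R]_n)
    (f_cont : continuous_on_prod A (C0 `[- hM, 0]) (supnorm hM) (@enorm R n) f)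
    (f0 : forall xi, A xi -> f xi (fun=> 0) = 0)
    (f_loclip : locally_lipschitz_snd hM A f)
    (HH : set (R -> 'rV[R]_r))
    (HH_cont : HH `<=` C0 `[0, +oo[)
    (HH_inv : forward_invariant HH)
    (HH_A : forall zeta, HH zeta -> forall t : R, 0 <= t -> A (zeta t)) :
  (forall (H : R) (V : 'rV[R]_r -> (R -> 'rV[R]_n) -> R) (w1 w2 : R -> R),
     0 < H ->
     lipschitz_snd hM A
       [set phi | C0 `[- hM, 0] phi /\ supnorm hM phi <= H] f ->
     continuous_on_prod A (W hM) (Wnorm hM) (fun y : R => `|y|) V ->
     classK w1 -> classK w2 ->
     (forall xi phi, A xi -> QH hM H phi ->
        w1 (enorm (phi 0)) <= V xi phi <= w2 (Wnorm hM phi)) ->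
     dini_decay hM f HH V (QH hM H) (fun=> 0) ->
     stable hM f HH /\
     ((exists2 w3 : R -> R, classK w3 & dini_decay hM f HH V (QH hM H) w3) ->
      locally_uas hM f HH)) /\
  (lipschitz_snd hM A (C0 `[- hM, 0]) f ->
   (exists (V : 'rV[R]_r -> (R -> 'rV[R]_n) -> R) (w1 w2 w3 : R -> R),
      [/\ continuous_on_prod A (W hM) (Wnorm hM) (fun y : R => `|y|) V,
          [/\ classKinf w1, classKinf w2 & classK w3],
          (forall xi phi, A xi -> W hM phi ->
             w1 (enorm (phi 0)) <= V xi phi <= w2 (Wnorm hM phi)) &
          dini_decay hM f HH V (W hM) w3]) ->
   globally_uas hM f HH).
Proof.
split=> [H V w1 w2 H0 lip Vc w1K w2K Vb dec|lip].
  have [|L L0 LP] := lipschitz_snd_pos hM_gt0 _ lip; first by move=> phi [].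
  have flip xi phi psi : A xi -> C0 `[- hM, 0] phi -> supnorm hM phi <= H ->
      C0 `[- hM, 0] psi -> supnorm hM psi <= H ->
      enorm (f xi phi - f xi psi) <= L * supnorm hM (phi \- psi).
    by move=> *; apply: LP.
  have G0 : 0 < Wgain hM L by rewrite /Wgain ltr_wpDr// mulr_ge0 ?addr_ge0// ltW.
  have bounded e d : good_pair hM H L w1 w2 e d -> bounded_by hM f HH e d.
    move=> ed zeta x0 zH x0C x0d; split.
      exact: (good_trajectory_exists hM_gt0 f_cont f0 HH_cont HH_A H0 L0 flip ed zH x0C x0d).
    move=> tf x traj; have tfoo := good_global hM_gt0 f_cont f0 HH_cont HH_inv HH_A H0 L0 flip
      Vc w2K Vb (w := fun=> 0) (fun _ _ => lexx 0) dec ed zH x0C x0d traj.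
    split => // t t0.
    apply: (good_bound hM_gt0 f_cont f0 HH_cont HH_inv HH_A H0 L0 flip
      Vc w2K Vb (w := fun=> 0) (fun _ _ => lexx 0) dec ed zH x0C x0d traj).
      by apply: le_trans t0; rewrite oppr_le0 ltW.
    by rewrite tfoo ltry.
  have small e : 0 < e -> exists e' d, e' <= e /\ good_pair hM H L w1 w2 e' d.
    (* A good pair must satisfy Wgain * e' <= H, so the target e is lowered when it is too large for
       Q_H. *)
    move=> e0; pose e' := Num.min e (H / Wgain hM L).
    have e'0 : 0 < e' by rewrite lt_min e0 divr_gt0.
    have eH : Wgain hM L * e' <= H.
      by rewrite mulrC -ler_pdivlMr// ge_min lexx orbT.
    have [d ed] := good_pair_exists hM_gt0 L0 w1K w2K e'0 eH.
    by exists e', d; split => //; rewrite ge_min lexx.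
  have smallb e : 0 < e -> exists2 d, 0 < d & bounded_by hM f HH e d.
    move=> /small[e' [d [ee ed]]]; exists d; first by case: ed.
    move=> zeta x0 zH x0C x0d; have [ex all] := bounded _ _ ed zeta x0 zH x0C x0d.
    split => // tf x traj; have [-> xb] := all _ _ traj; split => // t t0.
    exact: le_trans (xb t t0) ee.
  have [e0 [d0 [_ ed0]]] := small 1 ltr01.
  have d00 : 0 < d0 by case: ed0.
  split; first exact: (stable_from_bounds hM_gt0 d00 (bounded _ _ ed0) smallb).
  (* The radius d0 of the stability part also serves for attractivity and is the cap b for every
     s. *)
  move=> [w3 w3K dec3]; exists d0 => //; apply: uas_from_bounds => // s s0.
  exists d0; split => [s' _|| e ep].
  - by rewrite lte_fin => /ltW.
  - by exists e0; exact: bounded.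
  have [e' [d [ee ed]]] := small e ep.
  have dp : 0 < d / 2 by rewrite divr_gt0//; case: ed.
  have [T TP] := good_attraction hM_gt0 f_cont f0 HH_cont HH_inv HH_A H0 L0 flip
    Vc w1K w2K Vb (fun s => @classK_ge0 _ _ s w3K) dec3 ed0 ed
    (fun s s' => @classK_le _ _ s s' w3K) (classK_gt0 w3K dp).
  exists T => zeta x0 tf x zH x0C x0d traj t tT.
  exact: le_trans (TP _ _ _ _ zH x0C x0d traj t tT) ee.
move=> [V [w1 [w2 [w3 [Vc [[w1K w1oo] [w2K _] w3K] Vb dec3]]]]].
have [|L L0 LP] := lipschitz_snd_pos hM_gt0 _ lip; first by [].
have G0 : 0 < Wgain hM L by rewrite /Wgain ltr_wpDr// mulr_ge0 ?addr_ge0// ltW.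
have I0 : 0 < initial_gain hM L by apply: lt_le_trans (initial_gain_ge3 hM_gt0 L0).
have VbH H xi phi : A xi -> QH hM H phi ->
    w1 (enorm (phi 0)) <= V xi phi <= w2 (Wnorm hM phi).
  by move=> Axi [Wphi _]; exact: Vb.
have decH H : dini_decay hM f HH V (QH hM H) w3.
  by move=> x0 zeta tf x Wx0 zH traj t t0 ttf [Wt _]; exact: (dec3 _ _ _ _ Wx0 zH traj).
have flip H xi phi psi : A xi -> C0 `[- hM, 0] phi -> supnorm hM phi <= H ->
    C0 `[- hM, 0] psi -> supnorm hM psi <= H ->
    enorm (f xi phi - f xi psi) <= L * supnorm hM (phi \- psi).
  by move=> *; apply: LP.
have w3ge0 s : 0 <= s -> 0 <= w3 s by exact: classK_ge0.
have bounded H e d : 0 < H -> good_pair hM H L w1 w2 e d -> bounded_by hM f HH e d.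
  move=> H0 ed zeta x0 zH x0C x0d; split.
    exact: (good_trajectory_exists hM_gt0 f_cont f0 HH_cont HH_A H0 L0 (flip H) ed zH x0C x0d).
  move=> tf x traj; have tfoo := good_global hM_gt0 f_cont f0 HH_cont HH_inv HH_A H0 L0
    (flip H) Vc w2K (VbH H) w3ge0 (decH H) ed zH x0C x0d traj.
  split => // t t0.
  apply: (good_bound hM_gt0 f_cont f0 HH_cont HH_inv HH_A H0 L0
    (flip H) Vc w2K (VbH H) w3ge0 (decH H) ed zH x0C x0d traj).
    by apply: le_trans t0; rewrite oppr_le0 ltW.
  by rewrite tfoo ltry.
have small e : 0 < e -> exists d, good_pair hM (Wgain hM L * e) L w1 w2 e d.
  by move=> e0; exact: good_pair_exists.
have large d : 0 < d -> exists e, good_pair hM (Wgain hM L * e) L w1 w2 e d.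
  (* This is where w1 has to be unbounded: any initial size d admits a level e with w1 e above the
     largest possible V at time hM. *)
  move=> d0; have /cvgryPgt/(_ (w2 (Wgain hM L * (initial_gain hM L * d))))[M [_ MP]] := w1oo.
  pose e := Num.max (M + 1) (initial_gain hM L * d + 1).
  have eM : M + 1 <= e by rewrite le_max lexx.
  have ed : initial_gain hM L * d + 1 <= e by rewrite le_max lexx orbT.
  have Id : 0 < initial_gain hM L * d by rewrite mulr_gt0.
  by exists e; split => //; [lra|lra|apply: MP; lra].
apply: uas_from_bounds => // [e e0|s s0].
  have [d ed] := small e e0; exists d; first by case: ed.
  by apply: bounded ed; rewrite mulr_gt0.
have [e ed] := large s s0; have e0 : 0 < e by case: ed.
exists s; split => [s' //||e' e'0].
  by exists e; apply: bounded ed; rewrite mulr_gt0.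
have [d' ed'] := small e' e'0.
(* The pairs for the initial bound and for the target were built with different radii;
   [good_attraction] needs one radius that suits both. *)
pose H := Wgain hM L * Num.max e e'.
have H0 : 0 < H by rewrite mulr_gt0// lt_max e0.
have edH : good_pair hM H L w1 w2 e s.
  by case: ed => *; split => //; rewrite ler_pM2l// le_max lexx.
have edH' : good_pair hM H L w1 w2 e' d'.
  by case: ed' => *; split => //; rewrite ler_pM2l// le_max lexx orbT.
have dp : 0 < d' / 2 by rewrite divr_gt0//; case: ed'.
exact: (good_attraction hM_gt0 f_cont f0 HH_cont HH_inv HH_A H0 L0 (flip H)
  Vc w1K w2K (VbH H) w3ge0 (decH H) edH edH'
  (fun s s' => @classK_le _ _ s s' w3K) (classK_gt0 w3K dp)).
Qed.
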